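(* Let $\Phi=(A;A^*;\{E_i\}_{i=0}^d;\{E_i^*\}_{i=0}^d)$ be a Leonard system over a field $\mathbb{K}$ with diameter $d$ and underlying vector space $V$, and let the parameter array of $\Phi$ be given as in (one of) the Cases I, IA, II, IIA, IIB, IIC, III, IV listed in the context. Let $d'$ be a positive integer with $d'\leqslant d$, $\mathcal{A}'$ a $\mathbb{K}$-algebra isomorphic to $\mathrm{Mat}_{d'+1}(\mathbb{K})$, and $V'$ an irreducible left $\mathcal{A}'$-module. Let $\rho$ be an integer with $0\leqslant\rho\leqslant d-d'$. Assume: (a) for Case III, if $d$ is even then either $d'=1$ or $d'$ is even; if $d$ is odd then $d'$ is odd and $\rho$ is even; (b) for Case IV, $(d',\rho)\in\{(1,0),(1,2),(3,0)\}$. Let $\{U_i'\}_{i=0}^{d'}$, $\{U_i^{*\prime}\}_{i=0}^{d'}$ be decompositions of $V'$. Assume that there is a bilinear form $(\cdot|\cdot):V\times V'\rightarrow\mathbb{K}$ satisfying (i)--(iii) below: (i) $(E_i^*V|U_j^{*\prime})=0$ if $i-\rho\ne j$ ($0\leqslant i\leqslant d$, $0\leqslant j\leqslant d'$). (ii) $(E_iV|U_j')=0$ if $i<j$ or $i>j+d-d'$ ($0\leqslant i\leqslant d$, $0\leqslant j\leqslant d'$). (iii) $(\cdot|\cdot)$ has full-rank. Then there is a $\rho$-descendent $\Phi'=(A';A^{*\prime};\{E_i'\}_{i=0}^{d'};\{E_i^{*\prime}\}_{i=0}^{d'})$ of $\Phi$ in $\mathcal{A}'$ such that $E_i'V'=U_i'$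 and $E_i^{*\prime}V'=U_i^{*\prime}$ for $0\leqslant i\leqslant d'$. In particular, $(\cdot|\cdot)$ is $\rho$-balanced with respect to $\Phi$, $\Phi'$. Moreover, $\Phi'$ is unique up to affine transformation.
   Context: Leonard systems. Let $\mathbb{K}$ be a field, $d$ a positive integer, $\mathcal{A}$ a $\mathbb{K}$-algebra isomorphic to $\mathrm{Mat}_{d+1}(\mathbb{K})$, and $V$ an irreducible left $\mathcal{A}$-module (so $\dim V=d+1$). An element of $\mathcal{A}$ is multiplicity-free if it has $d+1$ mutually distinct eigenvalues in $\mathbb{K}$; the primitive idempotent associated with an eigenvalue is the projection (element of $\mathcal{A}$) onto the corresponding eigenspace along the other eigenspaces. A Leonard system in $\mathcal{A}$ (over $\mathbb{K}$, of diameter $d$, with underlying vector space $V$) is a sequence $\Phi=(A;A^*;\{E_i\}_{i=0}^d;\{E_i^*\}_{i=0}^d)$ such that: $A,A^*\in\mathcal{A}$ are multiplicity-free; $\{E_i\}_{i=0}^d$ is an ordering of the primitive idempotents of $A$; $\{E_i^*\}_{i=0}^d$ is an ordering of the primitive idempotents of $A^*$; for $0\leqslant i,j\leqslant d$, $E_i^*AE_j^*=0$ if $|i-j|>1$ and $\ne 0$ if $|i-j|=1$; and $E_iA^*E_j=0$ if $|i-j|>1$ and $\ne0$ if $|i-j|=1$. An affine transformation of $\Phi$ is a Leonard system $(\xi A+\zeta I;\xi^*A^*+\zeta^*I;\{E_i\}_{i=0}^d;\{E_i^*\}_{i=0}^d)$ with $\xi,\xi^*,\zeta,\zeta^*\in\mathbb{K}$,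 $\xi\ne0$, $\xi^*\ne0$. Parameter array. Let $\theta_i$ (resp. $\theta_i^*$) be the eigenvalue of $A$ (resp. $A^*$) associated with $E_i$ (resp. $E_i^*$). It is known that there are scalars $\varphi_1,\dots,\varphi_d\in\mathbb{K}$ (uniquely determined by $\Phi$, and all nonzero) and a $\mathbb{K}$-algebra isomorphism $\mathcal{A}\to\mathrm{Mat}_{d+1}(\mathbb{K})$ sending $A$ to the lower bidiagonal matrix with diagonal $\theta_0,\theta_1,\dots,\theta_d$ and all subdiagonal entries $1$, and $A^*$ to the upper bidiagonal matrix with diagonal $\theta_0^*,\theta_1^*,\dots,\theta_d^*$ and superdiagonal entries $\varphi_1,\dots,\varphi_d$. Let $\phi_1,\dots,\phi_d$ be the scalars obtained in the same way (in the role of the $\varphi_i$) from the Leonard system $\Phi^{\Downarrow}=(A;A^*;\{E_{d-i}\}_{i=0}^d;\{E_i^*\}_{i=0}^d)$; these are also all nonzero. The parameter array of $\Phi$ is $p(\Phi)=(\{\theta_i\}_{i=0}^d;\{\theta_i^*\}_{i=0}^d;\{\varphi_i\}_{i=1}^d;\{\phi_i\}_{i=1}^d)$. Balanced bilinear forms. Let $\Phi'$ be a Leonard system over $\mathbb{K}$ with diameter $d'\leqslant d$ and underlying vector space $V'$ (objects associated with $\Phi'$ carry a prime). A nonzero bilinear form $(\cdot|\cdot):V\times V'\to\mathbb{K}$ is balanced with respect to $\Phi,\Phi'$ if: (B1) there is an integer $\rho$ ($0\leqslant\rho\leqslant d-d'$) such that $(E_i^*V|E_j^{*\prime}V')=0$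 whenever $i-\rho\ne j$ ($0\leqslant i\leqslant d$, $0\leqslant j\leqslant d'$); (B2) $(E_iV|E_j'V')=0$ whenever $i<j$ or $i>j+d-d'$ ($0\leqslant i\leqslant d$, $0\leqslant j\leqslant d'$). With this $\rho$ (the endpoint) the form is called $\rho$-balanced. $\Phi'$ is called a $\rho$-descendent of $\Phi$ if a $\rho$-balanced bilinear form with respect to $\Phi,\Phi'$ exists. A bilinear form $(\cdot|\cdot):V\times V'\to\mathbb{K}$ (with $\dim V'\leqslant\dim V$) has full-rank if $v'\in V'$ and $(v|v')=0$ for all $v\in V$ imply $v'=0$. A decomposition of $V'$ is a sequence $\{U_i'\}_{i=0}^{d'}$ of one-dimensional subspaces of $V'$ such that $V'=U_0'+U_1'+\dots+U_{d'}'$ (direct sum). List of parameter arrays. It is known that the parameter array of every Leonard system over $\mathbb{K}$ of diameter $d$ has at least one of the following forms, where $\theta_i,\theta_i^*,\varphi_i,\phi_i\in\mathbb{K}$ and the scalars $q,h,h^*,r,r_1,r_2,s,s^*$ lie in the algebraic closure of $\mathbb{K}$. The formulas for $\theta_i,\theta_i^*$ are for $0\leqslant i\leqslant d$ and those for $\varphi_i,\phi_i$ are for $1\leqslant i\leqslant d$. (I) $p(\mathrm{I};q,h,h^*,r_1,r_2,s,s^*,\theta_0,\theta_0^*,d)$, where $r_1r_2=ss^*q^{d+1}$: $\theta_i=\theta_0+h(1-q^i)(1-sq^{i+1})q^{-i}$, $\theta_i^*=\theta_0^*+h^*(1-q^i)(1-s^*q^{i+1})q^{-i}$, $\varphi_i=hh^*q^{1-2i}(1-q^i)(1-q^{i-d-1})(1-r_1q^i)(1-r_2q^i)$,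 $\phi_i=hh^*q^{1-2i}(1-q^i)(1-q^{i-d-1})(r_1-s^*q^i)(r_2-s^*q^i)/s^*$ if $s^*\ne0$, and $\phi_i=hh^*q^{d+2-2i}(1-q^i)(1-q^{i-d-1})(s-r_1q^{i-d-1}-r_2q^{i-d-1})$ if $s^*=0$. (IA) $p(\mathrm{IA};q,h^*,r,s,\theta_0,\theta_0^*,d)$: $\theta_i=\theta_0-sq(1-q^i)$, $\theta_i^*=\theta_0^*+h^*(1-q^i)q^{-i}$, $\varphi_i=-rh^*q^{1-i}(1-q^i)(1-q^{i-d-1})$, $\phi_i=h^*q^{d+2-2i}(1-q^i)(1-q^{i-d-1})(s-rq^{i-d-1})$. (II) $p(\mathrm{II};h,h^*,r_1,r_2,s,s^*,\theta_0,\theta_0^*,d)$, where $r_1+r_2=s+s^*+d+1$: $\theta_i=\theta_0+hi(i+1+s)$, $\theta_i^*=\theta_0^*+h^*i(i+1+s^* )$, $\varphi_i=hh^*i(i-d-1)(i+r_1)(i+r_2)$, $\phi_i=hh^*i(i-d-1)(i+s^*-r_1)(i+s^*-r_2)$. (IIA) $p(\mathrm{IIA};h,r,s,s^*,\theta_0,\theta_0^*,d)$: $\theta_i=\theta_0+hi(i+1+s)$, $\theta_i^*=\theta_0^*+s^*i$, $\varphi_i=hs^*i(i-d-1)(i+r)$, $\phi_i=hs^*i(i-d-1)(i+r-s-d-1)$. (IIB) $p(\mathrm{IIB};h^*,r,s,s^*,\theta_0,\theta_0^*,d)$: $\theta_i=\theta_0+si$, $\theta_i^*=\theta_0^*+h^*i(i+1+s^*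 )$, $\varphi_i=h^*si(i-d-1)(i+r)$, $\phi_i=-h^*si(i-d-1)(i+s^*-r)$. (IIC) $p(\mathrm{IIC};r,s,s^*,\theta_0,\theta_0^*,d)$: $\theta_i=\theta_0+si$, $\theta_i^*=\theta_0^*+s^*i$, $\varphi_i=ri(i-d-1)$, $\phi_i=(r-ss^* )i(i-d-1)$. (III) $p(\mathrm{III};h,h^*,r_1,r_2,s,s^*,\theta_0,\theta_0^*,d)$, where $r_1+r_2=-s-s^*+d+1$: $\theta_i=\theta_0+h(s-1+(1-s+2i)(-1)^i)$, $\theta_i^*=\theta_0^*+h^*(s^*-1+(1-s^*+2i)(-1)^i)$; for $d$ even: $\varphi_i=-4hh^*i(i+r_1)$ and $\phi_i=4hh^*i(i-s^*-r_1)$ if $i$ is even, $\varphi_i=-4hh^*(i-d-1)(i+r_2)$ and $\phi_i=4hh^*(i-d-1)(i-s^*-r_2)$ if $i$ is odd; for $d$ odd: $\varphi_i=\phi_i=-4hh^*i(i-d-1)$ if $i$ is even, $\varphi_i=-4hh^*(i+r_1)(i+r_2)$ and $\phi_i=-4hh^*(i-s^*-r_1)(i-s^*-r_2)$ if $i$ is odd. (IV) $p(\mathrm{IV};h,h^*,r,s,s^*,\theta_0,\theta_0^* )$, where $\mathrm{char}(\mathbb{K})=2$, $d=3$: $\theta_1=\theta_0+h(s+1)$, $\theta_2=\theta_0+h$, $\theta_3=\theta_0+hs$; $\theta_1^*=\theta_0^*+h^*(s^*+1)$, $\theta_2^*=\theta_0^*+h^*$, $\theta_3^*=\theta_0^*+h^*s^*$;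 $\varphi_1=hh^*r$, $\varphi_2=hh^*$, $\varphi_3=hh^*(r+s+s^* )$; $\phi_1=hh^*(r+s(1+s^* ))$, $\phi_2=hh^*$, $\phi_3=hh^*(r+s^*(1+s))$. *)

(* Defs.v *)
From HB Require Import structures.
From mathcomp Require Import all_boot all_order all_algebra.

Set Implicit Arguments.
Unset Strict Implicit.
Unset Printing Implicit Defensive.

Import GRing.Theory.
Local Open Scope ring_scope.

Definition matrix_algebra (K : fieldType) (calA : algType K) (d : nat) : Prop :=
  exists f : {lrmorphism calA -> 'M[K]_d.+1}, bijective f.

(* [act a] is the map [v |-> a v]. *)
Definition left_module (K : fieldType) (calA : algType K) (V : vectType K)
    (act : {linear calA -> 'End(V)}) : Prop :=
  act 1 = \1%VF /\ forall a b : calA, act (a * b) = (act a \o act b)%VF.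

Definition irreducible_module (K : fieldType) (calA : algType K)
    (V : vectType K) (act : {linear calA -> 'End(V)}) : Prop :=
  [/\ left_module act,
      (fullv : {vspace V}) <> 0%VS &
      forall W : {vspace V}, (forall a : calA, (act a @: W <= W)%VS) ->
        W = 0%VS \/ W = fullv].

Section LeonardSystem.

Variables (K : fieldType) (calA : algType K) (V : vectType K).
Variables (act : {linear calA -> 'End(V)}) (d : nat).

Definition multiplicity_free (a : calA) : Prop :=
  exists th : 'I_d.+1 -> K,
    injective th /\ forall i, passmx.leigenvalue (act a) (th i).

(* [e] acts as the projection onto the [th]-eigenspace of [a] along the other
   eigenspaces; for multiplicity-free [a] the eigenspaces span [V]. *)
Definition primitive_idempotent (a : calA) (th : K) (e : calA) : Prop :=
  [/\ passmx.leigenvalue (act a) th,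
      forall v, v \in passmx.leigenspace (act a) th -> act e v = v &
      forall mu v, mu != th -> v \in passmx.leigenspace (act a) mu ->
        act e v = 0].

Definition primitive_idempotent_ordering (a : calA) (E : 'I_d.+1 -> calA) :
    Prop :=
  injective E /\
  forall e : calA, (exists i, E i = e) <->
                   (exists th, primitive_idempotent a th e).

Record leonard_seq := LeonardSeq {
  ls_A : calA;
  ls_As : calA;
  ls_E : 'I_d.+1 -> calA;
  ls_Es : 'I_d.+1 -> calA
}.

Definition tridiagonal_relations (E : 'I_d.+1 -> calA) (a : calA) : Prop :=
  forall i j : 'I_d.+1,
    ((1 < `|i - j|)%N -> E i * a * E j = 0) /\
    (`|i - j|%N = 1%N -> E i * a * E j <> 0).

Definition leonard_system (Phi : leonard_seq) : Prop :=
  [/\ multiplicity_free (ls_A Phi) /\ multiplicity_free (ls_As Phi),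
      primitive_idempotent_ordering (ls_A Phi) (ls_E Phi),
      primitive_idempotent_ordering (ls_As Phi) (ls_Es Phi),
      tridiagonal_relations (ls_Es Phi) (ls_A Phi) &
      tridiagonal_relations (ls_E Phi) (ls_As Phi)].

Definition affine_transformation (Phi Psi : leonard_seq) : Prop :=
  leonard_system Psi /\
  exists xi xis zeta zetas : K,
    [/\ xi != 0 /\ xis != 0,
        ls_A Psi = xi *: ls_A Phi + zeta%:A,
        ls_As Psi = xis *: ls_As Phi + zetas%:A,
        forall i, ls_E Psi i = ls_E Phi i &
        forall i, ls_Es Psi i = ls_Es Phi i].

Definition down (Phi : leonard_seq) : leonard_seq :=
  LeonardSeq (ls_A Phi) (ls_As Phi)
             (fun i => ls_E Phi (rev_ord i)) (ls_Es Phi).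

Definition lower_bidiag (th : 'I_d.+1 -> K) : 'M[K]_d.+1 :=
  \matrix_(i, j) if i == j then th i else (i == j.+1 :> nat)%:R.

(* Indexed by [nat], but only the entries [vphi 1, ..., vphi d] are used:
   entry [(j - 1, j)] of the matrix is [vphi j]. *)
Definition upper_bidiag (th : 'I_d.+1 -> K) (vphi : nat -> K) : 'M[K]_d.+1 :=
  \matrix_(i, j) if i == j then th i else
                 if j == i.+1 :> nat then vphi j else 0.

Definition eigenvalues_and_split (Phi : leonard_seq)
    (th ths : 'I_d.+1 -> K) (vphi : nat -> K) : Prop :=
  [/\ forall i, primitive_idempotent (ls_A Phi) (th i) (ls_E Phi i),
      forall i, primitive_idempotent (ls_As Phi) (ths i) (ls_Es Phi i) &
      exists f : {lrmorphism calA -> 'M[K]_d.+1},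
        [/\ bijective f, f (ls_A Phi) = lower_bidiag th &
            f (ls_As Phi) = upper_bidiag ths vphi]].

End LeonardSystem.

(* Only the entries of index [1, ..., d] of [pa_vphi] and [pa_phi] matter. *)
Record param_array (K : fieldType) (d : nat) := ParamArray {
  pa_th : 'I_d.+1 -> K;
  pa_ths : 'I_d.+1 -> K;
  pa_vphi : nat -> K;
  pa_phi : nat -> K
}.

Definition parameter_array_of (K : fieldType) (calA : algType K)
    (V : vectType K) (act : {linear calA -> 'End(V)}) (d : nat)
    (Phi : leonard_seq calA d) (p : param_array K d) : Prop :=
  eigenvalues_and_split act Phi (pa_th p) (pa_ths p) (pa_vphi p) /\
  eigenvalues_and_split act (down Phi)
    (fun i => pa_th p (rev_ord i)) (pa_ths p) (pa_phi p).

Definition algebraic_closure (K : fieldType) (L : closedFieldType)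
    (iota : {rmorphism K -> L}) : Prop :=
  forall x : L, algebraicOver iota x.

Variant pa_case :=
  CaseI | CaseIA | CaseII | CaseIIA | CaseIIB | CaseIIC | CaseIII | CaseIV.

Section List.

Variables (K : fieldType) (L : closedFieldType) (iota : {rmorphism K -> L}).
Variables (d : nat) (p : param_array K d).

Local Notation th0 := (iota (pa_th p ord0)).
Local Notation ths0 := (iota (pa_ths p ord0)).
Local Notation D := (d%:R : L).

Definition pa_given_by (th ths vphi phi : nat -> L) : Prop :=
  [/\ forall i : 'I_d.+1, iota (pa_th p i) = th i,
      forall i : 'I_d.+1, iota (pa_ths p i) = ths i,
      forall i : nat, (1 <= i <= d)%N -> iota (pa_vphi p i) = vphi i &
      forall i : nat, (1 <= i <= d)%N -> iota (pa_phi p i) = phi i].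

Definition pa_I : Prop :=
  exists q h hs r1 r2 s ss : L,
  [/\ q != 0, r1 * r2 = s * ss * q ^+ d.+1 &
  pa_given_by
    (fun i => th0 + h * (1 - q ^+ i) * (1 - s * q ^+ i.+1) * q ^- i)
    (fun i => ths0 + hs * (1 - q ^+ i) * (1 - ss * q ^+ i.+1) * q ^- i)
    (fun i => h * hs * q ^ (1 - 2 * i%:Z) * (1 - q ^+ i)
              * (1 - q ^ (i%:Z - d%:Z - 1))
              * (1 - r1 * q ^+ i) * (1 - r2 * q ^+ i))
    (fun i => if ss != 0 then
                h * hs * q ^ (1 - 2 * i%:Z) * (1 - q ^+ i)
                * (1 - q ^ (i%:Z - d%:Z - 1))
                * (r1 - ss * q ^+ i) * (r2 - ss * q ^+ i) / ss
              else
                h * hs * q ^ (d%:Z + 2 - 2 * i%:Z) * (1 - q ^+ i)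
                * (1 - q ^ (i%:Z - d%:Z - 1))
                * (s - r1 * q ^ (i%:Z - d%:Z - 1)
                     - r2 * q ^ (i%:Z - d%:Z - 1)))].

Definition pa_IA : Prop :=
  exists q hs r s : L,
  q != 0 /\
  pa_given_by
    (fun i => th0 - s * q * (1 - q ^+ i))
    (fun i => ths0 + hs * (1 - q ^+ i) * q ^- i)
    (fun i => - r * hs * q ^ (1 - i%:Z) * (1 - q ^+ i)
              * (1 - q ^ (i%:Z - d%:Z - 1)))
    (fun i => hs * q ^ (d%:Z + 2 - 2 * i%:Z) * (1 - q ^+ i)
              * (1 - q ^ (i%:Z - d%:Z - 1))
              * (s - r * q ^ (i%:Z - d%:Z - 1))).

Definition pa_II : Prop :=
  exists h hs r1 r2 s ss : L,
  r1 + r2 = s + ss + D + 1 /\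
  pa_given_by
    (fun i => th0 + h * i%:R * (i%:R + 1 + s))
    (fun i => ths0 + hs * i%:R * (i%:R + 1 + ss))
    (fun i => h * hs * i%:R * (i%:R - D - 1) * (i%:R + r1) * (i%:R + r2))
    (fun i => h * hs * i%:R * (i%:R - D - 1)
              * (i%:R + ss - r1) * (i%:R + ss - r2)).

Definition pa_IIA : Prop :=
  exists h r s ss : L,
  pa_given_by
    (fun i => th0 + h * i%:R * (i%:R + 1 + s))
    (fun i => ths0 + ss * i%:R)
    (fun i => h * ss * i%:R * (i%:R - D - 1) * (i%:R + r))
    (fun i => h * ss * i%:R * (i%:R - D - 1) * (i%:R + r - s - D - 1)).

Definition pa_IIB : Prop :=
  exists hs r s ss : L,
  pa_given_by
    (fun i => th0 + s * i%:R)
    (fun i => ths0 + hs * i%:R * (i%:R + 1 + ss))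
    (fun i => hs * s * i%:R * (i%:R - D - 1) * (i%:R + r))
    (fun i => - hs * s * i%:R * (i%:R - D - 1) * (i%:R + ss - r)).

Definition pa_IIC : Prop :=
  exists r s ss : L,
  pa_given_by
    (fun i => th0 + s * i%:R)
    (fun i => ths0 + ss * i%:R)
    (fun i => r * i%:R * (i%:R - D - 1))
    (fun i => (r - s * ss) * i%:R * (i%:R - D - 1)).

Definition pa_III : Prop :=
  exists h hs r1 r2 s ss : L,
  r1 + r2 = - s - ss + D + 1 /\
  pa_given_by
    (fun i => th0 + h * (s - 1 + (1 - s + 2 * i%:R) * (- 1) ^+ i))
    (fun i => ths0 + hs * (ss - 1 + (1 - ss + 2 * i%:R) * (- 1) ^+ i))
    (fun i =>
       if ~~ odd d then
         if ~~ odd i then - 4 * h * hs * i%:R * (i%:R + r1)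
         else - 4 * h * hs * (i%:R - D - 1) * (i%:R + r2)
       else
         if ~~ odd i then - 4 * h * hs * i%:R * (i%:R - D - 1)
         else - 4 * h * hs * (i%:R + r1) * (i%:R + r2))
    (fun i =>
       if ~~ odd d then
         if ~~ odd i then 4 * h * hs * i%:R * (i%:R - ss - r1)
         else 4 * h * hs * (i%:R - D - 1) * (i%:R - ss - r2)
       else
         if ~~ odd i then - 4 * h * hs * i%:R * (i%:R - D - 1)
         else - 4 * h * hs * (i%:R - ss - r1) * (i%:R - ss - r2)).

Definition pa_IV : Prop :=
  [/\ 2%N \in [pchar K], d = 3%N &
  exists h hs r s ss : L,
  pa_given_by
    (fun i => match i with
              | 0 => th0
              | 1 => th0 + h * (s + 1)
              | 2 => th0 + h
              | _ => th0 + h * s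
              end)
    (fun i => match i with
              | 0 => ths0
              | 1 => ths0 + hs * (ss + 1)
              | 2 => ths0 + hs
              | _ => ths0 + hs * ss
              end)
    (fun i => match i with
              | 1 => h * hs * r
              | 2 => h * hs
              | _ => h * hs * (r + s + ss)
              end)
    (fun i => match i with
              | 1 => h * hs * (r + s * (1 + ss))
              | 2 => h * hs
              | _ => h * hs * (r + ss * (1 + s))
              end)].

Definition pa_form (c : pa_case) : Prop :=
  match c with
  | CaseI => pa_I
  | CaseIA => pa_IA
  | CaseII => pa_II
  | CaseIIA => pa_IIA
  | CaseIIB => pa_IIB
  | CaseIIC => pa_IIC
  | CaseIII => pa_III
  | CaseIV => pa_IV
  end.

End List.

Definition decomposition (K : fieldType) (V : vectType K) (d : nat)
    (U : 'I_d.+1 -> {vspace V}) : Prop :=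
  [/\ forall i, \dim (U i) = 1%N,
      (\sum_i U i)%VS = fullv &
      directv (\sum_i U i)].

Section Forms.

Variables (K : fieldType) (V V' : vectType K).
Variable B : {bilinear V -> V' -> K | *%R & *%R}.

Definition orthogonal_spaces (W : {vspace V}) (W' : {vspace V'}) : Prop :=
  forall v v', v \in W -> v' \in W' -> B v v' = 0.

Definition full_rank : Prop := forall v' : V', (forall v, B v v' = 0) -> v' = 0.

Variables (calA calA' : algType K).
Variables (act : {linear calA -> 'End(V)}) (act' : {linear calA' -> 'End(V')}).
Variables (d d' : nat).

Definition balanced_form (rho : nat) (Phi : leonard_seq calA d)
    (Phi' : leonard_seq calA' d') : Prop :=
  [/\ exists v v', B v v' != 0,
      (rho <= d - d')%N,
      forall (i : 'I_d.+1) (j : 'I_d'.+1), (i : nat) <> (j + rho)%N ->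
        orthogonal_spaces (limg (act (ls_Es Phi i))) (limg (act' (ls_Es Phi' j))) &
      forall (i : 'I_d.+1) (j : 'I_d'.+1),
        (i < j)%N \/ (j + (d - d') < i)%N ->
        orthogonal_spaces (limg (act (ls_E Phi i))) (limg (act' (ls_E Phi' j)))].

End Forms.

Definition descendent (K : fieldType) (V V' : vectType K)
    (calA calA' : algType K)
    (act : {linear calA -> 'End(V)}) (act' : {linear calA' -> 'End(V')})
    (d d' rho : nat) (Phi : leonard_seq calA d) (Phi' : leonard_seq calA' d') :
    Prop :=
  [/\ (d' <= d)%N, leonard_system act' Phi' &
      exists B : {bilinear V -> V' -> K | *%R & *%R},
        balanced_form B act act' rho Phi Phi'].

(* Main.v *)
Require Import Defs.
From HB Require Import structures.
From mathcomp Require Import all_boot all_order all_algebra.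
From mathcomp Require Import perm ring zify.

Set Implicit Arguments.
Unset Strict Implicit.
Unset Printing Implicit Defensive.

Import GRing.Theory.
Local Open Scope ring_scope.

(** Write [n] for [d']. Let [v] span [E_0 V] and put [e_i = E*_i v]; none of
    these vectors vanishes. By full rank the functionals [B(e_(rho+m), .)],
    [0 <= m <= n], form a basis of the dual of [V'], and [Us' m] are the lines
    of the dual basis. In these coordinates the space [V'] pairs with functions
    on the nodes [x_m = theta*_(rho+m)]. Since [E_0 V + ... + E_k V] is spanned
    by the [A*^i v], [i <= k], condition (ii) says that [U' j] annihilates the
    polynomials of degree less than [j], and, starting from [E_d V], that it
    annihilates [g] times the polynomials of degree less than [n - j], where
    [g_i = E*_i E_d V / E*_i E_0 V] satisfies [phi_i g_(i-1) = vphi_i g_i]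
    (lemmas [form_matrix_low], [form_matrix_high], [split_ratio]).

    Multiplication by [x] raises the degree by one, hence acts on the lines
    [U' j] by an irreducible tridiagonal matrix
    ([nodes_irreducible_tridiagonal]); this gives [A*']. For [A'] one needs a
    tridiagonal operator [Y] on functions of the nodes which preserves the two
    filtrations, by degree and by [g] times degree: then every [U' j] is an
    eigenline of its transpose ([diagonal_of_two_filtrations]). If the
    eigenvalues are distinct, [Y] is automatically irreducible, since
    otherwise a coordinate subspace would be stable under both operators
    ([irreducible_of_tridiagonal]).

    The operator is of Askey-Wilson type. Three consecutive nodes satisfy
    [y + z = beta x + gamma], with [y] and [z] the roots of a quadratic
    depending on [x]; a three-term operator preserves the degree as soon as it does so on
    [1] and [x] and its diagonal times [(x - y)(x - z)] is quadratic in [x]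
    ([degree_preserving]). Lagrange interpolation at [y] and [z] of
    [t |-> U(x, t) N(x, t) / (t - x)], with [U] and [N] affine, produces such
    operators ([product_degree_operator]): [N] is read off from
    [vphi_i = f_i N(x_(i-1), x_i)], [phi_i = f_i N(x_i, x_(i-1))], and [U] is
    determined up to a factor by vanishing at the two ends of the window. Up to
    an affine transformation, the eigenvalues of the operator are those of [A]
    with the index shifted by [(d - n) / 2], so that their distinctness follows
    from that of the [theta_i]. In Case III with [d] odd the operator is given
    by separate formulas for the two parities of the row
    ([parity_degree_operator]); for [n = d] it is the adjoint of [A], and for
    [n = 1] every matrix is tridiagonal. The operator is found over the
    algebraic closure and brought down to [K] by linear algebra
    ([tridiagonal_descent]).

    For uniqueness, a tridiagonal matrix which is diagonal on the [U' j] is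
    determined, up to adding and multiplying by scalars, by its first row,
    because the first basis vector has a component on every [U' j]
    ([tridiagonal_unique]). *)

(** * Tridiagonal matrices and the degree filtration *)

Definition far (i j : nat) := (i.+1 < j)%N || (j.+1 < i)%N.
Definition adjacent (i j : nat) := (j == i.+1) || (i == j.+1).

Section Tridiagonal.
Variables (F : fieldType) (n : nat).
Implicit Types (M Q Y : 'M[F]_n.+1).

Definition tridiagonal M := forall i j : 'I_n.+1, far i j -> M i j = 0.
Definition irreducible_tridiagonal M :=
  tridiagonal M /\ forall i j : 'I_n.+1, adjacent i j -> M i j != 0.

Lemma trichotomy (i j : nat) : [|| i == j, adjacent i j | far i j].
Proof. rewrite /adjacent /far; lia. Qed.

Definition annihilates_low_degrees Q (x : 'I_n.+1 -> F) :=
  forall j k : 'I_n.+1, (k < j)%N -> \sum_m Q j m * x m ^+ k = 0.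

(** The matrix [Q] times the Vandermonde matrix is triangular and
    invertible. *)
Lemma vandermonde_diag_neq0 Q (x : 'I_n.+1 -> F) :
  Q \in unitmx -> injective x ->
  annihilates_low_degrees Q x ->
  forall j : 'I_n.+1, \sum_m Q j m * x m ^+ j != 0.
Proof.
move=> Qu xinj Q0 j.
pose W := Vandermonde n.+1 (\row_m x m) *m Q^T.
have WE k i : W k i = \sum_m Q i m * x m ^+ k.
  by rewrite mxE; apply: eq_bigr => m _; rewrite !mxE mulrC.
have: \det W != 0.
  rewrite det_mulmx mulf_neq0 // ?det_tr -?unitfE ?[_ \is a _]Qu //.
  rewrite det_Vandermonde; rewrite unitfE.
  apply/prodf_neq0 => i _; apply/prodf_neq0 => k ik.
  rewrite !mxE subr_eq0; apply/eqP => /xinj ki.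
  by rewrite ki ltnn in ik.
rewrite det_trig; last first.
  by apply/is_trig_mxP => k i ki; rewrite WE Q0.
by move/prodf_neq0/(_ j isT); rewrite WE.
Qed.

(** Read on columns of values of polynomials at the nodes, [Q j] annihilates
    the polynomials of degree less than [j], so that an operator preserving
    the degree filtration acts on the rows of [Q] by a triangular matrix. *)
Lemma triangular_of_degree_preserving Q Y (Z : 'M_n.+1) (x : 'I_n.+1 -> F)
    (lam : nat -> F) :
  Q *m Y = Z *m Q ->
  annihilates_low_degrees Q x ->
  (forall j : 'I_n.+1, \sum_m Q j m * x m ^+ j != 0) ->
  (forall k : nat, exists2 f : {poly F}, (size f <= k)%N &
     forall m, \sum_l Y m l * x l ^+ k = lam k * x m ^+ k + f.[x m]) ->
  forall j k : 'I_n.+1, (k <= j)%N -> Z j k = lam j *+ (k == j).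
Proof.
move=> QY Q0 Qn0 Ydeg j.
have rel (k : nat) : \sum_l Z j l * \sum_m Q l m * x m ^+ k =
    \sum_m Q j m * \sum_l Y m l * x l ^+ k.
  transitivity (\sum_m (Z *m Q) j m * x m ^+ k).
    under [RHS]eq_bigr => m _ do rewrite mxE mulr_suml.
    rewrite exchange_big; apply: eq_bigr => l _; rewrite mulr_sumr.
    by apply: eq_bigr => m _; rewrite mulrA.
  rewrite -QY; under eq_bigr => m _ do rewrite mxE mulr_suml.
  rewrite exchange_big; apply: eq_bigr => l _; rewrite mulr_sumr.
  by apply: eq_bigr => m _; rewrite mulrA.
have poly0 (f : {poly F}) : (size f <= j)%N -> \sum_m Q j m * f.[x m] = 0.
  move=> sf; under eq_bigr => m _ do rewrite horner_coef mulr_sumr.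
  rewrite exchange_big big1 // => -[i i_lt] _ /=.
  under eq_bigr => m _ do rewrite mulrCA.
  have ij : (i < j)%N by apply: leq_trans sf.
  rewrite -mulr_sumr.
  by have /= -> := Q0 j (Ordinal (ltn_trans ij (ltn_ord j))) ij; rewrite mulr0.
have rhs (k : 'I_n.+1) : (k <= j)%N ->
    \sum_m Q j m * \sum_l Y m l * x l ^+ k =
    lam k * \sum_m Q j m * x m ^+ k.
  move=> kj; have [f sf fE] := Ydeg k.
  under eq_bigr => m _ do rewrite fE mulrDr mulrCA.
  by rewrite big_split -mulr_sumr /= poly0 ?addr0 // (leq_trans sf).
suff H (N : nat) (k : 'I_n.+1) : (k < N)%N -> (k <= j)%N ->
    Z j k = lam j *+ (k == j) by move=> k; apply: (H k.+1).
elim: N k => // N IH k kN kj.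
have lower : \sum_(l | l != k) Z j l * \sum_m Q l m * x m ^+ k = 0.
  apply: big1 => l lk; case: (ltnP l k) => [l_lt|k_le].
    rewrite IH ?(leq_trans l_lt) ?(leq_trans (ltnW l_lt)) //.
    have -> : (l == j) = false by apply/eqP => lj; rewrite lj in l_lt; lia.
    by rewrite mulr0n mul0r.
  by rewrite Q0 ?mulr0 // ltn_neqAle k_le andbT eq_sym.
have := rel k; rewrite (rhs k kj) (bigD1 k) //= lower addr0.
case: eqP => [->|kj'].
  by move/(mulIf (Qn0 j)) => ->.
rewrite (Q0 j k); last by rewrite ltn_neqAle kj andbT; apply/eqP => /val_inj.
by rewrite mulr0 => /eqP; rewrite mulf_eq0 (negPf (Qn0 k)) orbF => /eqP.
Qed.

(** That this matrix annihilates low degrees means that [Q j] annihilates [g]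
    times the polynomials of degree less than [n - j]. *)
Definition reversed Q (g : 'I_n.+1 -> F) : 'M[F]_n.+1 :=
  \matrix_(j, m) (Q (rev_ord j) m * g m).

Lemma reversed_unit Q (g : 'I_n.+1 -> F) :
  (forall m, g m != 0) -> Q \in unitmx -> reversed Q g \in unitmx.
Proof.
move=> gn0 Qu.
have -> : reversed Q g =
    row_perm (perm (@rev_ord_inj n.+1)) Q *m diag_mx (\row_m g m).
  by apply/matrixP => j m; rewrite mul_mx_diag !mxE permE.
rewrite unitmx_mul row_permE unitmx_mul unitmx_perm Qu unitmxE det_diag unitfE.
by apply/prodf_neq0 => i _; rewrite mxE.
Qed.

(** The rows of [Q] are eigenvectors as soon as [Y] preserves both the degree
    filtration and its multiple by [g]: the two filtrations make [Z] upper
    and lower triangular, the second one after reversing the rows. *)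
Lemma diagonal_of_two_filtrations Q Y (x g : 'I_n.+1 -> F)
    (lam lamt : nat -> F) :
  Q \in unitmx -> injective x -> (forall m, g m != 0) ->
  annihilates_low_degrees Q x -> annihilates_low_degrees (reversed Q g) x ->
  (forall k : nat, exists2 f : {poly F}, (size f <= k)%N &
     forall m, \sum_l Y m l * x l ^+ k = lam k * x m ^+ k + f.[x m]) ->
  (forall k : nat, exists2 f : {poly F}, (size f <= k)%N &
     forall m, \sum_l Y m l * (g l * x l ^+ k) =
               g m * (lamt k * x m ^+ k + f.[x m])) ->
  Q *m Y = diag_mx (\row_j lam j) *m Q.
Proof.
move=> Qu xinj gn0 Q0 Qr0 Ydeg Ygdeg.
have [Z QY] : exists Z, Q *m Y = Z *m Q.
  by exists (Q *m Y *m invmx Q); rewrite mulmxKV.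
suff -> : diag_mx (\row_j lam j) = Z by [].
have Zu := triangular_of_degree_preserving QY Q0
  (vandermonde_diag_neq0 Qu xinj Q0) Ydeg.
have Qru := reversed_unit gn0 Qu.
pose Yr := \matrix_(m, l) (Y m l * g l / g m).
pose Zr := \matrix_(i, j) Z (rev_ord i) (rev_ord j).
have QYr : reversed Q g *m Yr = Zr *m reversed Q g.
  apply/matrixP => i j; rewrite !mxE.
  transitivity ((Q *m Y) (rev_ord i) j * g j).
    rewrite mxE mulr_suml; apply: eq_bigr => m _; rewrite !mxE.
    by field; exact: gn0.
  rewrite QY mxE mulr_suml (reindex_inj rev_ord_inj) /=.
  by apply: eq_bigr => m _; rewrite [Zr _ _]mxE [reversed _ _ _ _]mxE mulrA.
have Yrdeg (k : nat) : exists2 f : {poly F}, (size f <= k)%N &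
     forall m, \sum_l Yr m l * x l ^+ k = lamt k * x m ^+ k + f.[x m].
  have [f sf fE] := Ygdeg k; exists f => // m.
  apply: (mulfI (gn0 m)); rewrite -fE mulr_sumr; apply: eq_bigr => l _.
  by rewrite mxE; field; exact: gn0.
have Zl := triangular_of_degree_preserving QYr Qr0
  (vandermonde_diag_neq0 Qru xinj Qr0) Yrdeg.
apply/matrixP => j k; rewrite !mxE eq_sym.
case: (leqP k j) => [kj|jk]; first by rewrite Zu.
have := Zl (rev_ord j) (rev_ord k); rewrite mxE !rev_ordK => -> /=; last first.
  by have := ltn_ord k; lia.
by rewrite (inj_eq rev_ord_inj) -val_eqE gtn_eqF.
Qed.

(** Multiplication by [x] raises the degree by exactly one, so its matrix on
    the rows of [Q] has one nonzero diagonal below the main one. *)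
Lemma hessenberg_of_nodes Q M (x : 'I_n.+1 -> F) :
  Q *m diag_mx (\row_m x m) = M *m Q -> annihilates_low_degrees Q x ->
  (forall j : 'I_n.+1, \sum_m Q j m * x m ^+ j != 0) ->
  forall j k : 'I_n.+1, ((k.+1 < j)%N -> M j k = 0) /\
                        (j = k.+1 :> nat -> M j k != 0).
Proof.
move=> QX Q0 Qn0 j.
have rel (k : nat) : \sum_l M j l * \sum_m Q l m * x m ^+ k =
    \sum_m Q j m * x m ^+ k.+1.
  transitivity (\sum_m (M *m Q) j m * x m ^+ k).
    under [RHS]eq_bigr => m _ do rewrite mxE mulr_suml.
    rewrite exchange_big; apply: eq_bigr => l _; rewrite mulr_sumr.
    by apply: eq_bigr => m _; rewrite mulrA.
  rewrite -QX; apply: eq_bigr => m _.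
  by rewrite mul_mx_diag !mxE exprS mulrA.
have head (k : 'I_n.+1) : (forall l : 'I_n.+1, (l < k)%N -> M j l = 0) ->
    M j k * \sum_m Q k m * x m ^+ k = \sum_m Q j m * x m ^+ k.+1.
  move=> H; rewrite -rel [RHS](bigD1 k) //= [X in _ = _ + X]big1 ?addr0 // => l lk.
  case: (ltnP l k) => [lt|le]; first by rewrite H ?mul0r.
  by rewrite Q0 ?mulr0 // ltn_neqAle le andbT eq_sym.
have low N (k : 'I_n.+1) : (k < N)%N -> (k.+1 < j)%N -> M j k = 0.
  elim: N k => // N IH k kN kj.
  have := head k; rewrite (Q0 j (Ordinal (ltn_trans kj (ltn_ord j)))) // => H.
  have /eqP : M j k * \sum_m Q k m * x m ^+ k = 0.
    by apply: H => l lk; apply: IH; lia.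
  by rewrite mulf_eq0 (negPf (Qn0 k)) orbF => /eqP.
move=> k; split=> [kj|jk]; first exact: (low k.+1).
have : M j k * \sum_m Q k m * x m ^+ k != 0.
  rewrite head => [|l lk]; first by rewrite -jk.
  by apply: (low l.+1) => //; lia.
by rewrite mulf_eq0 negb_or => /andP [].
Qed.

(** The filtration by degree controls the entries of [M] below the diagonal,
    and its multiple by [g] those above. *)
Lemma nodes_irreducible_tridiagonal Q M (x g : 'I_n.+1 -> F) :
  Q \in unitmx -> injective x -> (forall m, g m != 0) ->
  annihilates_low_degrees Q x -> annihilates_low_degrees (reversed Q g) x ->
  Q *m diag_mx (\row_m x m) = M *m Q -> irreducible_tridiagonal M.
Proof.
move=> Qu xinj gn0 Q0 Qr0 QX.
pose Mr : 'M[F]_n.+1 := \matrix_(i, j) M (rev_ord i) (rev_ord j).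
have QrX : reversed Q g *m diag_mx (\row_m x m) = Mr *m reversed Q g.
  apply/matrixP => i j; rewrite mul_mx_diag !mxE.
  have /matrixP/(_ (rev_ord i) j) := QX; rewrite mul_mx_diag !mxE => E.
  rewrite mulrAC E mulr_suml (reindex_inj rev_ord_inj) /=.
  by apply: eq_bigr => m _; rewrite [Mr _ _]mxE [reversed _ _ _ _]mxE mulrA.
have up := hessenberg_of_nodes QX Q0 (vandermonde_diag_neq0 Qu xinj Q0).
have down := hessenberg_of_nodes QrX Qr0
  (vandermonde_diag_neq0 (reversed_unit gn0 Qu) xinj Qr0).
have downE j k : M j k = Mr (rev_ord j) (rev_ord k) by rewrite mxE !rev_ordK.
split=> j k; rewrite /far /adjacent => /orP [] jk.
- rewrite downE; have [->] // := down (rev_ord j) (rev_ord k).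
  by have := ltn_ord k; rewrite /=; lia.
- by have [->] := up j k.
- rewrite downE; have [_] := down (rev_ord j) (rev_ord k); apply=> /=.
  by have := ltn_ord k; move/eqP: jk; lia.
- by have [_] := up j k; apply; apply/eqP.
Qed.

(** An irreducible tridiagonal matrix moves a basis row to its neighbours, and
    a diagonal matrix with distinct entries separates them. *)
Lemma stable_full (t : 'I_n.+1 -> F) M (V : 'M[F]_n.+1) :
  injective t -> irreducible_tridiagonal M -> V != 0 ->
  stablemx V (diag_mx (\row_k t k)) -> stablemx V M -> row_full V.
Proof.
move=> tinj [_ Mirr] V0 Vt VM.
have component (v : 'rV[F]_n.+1) k : (v <= V)%MS -> v 0 k != 0 ->
    ((delta_mx 0 k : 'rV_n.+1) <= V)%MS.
  move=> vV vk; pose p := \prod_(l | l != k) ('X - (t l)%:P).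
  have pk : p.[t k] != 0.
    rewrite horner_prod; apply/prodf_neq0 => l lk.
    by rewrite !hornerE subr_eq0 (inj_eq tinj) eq_sym.
  suff <- : (v 0 k * p.[t k])^-1 *:
      (v *m horner_mx (diag_mx (\row_k t k)) p) = delta_mx 0 k.
    apply/scalemx_sub/(submx_trans (submxMr _ vV))/horner_mx_stable.
    exact: Vt.
  apply/rowP => l; rewrite horner_mx_diag mul_mx_diag !mxE /=.
  case: (eqVneq l k) => [->|lk]; first by rewrite mulVf // mulf_neq0.
  rewrite [X in v 0 l * X](_ : _ = 0) ?mulr0 //.
  by rewrite horner_prod (bigD1 l) //= !hornerE subrr mul0r.
have [k0 k0V] : exists k, ((delta_mx 0 k : 'rV_n.+1) <= V)%MS.
  have /existsP [i /existsP [k Vik]] : [exists i, exists k, V i k != 0].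
    apply: contraNT V0; rewrite negb_exists => /forallP H.
    apply/eqP/matrixP => i k; have := H i; rewrite negb_exists => /forallP.
    by move/(_ k); rewrite negbK mxE => /eqP.
  by exists k; apply: (component (row i V)); rewrite ?row_sub // mxE.
have step (k l : 'I_n.+1) : adjacent k l -> ((delta_mx 0 k : 'rV_n.+1) <= V)%MS ->
    ((delta_mx 0 l : 'rV_n.+1) <= V)%MS.
  move=> kl kV; apply: (component (delta_mx 0 k *m M)).
    exact: submx_trans (submxMr _ kV) VM.
  by rewrite -rowE mxE Mirr.
have up (N : nat) (l : 'I_n.+1) : (l <= k0 + N)%N -> (k0 <= l + N)%N ->
    ((delta_mx 0 l : 'rV_n.+1) <= V)%MS.
  elim: N l => [|N IH] l; first by move=> h1 h2; rewrite (_ : l = k0) //;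
    apply/val_inj => /=; lia.
  move=> h1 h2; case: (ltngtP l k0) => [lk|lk|/val_inj->] //.
    have l1 : (l.+1 < n.+1)%N by have := ltn_ord k0; lia.
    by apply: (step (Ordinal l1)); [rewrite /adjacent /= eqxx orbT
      | apply: IH => /=; lia].
  have l1 : (l.-1 < n.+1)%N by have := ltn_ord l; lia.
  by apply: (step (Ordinal l1)); [rewrite /adjacent /=; lia
    | apply: IH => /=; lia].
rewrite -sub1mx; apply/row_subP => l; rewrite row1.
by apply: (up n); have := ltn_ord l; have := ltn_ord k0; lia.
Qed.

(** A vanishing entry next to the diagonal of [Y] would make a coordinate
    subspace stable under both operators. *)
Lemma irreducible_of_tridiagonal Q Y M (x t : 'I_n.+1 -> F) :
  Q \in unitmx -> injective t -> tridiagonal Y ->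
  Q *m Y = diag_mx (\row_k t k) *m Q ->
  Q *m diag_mx (\row_m x m) = M *m Q -> irreducible_tridiagonal M ->
  irreducible_tridiagonal Y.
Proof.
move=> Qu tinj Ytri QY QX Mirr; split => // i j ij; apply/eqP => Yij.
have closed (P : pred 'I_n.+1) : (forall m l, P m -> ~~ P l -> Y m l = 0) ->
    P i -> P j.
  move=> PY Pi; pose S : 'M[F]_n.+1 := diag_mx (\row_m (P m)%:R).
  have Ssub (W : 'M_n.+1) : (forall m l, ~~ P l -> P m -> W m l = 0) ->
      (S *m W <= S)%MS.
    move=> W0; apply/submxP; exists (S *m W); apply/matrixP => m l.
    rewrite /S mul_mx_diag !mul_diag_mx !mxE.
    case Pl: (P l); rewrite ?mulr1 ?mulr0 //.
    by case Pm: (P m); rewrite ?mul0r ?mul1r //; apply: W0; rewrite ?Pl ?Pm.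
  have full : row_full (S *m invmx Q).
    apply: (stable_full tinj Mirr).
    - rewrite -[X in _ != X](mul0mx _ (invmx Q)).
      rewrite (inj_eq (can_inj (mulmxKV Qu))).
      apply/eqP => /matrixP/(_ i i); rewrite !mxE eqxx Pi => /eqP.
      by rewrite oner_eq0.
    - rewrite (_ : _ *m _ = S *m Y *m invmx Q).
        by apply/submxMr/Ssub => m l Pl Pm; apply: PY.
      rewrite -[S *m Y *m _]mulmxA -[S *m _ *m _]mulmxA; congr (S *m _).
      by rewrite -[Y](mulKmx Qu) QY -!mulmxA mulmxV // mulmx1.
    - rewrite (_ : _ *m _ = S *m diag_mx (\row_m x m) *m invmx Q).
        apply/submxMr/Ssub => m l Pl Pm; rewrite !mxE.
        by case: eqP => // ml; rewrite -ml Pm in Pl.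
      rewrite -[X in _ = X]mulmxA -[X in X = _]mulmxA; congr (S *m _).
      by rewrite -[diag_mx (\row_m _)](mulKmx Qu) QX -!mulmxA mulmxV // mulmx1.
  have : row_full S.
    move: full; rewrite -!sub1mx => /(submxMr Q); rewrite mulmxKV // mul1mx.
    by apply: submx_trans; rewrite sub1mx row_full_unit.
  rewrite -sub1mx => /submxP [W /matrixP/(_ j j)].
  rewrite /S mul_mx_diag !mxE eqxx => /eqP.
  by case: (P j) => //; rewrite mulr0 oner_eq0.
case/orP: ij => /eqP ij.
- have /= := closed (fun m : 'I_n.+1 => (m <= i)%N).
  rewrite leqnn ij ltnn => H; have : false; last by [].
  apply: H => // m l mi; rewrite -ltnNge => il.
  case: (ltngtP m i) => [mi'| |/val_inj E]; last 1 first.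
  + case: (ltngtP l j) => [|jl|/val_inj ->]; [by rewrite ij; lia| |by rewrite E].
    by rewrite Ytri // /far; move: jl; rewrite ij E; lia.
  + by rewrite Ytri // /far; lia.
  by lia.
- have /= := closed (fun m : 'I_n.+1 => (i <= m)%N).
  rewrite leqnn ij ltnn => H; have : false; last by [].
  apply: H => // m l mi; rewrite -ltnNge => il.
  case: (ltngtP m i) => [mi'| |/val_inj E]; last 1 first.
  + case: (ltngtP l j) => [jl||/val_inj ->]; [|by move: il; lia|by rewrite E].
    by rewrite Ytri // /far; move: jl; rewrite E ij; lia.
  + by lia.
  by move=> mi'; rewrite Ytri // /far; lia.
Qed.

(** Both matrices are determined, up to the two scalars, by the image of the
    first basis row, which has a component on every eigenvector of [Y]. *)
Lemma tridiagonal_unique Q Y Y' (t t' : 'I_n.+1 -> F) :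
  Q \in unitmx -> irreducible_tridiagonal Y -> tridiagonal Y' ->
  Q *m Y = diag_mx (\row_k t k) *m Q ->
  Q *m Y' = diag_mx (\row_k t' k) *m Q ->
  exists xi zeta, forall k, t' k = xi * t k + zeta.
Proof.
move=> Qu [Ytri Yirr] Ytri' QY QY'.
pose c := row ord0 (invmx Q).
have eigen Y1 (t1 : 'I_n.+1 -> F) : Q *m Y1 = diag_mx (\row_k t1 k) *m Q ->
    forall m k, \sum_l Y1 m l * invmx Q l k = t1 k * invmx Q m k.
  move=> QY1 m k; have : (Y1 *m invmx Q) m k =
    (invmx Q *m diag_mx (\row_k t1 k)) m k.
    by rewrite -[Y1](mulKmx Qu) QY1 -!mulmxA mulmxV // mulmx1.
  by rewrite mul_mx_diag !mxE => ->; rewrite mulrC.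
have c_neq0 k : invmx Q ord0 k != 0.
  apply/eqP => c0.
  have col0 (N : nat) (m : 'I_n.+1) : (m <= N)%N -> invmx Q m k = 0.
    elim: N m => [|N IH] m.
      by rewrite leqn0 => /eqP m0; rewrite -c0; congr (invmx Q _ _); apply/val_inj.
    rewrite leq_eqVlt ltnS => /predU1P [mN|]; last exact: IH.
    have N1 : (N < n.+1)%N by have := ltn_ord m; lia.
    have := eigen _ _ QY (Ordinal N1) k; rewrite (IH (Ordinal N1)) // mulr0.
    rewrite (bigD1 m) //= big1 ?addr0 => [/eqP|l lm].
      rewrite mulf_eq0 (negPf (Yirr _ _ _)) /=; last by rewrite /adjacent /= mN eqxx.
      by move/eqP.
    case: (leqP l N) => lN; first by rewrite IH // mulr0.
    rewrite Ytri ?mul0r // /far /=; apply/orP; left.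
    by rewrite ltn_neqAle lN andbT -mN eq_sym.
  have /matrixP/(_ k k) := mulmxV Qu; rewrite !mxE eqxx big1 => [/eqP|m _].
    by rewrite eq_sym oner_eq0.
  by rewrite (col0 n) ?mulr0 // -ltnS.
case: (posnP n) => [n0|n_gt0].
  exists 0, (t' ord0) => k; rewrite mul0r add0r; congr t'; apply/val_inj => /=.
  by have := ltn_ord k; lia.
pose i1 : 'I_n.+1 := Ordinal (n_gt0 : (1 < n.+1)%N).
have row0 Y1 (t1 : 'I_n.+1 -> F) k : tridiagonal Y1 ->
    Q *m Y1 = diag_mx (\row_k t1 k) *m Q ->
    Y1 ord0 ord0 * invmx Q ord0 k + Y1 ord0 i1 * invmx Q i1 k =
    t1 k * invmx Q ord0 k.
  move=> Y1tri QY1; rewrite -(eigen _ _ QY1) (bigD1 ord0) //= (bigD1 i1) //=.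
  rewrite big1 ?addr0 // => l /andP [l0 l1]; rewrite Y1tri ?mul0r // /far.
  move: l0 l1; rewrite -!val_eqE /=; lia.
have Y01 : Y ord0 i1 != 0 by apply: Yirr.
exists (Y' ord0 i1 / Y ord0 i1).
exists (Y' ord0 ord0 - Y' ord0 i1 / Y ord0 i1 * Y ord0 ord0) => k.
apply: (mulIf (c_neq0 k)); rewrite -(row0 _ _ k Ytri' QY').
by rewrite mulrDl -[_ * t k * _]mulrA -(row0 _ _ k Ytri QY); field.
Qed.

End Tridiagonal.

(** * Descent of the operator to the ground field *)

(** The linear map sending [t] to the entries of [invmx Q *m diag_mx t *m Q]
    away from the three central diagonals. *)
Definition tridiagonal_constraints (F : fieldType) n (Q : 'M[F]_n.+1) :
    'M[F]_(n.+1, n.+1 * n.+1) :=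
  \matrix_k mxvec (\matrix_(i, j)
    (invmx Q i k * Q k j *+ (far i j))).

Lemma tridiagonal_constraintsP (F : fieldType) n (Q : 'M[F]_n.+1)
    (t : 'rV[F]_n.+1) :
  t *m tridiagonal_constraints Q = 0 <->
  tridiagonal (invmx Q *m diag_mx t *m Q).
Proof.
have E : t *m tridiagonal_constraints Q =
    mxvec (\matrix_(i, j) ((invmx Q *m diag_mx t *m Q) i j *+ (far i j))).
  rewrite mulmx_sum_row; under eq_bigr => k _ do rewrite rowK.
  under eq_bigr => k _ do rewrite -linearZ /=.
  rewrite -linear_sum /=; congr mxvec; apply/matrixP => i j.
  rewrite summxE !mxE -sumrMnl; apply: eq_bigr => k _.
  rewrite mul_mx_diag !mxE mulrnAr; congr (_ *+ _); ring.
rewrite E; split=> [|tri].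
  move/(congr1 vec_mx); rewrite mxvecK linear0 => /matrixP H i j ij.
  by have := H i j; rewrite !mxE ij.
rewrite -[RHS](linear0 mxvec); congr mxvec; apply/matrixP => i j; rewrite !mxE.
by case ij: (far i j) => //; have := tri i j ij; rewrite mxE.
Qed.

(** The [t] for which the matrix is tridiagonal form a subspace defined over
    [K]; since it contains a nonconstant vector over [L], it does over [K], and
    that vector is an affine image of [lam]. *)
Lemma tridiagonal_descent (K L : fieldType) (iota : {rmorphism K -> L}) n
    (Q M : 'M[K]_n.+1) (x : 'I_n.+1 -> K) (lam : 'I_n.+1 -> L)
    (Y : 'M[L]_n.+1) :
  (0 < n)%N -> Q \in unitmx -> Q *m diag_mx (\row_m x m) = M *m Q ->
  irreducible_tridiagonal M -> injective lam -> tridiagonal Y ->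
  map_mx iota Q *m Y = diag_mx (\row_k lam k) *m map_mx iota Q ->
  exists (t : 'I_n.+1 -> K) (Y' : 'M[K]_n.+1),
    [/\ injective t, tridiagonal Y' & Q *m Y' = diag_mx (\row_k t k) *m Q].
Proof.
move=> n_gt0 Qu QX [Mtri Mirr] laminj Ytri QY.
have QLu : map_mx iota Q \in unitmx by rewrite map_unitmx.
have QXL : map_mx iota Q *m diag_mx (\row_m iota (x m)) =
    map_mx iota M *m map_mx iota Q.
  rewrite -map_mxM -QX map_mxM map_diag_mx; congr (_ *m diag_mx _).
  by apply/rowP => m; rewrite !mxE.
have MLirr : irreducible_tridiagonal (map_mx iota M).
  split=> i j ij; rewrite mxE; first by rewrite Mtri // rmorph0.
  by rewrite fmorph_eq0 Mirr.
have Yirr := irreducible_of_tridiagonal QLu laminj Ytri QY QXL MLirr.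
pose G := tridiagonal_constraints Q.
have GL : map_mx iota G = tridiagonal_constraints (map_mx iota Q).
  apply/matrixP => k p; case/mxvec_indexP: p => i j.
  by rewrite !mxE !mxvecE !mxE -map_invmx !mxE rmorphMn rmorphM.
have [k0 [k1 t01]] : exists k0 k1, kermx G k0 k1 != kermx G k0 ord0.
  have /existsP [k0 /existsP [k1 H]] :
      [exists k0, exists k1, kermx G k0 k1 != kermx G k0 ord0].
    apply/contraT; rewrite negb_exists => /forallP noG.
    have Gconst k0 k1 : kermx G k0 k1 = kermx G k0 ord0.
      have := noG k0; rewrite negb_exists => /forallP/(_ k1).
      by rewrite negbK => /eqP.
    have : (\row_k lam k <= map_mx iota (kermx G))%MS.
      rewrite map_kermx GL; apply/sub_kermxP/tridiagonal_constraintsP.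
      by rewrite -mulmxA -QY mulKmx.
    case/submxP => c; move: (kermx G) Gconst => N Nconst /rowP cE.
    have lamE k : lam k = lam ord0.
      have := cE k; have := cE ord0; rewrite !mxE => -> ->.
      by apply: eq_bigr => i _; rewrite !mxE Nconst.
    have /laminj : lam ord_max = lam ord0 by [].
    by move/(congr1 val) => /= n0; rewrite n0 in n_gt0.
  by exists k0, k1.
pose t := row k0 (kermx G).
have ttri : tridiagonal (invmx Q *m diag_mx t *m Q).
  apply/tridiagonal_constraintsP; apply/sub_kermxP; exact: row_sub.
exists (fun k => t 0 k), (invmx Q *m diag_mx t *m Q).
have QY' : Q *m (invmx Q *m diag_mx t *m Q) = diag_mx (\row_k t 0 k) *m Q.
  rewrite -mulmxA mulKVmx //; congr (diag_mx _ *m _).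
  by apply/rowP => k; rewrite [RHS]mxE.
split => //.
pose YL := map_mx iota (invmx Q *m diag_mx t *m Q).
have YLtri : tridiagonal YL by move=> i j ij; rewrite mxE ttri // rmorph0.
have QYL : map_mx iota Q *m YL =
    diag_mx (\row_k iota (t 0 k)) *m map_mx iota Q.
  rewrite -map_mxM QY' map_mxM map_diag_mx; congr (diag_mx _ *m _).
  by apply/rowP => m; rewrite !mxE.
have [xi [zeta E]] := tridiagonal_unique QLu Yirr YLtri QY QYL.
have xi0 : xi != 0.
  apply: contra_neq t01 => xi0; apply: (fmorph_inj iota).
  by have := E k1; have := E ord0; rewrite xi0 !mul0r /t [row _ _ _ _]mxE [row _ _ _ _]mxE => -> ->.
by move=> i j /(congr1 iota); rewrite !E => /addIr/(mulfI xi0)/laminj.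
Qed.

(** * Three-term operators preserving the degree *)

Section ThreeTerm.
Variables (F : fieldType) (n : nat).

(** The Askey-Wilson quadratic form, which vanishes on consecutive nodes. *)
Definition aw_form (beta gamma rhoc x y : F) :=
  x ^+ 2 - beta * x * y + y ^+ 2 - gamma * (x + y) - rhoc.

(** The relation expresses [Y x^2] through lower powers of [x] on the right
    of [Y], so that the degree bound propagates from [1] and [x]. *)
Lemma degree_preserving (x : 'I_n.+1 -> F) (Y : 'M[F]_n.+1)
    (beta gamma rhoc c2 c1 c0 mu : F) (lam : nat -> F) :
  (forall m l, Y m l * aw_form beta gamma rhoc (x m) (x l) =
     (c2 * x m ^+ 2 + c1 * x m + c0) *+ (m == l)) ->
  (forall m, \sum_l Y m l = lam 0) ->
  (forall m, \sum_l Y m l * x l = lam 1 * x m + mu) ->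
  (forall k, lam k.+2 = beta * lam k.+1 - lam k + c2) ->
  forall k : nat, exists2 f : {poly F}, (size f <= k)%N &
     forall m, \sum_l Y m l * x l ^+ k = lam k * x m ^+ k + f.[x m].
Proof.
move=> Yaw Y0 Y1 lamE.
suff H k : (exists2 f : {poly F}, (size f <= k)%N &
     forall m, \sum_l Y m l * x l ^+ k = lam k * x m ^+ k + f.[x m]) /\
   (exists2 f : {poly F}, (size f <= k.+1)%N &
     forall m, \sum_l Y m l * x l ^+ k.+1 = lam k.+1 * x m ^+ k.+1 + f.[x m]).
  by move=> k; case: (H k).
elim: k => [|k [[f0 sf0 f0E] [f1 sf1 f1E]]].
  split.
    exists 0 => [|m]; first by rewrite size_poly0.
    under eq_bigr => l _ do rewrite expr0 mulr1.
    by rewrite Y0 hornerC addr0 mulr1.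
  exists mu%:P => [|m]; first exact: size_polyC_leq1.
  under eq_bigr => l _ do rewrite expr1.
  by rewrite Y1 hornerC expr1.
split; first by exists f1.
exists (beta *: ('X * f1) - 'X^2 * f0
  + gamma *: (lam k *: 'X^(k.+1) + 'X * f0 + (lam k.+1 *: 'X^(k.+1) + f1))
  + rhoc *: (lam k *: 'X^k + f0) + (c1 *: 'X^(k.+1) + c0 *: 'X^k)).
  have sX (p : {poly F}) j : (size p <= j)%N -> (size ('X * p)%R <= j.+1)%N.
    move=> sp; rewrite mulrC; apply: (leq_trans (size_polyMleq _ _)).
    by rewrite size_polyX; lia.
  have sXn (a : F) j : (j <= k.+1)%N -> (size (a *: 'X^j : {poly F})%R <= k.+2)%N.
    move=> jk; apply: (leq_trans (size_scale_leq _ _)).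
    by rewrite size_polyXn ltnS.
  have sD (p q : {poly F}) : (size p <= k.+2)%N -> (size q <= k.+2)%N ->
      (size (p + q)%R <= k.+2)%N.
    by move=> sp sq; rewrite (leq_trans (size_polyD _ _)) // geq_max sp.
  have sZ a (p : {poly F}) : (size p <= k.+2)%N -> (size (a *: p)%R <= k.+2)%N.
    exact/leq_trans/size_scale_leq.
  have X2 : (size ('X^2 * f0)%R <= k.+2)%N.
    rewrite expr2 -mulrA; apply: (sX _ k.+1); exact: (sX _ k).
  have sf0' : (size f0 <= k.+2)%N by rewrite (leq_trans sf0) // -addn2 leq_addr.
  have sf1' : (size f1 <= k.+2)%N by exact: leqW.
  have X0 : (size ('X * f0)%R <= k.+2)%N by apply: (sX _ k.+1); exact: leqW.
  apply: (sD); last by apply: (sD); apply: sXn.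
  apply: (sD); last by apply: (sZ); apply: (sD) => //; apply: sXn.
  apply: (sD).
    by apply: (sD); [apply: (sZ); apply: (sX _ k.+1) | rewrite size_polyN].
  apply: (sZ); apply: (sD); last by apply: (sD) => //; apply: sXn.
  by apply: (sD) => //; apply: sXn.
move=> m.
have step l : Y m l * x l ^+ k.+2 = beta * x m * (Y m l * x l ^+ k.+1)
    - x m ^+ 2 * (Y m l * x l ^+ k)
    + gamma * (x m * (Y m l * x l ^+ k) + Y m l * x l ^+ k.+1)
    + rhoc * (Y m l * x l ^+ k)
    + (c2 * x m ^+ 2 + c1 * x m + c0) *+ (m == l) * x l ^+ k.
  by rewrite -Yaw /aw_form !exprS; ring.
under eq_bigr => l _ do rewrite step.
rewrite !big_split /= !sumrN -!mulr_sumr big_split /= -!mulr_sumr.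
rewrite f0E f1E (bigD1 m) //= eqxx mulr1n big1 => [|l lm]; last first.
  by rewrite eq_sym (negPf lm) mul0r.
rewrite !(hornerD, hornerN, hornerZ, hornerM, hornerX, hornerXn) lamE.
by rewrite !exprS expr0; ring.
Qed.

(** A tridiagonal operator on the functions of the nodes [x] which acts
    triangularly on [1, x, x^2, ...], with diagonal [lam], and likewise on
    [g, g x, g x^2, ...]. *)
Definition degree_operator (x g : 'I_n.+1 -> F) (lam : nat -> F) :=
  exists (Y : 'M[F]_n.+1) (lamt : nat -> F),
  [/\ tridiagonal Y,
    forall k : nat, exists2 f : {poly F}, (size f <= k)%N &
      forall m, \sum_l Y m l * x l ^+ k = lam k * x m ^+ k + f.[x m] &
    forall k : nat, exists2 f : {poly F}, (size f <= k)%N &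
      forall m, \sum_l Y m l * (g l * x l ^+ k) =
               g m * (lamt k * x m ^+ k + f.[x m])].

(** Two consecutive terms of the sequence with
    [l_(k+2) = beta * l_(k+1) - l_k + c2]. *)
Fixpoint second_order (beta c2 l0 l1 : F) (k : nat) : F * F :=
  if k is k'.+1 then
    let: (a, b) := second_order beta c2 l0 l1 k' in (b, beta * b - a + c2)
  else (l0, l1).

Definition three_term_matrix (b a c : nat -> F) : 'M[F]_n.+1 :=
  \matrix_(m, l) (b m *+ (l == m.+1 :> nat) + a m *+ (l == m :> nat)
                  + c m *+ (m == l.+1 :> nat)).

Lemma three_term_tridiagonal b a c : tridiagonal (three_term_matrix b a c).
Proof.
move=> i j; rewrite /far => ij; rewrite mxE.
have -> : (j == i.+1 :> nat) = false by apply/eqP; lia.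
have -> : (j == i :> nat) = false by apply/eqP; lia.
have -> : (i == j.+1 :> nat) = false by apply/eqP; lia.
by rewrite !mulr0n !addr0.
Qed.

Lemma sum_three_term b a c (h : nat -> F) (m : 'I_n.+1) :
  b n = 0 -> c 0 = 0 ->
  \sum_(l < n.+1) three_term_matrix b a c m l * h l =
  b m * h m.+1 + a m * h m + c m * h m.-1.
Proof.
move=> bn c0; under eq_bigr => l _ do rewrite mxE !mulrDl !mulrnAl.
rewrite !big_split /= -!addrA; congr (_ + (_ + _)).
- case: (ltnP m n) => mn.
    rewrite (bigD1 (Ordinal (mn : (m.+1 < n.+1)%N))) //= eqxx big1 ?addr0 // => l.
    by rewrite -val_eqE /= => /negPf ->.
  have -> : nat_of_ord m = n by apply/eqP; rewrite eqn_leq mn -ltnS ltn_ord.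
  rewrite bn mul0r big1 // => l _.
  by rewrite mul0r mul0rn.
- rewrite (bigD1 m) //= eqxx big1 ?addr0 // => l.
  by rewrite -val_eqE /= => /negPf ->.
- case: (posnP m) => m0.
    by rewrite m0 c0 mul0r big1 // => l _; rewrite mul0r mul0rn.
  have m1 : (m.-1 < n.+1)%N by have := ltn_ord m; lia.
  rewrite (bigD1 (Ordinal m1)) //= prednK // eqxx big1 ?addr0 // => l.
  rewrite -val_eqE /= => lm; rewrite (_ : _ == _ = false) //.
  by apply/eqP; move/eqP: lm; lia.
Qed.

(** [w i.+1] is the node of index [i]; [w 0] and [w n.+2] prolong the
    recurrence past the ends and let the end rows be treated as the others.
    The operator kills [1]; the four conditions describe its effect on [x], its
    diagonal, and the effect of its conjugate by [g] on [x] and on [1]. *)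
Lemma three_term_degree_operator (w g b c : nat -> F) (lam : nat -> F)
    (beta gamma rhoc c2 c1 c0 mu mut lamt1 eps : F) :
  (forall i, w i + w i.+2 = beta * w i.+1 + gamma) ->
  (forall i, aw_form beta gamma rhoc (w i) (w i.+1) = 0) ->
  (forall m, (m <= n)%N -> g m != 0) ->
  b n = 0 -> c 0 = 0 ->
  (forall m, (m <= n)%N ->
   let x := w m.+1 in let y := w m.+2 in let z := w m in
   let bt := b m * g m.+1 / g m in let ct := c m * g m.-1 / g m in
   [/\ b m * (y - x) + c m * (z - x) = lam 1 * x + mu,
       (x - y) * (x - z) * - (b m + c m) = c2 * x ^+ 2 + c1 * x + c0,
       bt * (y - x) + ct * (z - x) = lamt1 * x + mut &
       bt + ct - (b m + c m) = eps]) ->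
  lam 0 = 0 -> (forall k, lam k.+2 = beta * lam k.+1 - lam k + c2) ->
  degree_operator (fun m : 'I_n.+1 => w m.+1) (fun m : 'I_n.+1 => g m) lam.
Proof.
move=> wrec waw gn0 bn c00 H lam0 lamE.
pose a m := - (b m + c m).
pose Y := three_term_matrix b a c.
pose lamt k := (second_order beta c2 eps (lamt1 + eps) k).1.
have lamtE k : lamt k.+2 = beta * lamt k.+1 - lamt k + c2.
  by rewrite /lamt /=; case: (second_order _ _ _ _ k).
have aw_sym i : aw_form beta gamma rhoc (w i.+1) (w i) = 0.
  by rewrite -(waw i) /aw_form; ring.
have aw_diag i : aw_form beta gamma rhoc (w i.+1) (w i.+1) =
    (w i.+1 - w i.+2) * (w i.+1 - w i).
  have e := waw i; have e2 := wrec i.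
  have -> : w i.+2 = beta * w i.+1 + gamma - w i by rewrite -e2; ring.
  apply/eqP; rewrite -subr_eq0 -[X in _ == X]e /aw_form.
  by apply/eqP; ring.
have Yaw (h : nat -> F) (m l : 'I_n.+1) :
    Y m l * h l / h m * aw_form beta gamma rhoc (w m.+1) (w l.+1) =
    (h m / h m * (c2 * w m.+1 ^+ 2 + c1 * w m.+1 + c0)) *+ (m == l).
  rewrite mxE; case: (eqVneq m l) => [->|ml].
    rewrite !eqxx ltn_eqF // !mulr0n mulr1n add0r addr0 aw_diag.
    by have [_ <- _ _] := H l (ltn_ord l); rewrite /a mulr1n; ring.
  rewrite mulr0n; move: ml; rewrite -val_eqE /= eq_sym => /negPf ->.
  case: (eqVneq (val l) m.+1) => [->|_]; first by rewrite waw mulr0.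
  case: (eqVneq (val m) l.+1) => [->|_]; first by rewrite aw_sym mulr0.
  by rewrite !mulr0n !addr0 !mul0r.
exists Y, lamt; split.
- exact: three_term_tridiagonal.
- apply: (degree_preserving (beta := beta) (gamma := gamma) (rhoc := rhoc)
    (c2 := c2) (c1 := c1) (c0 := c0) (mu := mu)) => // [m l|m|m].
  + by have := Yaw (fun _ => 1) m l; rewrite divr1 mulr1 divff ?oner_eq0 // mul1r.
  + under eq_bigr => l _ do rewrite -[Y m l]mulr1.
    by rewrite (sum_three_term _ (fun _ => 1)) // /a lam0; ring.
  + have [<- _ _ _] := H m (ltn_ord m).
    rewrite (sum_three_term _ (fun l => w l.+1)) // /a.
    case: (posnP m) => [->|m0]; first by rewrite c00; ring.
    by rewrite prednK //; ring.
- pose Yt : 'M[F]_n.+1 := \matrix_(m, l) (Y m l * g l / g m).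
  have Ytsum (h : nat -> F) (m : 'I_n.+1) : \sum_l Yt m l * h l =
      (b m * (g m.+1 * h m.+1) + a m * (g m * h m)
        + c m * (g m.-1 * h m.-1)) / g m.
    rewrite -(sum_three_term a (fun l => g l * h l) m bn c00) mulr_suml.
    by apply: eq_bigr => l _; rewrite mxE; ring.
  move=> k.
  have [||||f sf fE] := degree_preserving (x := fun m : 'I_n.+1 => w m.+1)
    (Y := Yt) (beta := beta) (gamma := gamma) (rhoc := rhoc)
    (c2 := c2) (c1 := c1) (c0 := c0) (mu := mut) (lam := lamt) _ _ _ _ k => //.
  + move=> m l; rewrite mxE Yaw divff ?mul1r //.
    by apply: gn0; rewrite -ltnS.
  + move=> m; rewrite /lamt /=; have [_ _ _ <-] := H m (ltn_ord m).
    under eq_bigr => l _ do rewrite -[Yt m l]mulr1.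
    rewrite (Ytsum (fun=> 1)) /a; field.
    by apply: gn0; rewrite -ltnS.
  + move=> m; rewrite (Ytsum (fun l => w l.+1)).
    have gm : g m != 0 by apply: gn0; rewrite -ltnS.
    have [_ _ e1 e2] := H m (ltn_ord m).
    have -> : lamt 1 * w m.+1 + mut = (lamt1 * w m.+1 + mut) + eps * w m.+1.
      by rewrite /lamt /=; ring.
    rewrite -e1 -e2 /a.
    case: (posnP m) => [m0|m0]; last by rewrite prednK //; field.
    by move: gm; rewrite m0 c00 => gm; field.
  + exists f => // m; rewrite -fE.
    have gm : g m != 0 by apply: gn0; rewrite -ltnS.
    rewrite mulr_sumr; apply: eq_bigr => l _.
    by rewrite [Yt _ _]mxE; field.
Qed.

End ThreeTerm.

Section ProductOperator.
Variables (F : fieldType) (n : nat).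

(** In the interior the coefficients are the Lagrange weights of
    [t |-> U(x, t) * N(x, t) / (t - x)] at [y = w m.+2] and [z = w m], the two
    roots of the Askey-Wilson form with [x = w m.+1]; [U] cuts the operator off
    at both ends and [N] carries the twist by [g]. At the ends [y] and [z] may
    collide, which is why the weights are then written with the factor of [U]
    cancelled. *)
Lemma product_degree_operator (w g : nat -> F) (lam : nat -> F)
    (beta gamma rhoc u1 u2 u0 n1 n2 n0 : F) :
  let U x t := u1 * x + u2 * t + u0 in
  let N x t := n1 * x + n2 * t + n0 in
  (1 < n)%N ->
  (forall i, w i + w i.+2 = beta * w i.+1 + gamma) ->
  (forall i, aw_form beta gamma rhoc (w i) (w i.+1) = 0) ->
  (forall i j, (i <= n)%N -> (j <= n)%N -> w i.+1 = w j.+1 -> i = j) ->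
  (forall m, (m <= n)%N -> g m != 0) ->
  U (w 1) (w 0) = 0 -> U (w n.+1) (w n.+2) = 0 ->
  (forall m, (m < n)%N -> N (w m.+2) (w m.+1) * g m =
                          N (w m.+1) (w m.+2) * g m.+1) ->
  lam 0 = 0 -> lam 1 = u2 * n2 * beta + u1 * n2 + u2 * n1 ->
  (forall k, lam k.+2 = beta * lam k.+1 - lam k +
     (u1 * n1 + u1 * n2 + u2 * n1 + u2 * n2 - u2 * n2 * (2 - beta))) ->
  degree_operator (fun m : 'I_n.+1 => w m.+1) (fun m : 'I_n.+1 => g m) lam.
Proof.
move=> U N n_gt1 wrec waw winj gn0 U0 Un Ng lam0 lam1 lamE.
have wneq i j : (i <= n)%N -> (j <= n)%N -> i != j -> w i.+1 - w j.+1 != 0.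
  by move=> i_n j_n; apply: contra_neq => /subr0_eq; exact: winj.
pose b m := if m == n then 0 else
  if m == 0%N then u2 * N (w m.+1) (w m.+2) / (w m.+2 - w m.+1) else
  U (w m.+1) (w m.+2) * N (w m.+1) (w m.+2)
  / ((w m.+2 - w m.+1) * (w m.+2 - w m)).
pose c m := if m == 0%N then 0 else
  if m == n then u2 * N (w m.+1) (w m) / (w m - w m.+1) else
  U (w m.+1) (w m) * N (w m.+1) (w m) / ((w m.+1 - w m) * (w m.+2 - w m)).
apply: (three_term_degree_operator (b := b) (c := c) (beta := beta)
  (gamma := gamma) (rhoc := rhoc)
  (c2 := u1 * n1 + u1 * n2 + u2 * n1 + u2 * n2 - u2 * n2 * (2 - beta))
  (c1 := u1 * n0 + u0 * n1 + (u2 * n0 + u0 * n2) + 2 * gamma * u2 * n2)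
  (c0 := u0 * n0 + u2 * n2 * rhoc)
  (mu := u2 * n2 * gamma + u2 * n0 + u0 * n2)
  (mut := u2 * n1 * gamma + u2 * n0 + u0 * n1)
  (lamt1 := u2 * n1 * beta + u1 * n1 + u2 * n2)
  (eps := u2 * n1 - u2 * n2)) => //.
- by rewrite /b eqxx.
- move=> m mn /=; rewrite lam1.
  have gammaE : gamma = w m + w m.+2 - beta * w m.+1 by rewrite wrec; ring.
  have rhocE : rhoc = w m ^+ 2 - beta * w m * w m.+1 + w m.+1 ^+ 2
      - gamma * (w m + w m.+1).
    by apply/eqP; rewrite -subr_eq0 -[X in _ == X]oppr0 -(waw m) /aw_form;
       apply/eqP; ring.
  have gm := gn0 m mn.
  have bt : (m < n)%N -> N (w m.+1) (w m.+2) * g m.+1 / g m =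
      N (w m.+2) (w m.+1) by move=> /Ng <-; rewrite mulfK.
  have ct : (0 < m)%N -> N (w m.+1) (w m) * g m.-1 / g m = N (w m) (w m.+1).
    case: m mn gm {gammaE rhocE bt} => // m mn gm _ /=.
    by rewrite Ng // mulfK.
  rewrite rhocE gammaE /b /c {gammaE rhocE}.
  case: (posnP m) => [m0|m_gt0].
    have m_n : (m == n) = false by rewrite m0; lia.
    have m_lt : (m < n)%N by rewrite m0; lia.
    have yx : w m.+2 - w m.+1 != 0 by apply: wneq; rewrite // m0; lia.
    have u0E : u0 = - u1 * w m.+1 - u2 * w m.
      by apply/eqP; rewrite -subr_eq0 -U0 /U m0; apply/eqP; ring.
    rewrite m_n.
    have -> : u2 * N (w m.+1) (w m.+2) / (w m.+2 - w m.+1) * g m.+1 / g m =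
        u2 * N (w m.+2) (w m.+1) / (w m.+2 - w m.+1).
      by rewrite -(bt m_lt); field; rewrite yx gm.
    by split; rewrite ?mul0r ?u0E /N; field.
  have zx : w m - w m.+1 != 0.
    by case: m mn m_gt0 {bt ct gm} => // m mn _; apply: wneq; lia.
  case: (eqVneq m n) => [mn'|mn'].
    have u0E : u0 = - u1 * w m.+1 - u2 * w m.+2.
      by apply/eqP; rewrite -subr_eq0 -Un /U -mn'; apply/eqP; ring.
    have -> : u2 * N (w m.+1) (w m) / (w m - w m.+1) * g m.-1 / g m =
        u2 * N (w m) (w m.+1) / (w m - w m.+1).
      by rewrite -(ct m_gt0); field; rewrite zx gm.
    by split; rewrite ?mul0r ?u0E /N; field.
  have m_lt : (m < n)%N by rewrite ltn_neqAle mn'.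
  have yx : w m.+2 - w m.+1 != 0 by apply: wneq; lia.
  have yz : w m.+2 - w m != 0.
    by case: m m_lt m_gt0 {bt ct gm mn mn' yx zx} => // m mn _; apply: wneq; lia.
  have xz : w m.+1 - w m != 0 by rewrite -opprB oppr_eq0.
  have -> : U (w m.+1) (w m.+2) * N (w m.+1) (w m.+2) /
      ((w m.+2 - w m.+1) * (w m.+2 - w m)) * g m.+1 / g m =
      U (w m.+1) (w m.+2) * N (w m.+2) (w m.+1) /
      ((w m.+2 - w m.+1) * (w m.+2 - w m)).
    by rewrite -(bt m_lt); field; rewrite yx yz gm.
  have -> : U (w m.+1) (w m) * N (w m.+1) (w m) /
      ((w m.+1 - w m) * (w m.+2 - w m)) * g m.-1 / g m =
      U (w m.+1) (w m) * N (w m) (w m.+1) /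
      ((w m.+1 - w m) * (w m.+2 - w m)).
    by rewrite -(ct m_gt0); field; rewrite xz yz gm.
  by split; rewrite /U /N; field; rewrite ?yx ?yz ?xz.
Qed.

End ProductOperator.

(** The numerators of the weights depend on the parity of the row: on even rows
    that of [b] is a fixed quadratic in the index and that of [c] is cut off at
    the left end, on odd rows that of [c] is a fixed quadratic and that of [b]
    is cut off at the right end. *)
Lemma parity_degree_operator (F : fieldType) (n : nat) (g lam : nat -> F)
    (kappa u v r p : F) :
  let w i := kappa - (-1) ^+ i * (u + v * (i%:R - 1)) in
  let s := u / v in
  let e j := j ^+ 2 + r * j + p in
  let et j := (j - 1 + 2 * s) ^+ 2 - r * (j - 1 + 2 * s) + p in
  odd n -> v != 0 ->
  (forall i j, (i <= n)%N -> (j <= n)%N -> w i.+1 = w j.+1 -> i = j) ->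
  (forall m, (m <= n)%N -> g m != 0) ->
  (forall m, (m < n)%N -> odd m -> g m = g m.+1) ->
  (forall m, (m < n)%N -> ~~ odd m -> et m.+1%:R * g m = e m.+1%:R * g m.+1) ->
  (forall k, lam k = if odd k then
     (1 - k%:R + (n%:R + 2 * s - 2 - r)) / v else k%:R / v) ->
  degree_operator (fun m : 'I_n.+1 => w m.+1) (fun m : 'I_n.+1 => g m) lam.
Proof.
move=> w s e et n_odd v0 winj gn0 g_odd g_even lamE.
have wneq i j : (i <= n)%N -> (j <= n)%N -> i != j -> w i.+1 - w j.+1 != 0.
  by move=> i_n j_n; apply: contra_neq => /subr0_eq; exact: winj.
pose b m := if m == n then 0 else
  (if odd m then (m%:R - n%:R) * (m%:R + 2 * s) else - e m.+1%:R)
  / (w m.+2 - w m.+1).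
pose c m := if m == 0%N then 0 else
  (if odd m then et m%:R else - (m%:R * (m%:R + n%:R + 2 * s)))
  / (w m.+1 - w m).
pose f := n%:R + 2 * s.
pose e1 := 2 + r.
pose e0 := 1 + r + p.
pose a2 := 2 * (f - e1) + 2.
pose a1 := - 2 * e0 - (2 * s - 1) * e1 + (2 * s + 1) * f.
have uE : u = s * v by rewrite /s mulfVK.
apply: (three_term_degree_operator (b := b) (c := c) (beta := - 2)
  (gamma := 4 * kappa) (rhoc := v ^+ 2 - 4 * kappa ^+ 2)
  (c2 := a2 / v)
  (c1 := a1 - 2 * a2 * s - 2 * (a2 / v) * kappa)
  (c0 := v * (a2 * s ^+ 2 - a1 * s - (2 * s - 1) * e0)
         - (a1 - 2 * a2 * s) * kappa + a2 / v * kappa ^+ 2)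
  (mu := - (f - e1) * s - e0 - (f - e1) / v * kappa)
  (mut := - (f - 4 * s + r) * s - (4 * s ^+ 2 - 2 * s * r + p)
          - (f - 4 * s + r) / v * kappa)
  (lamt1 := (f - 4 * s + r) / v)
  (eps := - (1 - 2 * s + r) / v)) => //.
- by move=> i; rewrite /w -!natr1 !exprS; ring.
- move=> i; rewrite /w /aw_form -!natr1 (exprS (-1) i).
  by rewrite -signr_odd; case: (odd i) => /=; rewrite ?expr1 ?expr0; ring.
- by rewrite /b eqxx.
- move=> m mn /=; rewrite lamE /=.
  have gm := gn0 m mn.
  have btE : b m * g m.+1 / g m = if m == n then 0 else
      (if odd m then (m%:R - n%:R) * (m%:R + 2 * s) else - et m.+1%:R)
      / (w m.+2 - w m.+1).
    rewrite /b; case: (eqVneq m n) => [_|mn']; first by rewrite !mul0r.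
    have m_lt : (m < n)%N by rewrite ltn_neqAle mn'.
    have yx : w m.+2 - w m.+1 != 0 by apply: wneq; lia.
    case: ifPn => m_odd.
      by rewrite -(g_odd m) //; field; rewrite yx gm.
    have := g_even m m_lt m_odd; move: (et _) (e _) => X Z XZ.
    have -> : X = Z * g m.+1 / g m by rewrite -XZ mulfK.
    by field; rewrite yx gm.
  have ctE : c m * g m.-1 / g m = if m == 0%N then 0 else
      (if odd m then e m%:R else - (m%:R * (m%:R + n%:R + 2 * s)))
      / (w m.+1 - w m).
    rewrite /c {btE}; case: m mn gm => [|m] mn gm /=; first by rewrite !mul0r.
    have xz : w m.+2 - w m.+1 != 0 by apply: wneq; lia.
    case: ifPn => m_odd.
      have := g_even m mn m_odd; move: (et _) (e _) => X Z XZ.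
      have -> : Z = X * g m / g m.+1 by rewrite XZ mulfK.
      by field; rewrite xz gm.
    by rewrite (g_odd m) //; [field; rewrite xz gm | move: m_odd; rewrite negbK].
  rewrite btE ctE /b /c {btE ctE}.
  have yx : m != n -> w m.+2 - w m.+1 != 0.
    by move=> mn'; apply: wneq; lia.
  have xz : m != 0%N -> w m.+1 - w m != 0.
    by case: m mn gm {yx} => // m mn gm _; apply: wneq; lia.
  have yE : w m.+2 = kappa - (-1) ^+ m * (u + v * (m%:R + 1)).
    by rewrite /w -!natr1 !exprS; ring.
  have xE : w m.+1 = kappa + (-1) ^+ m * (u + v * m%:R).
    by rewrite /w -!natr1 !exprS; ring.
  have zE : w m = kappa - (-1) ^+ m * (u + v * (m%:R - 1)) by [].
  move: xz yx; rewrite yE xE zE {yE xE zE} -signr_odd.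
  have eE : e m.+1%:R = (m%:R + 1) ^+ 2 + r * (m%:R + 1) + p.
    by rewrite /e -natr1.
  have etE : et m.+1%:R = (m%:R + 2 * s) ^+ 2 - r * (m%:R + 2 * s) + p.
    by rewrite /et -natr1 addrK.
  rewrite eE etE uE /e /et /a2 /a1 /e1 /e0 /f.
  case m_odd: (odd m); rewrite /= ?expr1 ?expr0.
    have -> : (m == 0%N) = false by apply/eqP => m0; rewrite m0 in m_odd.
    move=> /(_ isT) xz; case: (eqVneq m n) => [mn'|_ /(_ isT) yx].
      by move=> _; split; rewrite ?mul0r mn'; rewrite mn' in xz;
         field; rewrite ?v0 ?xz.
    by split; field; rewrite ?v0 ?xz ?yx.
  have -> : (m == n) = false by apply/eqP => mn'; rewrite mn' n_odd in m_odd.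
  case: (eqVneq m 0%N) => [m0 _|_ /(_ isT) xz] /(_ isT) yx.
    move: yx; rewrite m0 !(mulr0, addr0, add0r, mulr1, mul1r) => yx.
    by split; rewrite ?mul0r; field; rewrite ?v0 ?yx.
  move: xz yx; rewrite !mul1r => xz yx.
  by split; field; rewrite ?v0 ?xz ?yx.
- by rewrite lamE mul0r.
- move=> k; rewrite !lamE /= negbK /a2 /f /e1 -!natr1.
  by case: (odd k) => /=; field.
Qed.

(** * Operators on a window of nodes *)

Section Families.
Variables (F : fieldType) (n d rho : nat).

Lemma eq_degree_operator (x x' g : 'I_n.+1 -> F) lam :
  x =1 x' -> degree_operator x g lam -> degree_operator x' g lam.
Proof.
move=> xx' [Y [lamt [Ytri Ydeg Ygdeg]]]; exists Y, lamt; split=> // k.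
  have [f sf fE] := Ydeg k; exists f => // m; rewrite -xx' -fE.
  by apply: eq_bigr => l _; rewrite xx'.
have [f sf fE] := Ygdeg k; exists f => // m; rewrite -xx' -fE.
by apply: eq_bigr => l _; rewrite xx'.
Qed.

Definition inj_upto (N : nat) (f : nat -> F) :=
  forall i j, (i <= N)%N -> (j <= N)%N -> f i = f j -> i = j.

(** The operator sought for [A'], on the [n + 1] nodes starting from
    [x rho]. *)
Definition window_operator (x g : nat -> F) :=
  exists2 lam : nat -> F, inj_upto n lam &
    degree_operator (fun m : 'I_n.+1 => x (rho + m)%N)
      (fun m : 'I_n.+1 => g (rho + m)%N) lam.

(** [phi_(i+1) g_i = vphi_(i+1) g_(i+1)] after removal of the common factor of
    [vphi_(i+1)] and [phi_(i+1)]. *)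
Definition twist_relation (x g : nat -> F) (a b c : F) :=
  forall i, (i < d)%N -> (b * x i.+1 + a * x i + c) * g i =
                         (b * x i + a * x i.+1 + c) * g i.+1.

Hypotheses (n_gt1 : (1 < n)%N) (n_d : (rho <= d - n)%N) (le_nd : (n <= d)%N).

Lemma inj_upto_lt (lam : nat -> F) :
  (forall k l, (k < l)%N -> (l <= n)%N -> lam k != lam l) -> inj_upto n lam.
Proof.
move=> H k l kn ln e; case: (ltngtP k l) => // kl.
  by have := H k l kl ln; rewrite e eqxx.
by have := H l k kl kn; rewrite e eqxx.
Qed.

(** The cut-off factor [U] vanishes at both ends for
    [u1 : u2 = - (1 - q^(n+2)) : q (1 - q^n)]. The difference [lam k - lam l]
    is a nonzero multiple of [th k - th (l + (d - n))]. *)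
Lemma q_window_operator (x th g : nat -> F)
    (q kappa X Y kap y z a b c sc : F) :
  q != 0 -> sc != 0 ->
  (forall i, (i <= d)%N -> x i = kappa + X / q ^+ i + Y * q ^+ i) ->
  (forall i, (i <= d)%N -> th i = kap + y / q ^+ i + z * q ^+ i) ->
  inj_upto d x -> inj_upto d th ->
  (forall i, (i <= d)%N -> g i != 0) ->
  twist_relation x g a b c ->
  a + b * q = sc * y -> q * a + b = sc * z * q ^+ d ->
  window_operator x g.
Proof.
move=> q0 sc0 xE thE xinj thinj gn0 tw ab1 ab2.
have qi0 i : q ^+ i != 0 by rewrite expf_neq0.
have qneq k l : (k <= d)%N -> (l <= d)%N -> k != l -> q ^+ k - q ^+ l != 0.
  move=> kd ld; apply: contra_neq => /subr0_eq E; apply: xinj => //.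
  by rewrite !xE // E.
have q1 : 1 - q != 0.
  by rewrite -[X in X - _](expr0 q) -[X in _ - X]expr1 qneq //; lia.
pose lam k := - (q / (1 - q)) * (1 - q ^+ k) *
  (q ^+ n * (a + b * q) - (q * a + b) * q ^+ k) / q ^+ k.
pose w i := kappa + X * q / q ^+ rho / q ^+ i + Y * q ^+ rho / q * q ^+ i.
have wE i : (rho + i <= d)%N -> w i.+1 = x (rho + i)%N.
  by move=> id; rewrite xE // /w exprS exprD; field; rewrite q0 !qi0.
exists lam.
  apply: inj_upto_lt => k l kl ln.
  pose i := k; pose j := (l + (d - n))%N.
  have thij : (th i - th j) * (q ^+ i * q ^+ j) =
      (q ^+ j - q ^+ i) * (y - z * (q ^+ i * q ^+ j)).
    by rewrite !thE /i /j; try lia; field; rewrite !qi0.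
  have nz : y - z * (q ^+ i * q ^+ j) != 0.
    have : (th i - th j) * (q ^+ i * q ^+ j) != 0.
      rewrite !mulf_neq0 // subr_eq0; apply/eqP => /thinj; rewrite /i /j; lia.
    by rewrite thij mulf_eq0 negb_or => /andP [].
  rewrite -subr_eq0.
  suff : (lam k - lam l) * (q ^+ k * q ^+ l) != 0.
    by rewrite mulf_eq0 negb_or => /andP [].
  have qdE : q ^+ d = q ^+ n * q ^+ (d - n) by rewrite -exprD subnKC.
  have -> : (lam k - lam l) * (q ^+ k * q ^+ l) =
      - (q / (1 - q)) * (sc * q ^+ n * (q ^+ l - q ^+ k) *
       (y - z * (q ^+ i * q ^+ j))).
    by rewrite /lam ab1 ab2 qdE /i /j !exprD; field; rewrite q1 !qi0.
  rewrite mulNr oppr_eq0 !mulf_neq0 ?invr_eq0 //.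
  by apply: qneq; lia.
apply: (@eq_degree_operator (fun m : 'I_n.+1 => w m.+1)).
  by move=> m; rewrite wE //; have := ltn_ord m; lia.
pose u2 := q * (1 - q ^+ n); pose u1 := - (1 - q ^+ n.+2).
(* The constant [rhoc] is the value of the Askey-Wilson form on consecutive
   nodes without its constant term. *)
apply: (product_degree_operator (g := fun m => g (rho + m)%N) (beta := q + q^-1)
  (gamma := (2 - (q + q^-1)) * kappa)
  (rhoc := X * Y * (4 - (q + q^-1) ^+ 2) - (2 - (q + q^-1)) * kappa ^+ 2)
  (u1 := u1) (u2 := u2) (u0 := - u1 * w 1 - u2 * w 0)
  (n1 := b) (n2 := a) (n0 := c)) => //.
- by move=> i; rewrite /w !exprS; field; rewrite q0 !qi0.
- by move=> i; rewrite /w /aw_form (exprS q i); field; rewrite q0 !qi0.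
- move=> i j i_n j_n; rewrite !wE; try lia.
  by move/xinj => /(_ _ _)/addnI; apply; lia.
- by move=> m mn; apply: gn0; lia.
- by ring.
- by rewrite /w /u1 /u2 !exprS expr0; field; rewrite q0 !qi0 oner_neq0.
- move=> m mn; rewrite !wE; try lia.
  by have := tw (rho + m)%N; rewrite addnS; apply; lia.
- by rewrite /lam expr0 subrr mulr0 !mul0r.
- by rewrite /lam /u1 /u2 !exprS expr0; field; rewrite ?q1 ?q0 ?oner_neq0.
- by move=> k; rewrite /lam /u1 /u2 !exprS; field; rewrite ?q1 ?q0 ?qi0.
Qed.

(** The analogue for [beta = 2]: here [u1 : u2 = - (n + 2) : n], and
    [lam k - lam l] is again a nonzero multiple of
    [th k - th (l + (d - n))]. *)
Lemma quadratic_window_operator (x th g : nat -> F)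
    (kappa u v kap y z a b c : F) :
  (forall i, (i <= d)%N -> x i = kappa + u * i%:R ^+ 2 + v * i%:R) ->
  (forall i, (i <= d)%N -> th i = kap + y * i%:R ^+ 2 + z * i%:R) ->
  inj_upto d x -> inj_upto d th ->
  (forall i, (i <= d)%N -> g i != 0) ->
  twist_relation x g a b c ->
  a + b = y -> a - b = z + d%:R * y ->
  window_operator x g.
Proof.
move=> xE thE xinj thinj gn0 tw ab1 ab2.
have nneq k l : (k <= d)%N -> (l <= d)%N -> k != l -> k%:R - l%:R != 0 :> F.
  move=> kd ld; apply: contra_neq => /subr0_eq E; apply: xinj => //.
  by rewrite !xE // E.
pose lam (k : nat) : F := - (y * k%:R ^+ 2 + (z + (d - n)%:R * y) * k%:R).
pose w i := kappa + u * (rho%:R + i%:R - 1) ^+ 2 + v * (rho%:R + i%:R - 1).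
have wE i : (rho + i <= d)%N -> w i.+1 = x (rho + i)%N.
  by move=> id; rewrite xE // /w natrD -natr1 addrA addrK.
have dE : d%:R = n%:R + (d - n)%:R :> F by rewrite -natrD subnKC.
exists lam.
  apply: inj_upto_lt => k l kl ln.
  have thij : th k - th (l + (d - n))%N =
      (k%:R - (l + (d - n))%:R) * (y * (k%:R + (l + (d - n))%:R) + z).
    by rewrite !thE; try lia; ring.
  have nz : y * (k%:R + (l + (d - n))%:R) + z != 0.
    have : th k - th (l + (d - n))%N != 0.
      by rewrite subr_eq0; apply/eqP => /thinj; lia.
    by rewrite thij mulf_eq0 negb_or => /andP [].
  rewrite -subr_eq0.
  have -> : lam k - lam l = - ((k%:R - l%:R) *
      (y * (k%:R + (l + (d - n))%:R) + z)).
    by rewrite /lam natrD; ring.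
  by rewrite oppr_eq0 mulf_neq0 // nneq //; lia.
apply: (@eq_degree_operator (fun m : 'I_n.+1 => w m.+1)).
  by move=> m; rewrite wE //; have := ltn_ord m; lia.
pose u2 : F := n%:R; pose u1 : F := - (n%:R + 2).
have bE : b = y - a by rewrite -ab1; ring.
have a2E : a + a = y + z + d%:R * y by rewrite -addrA -ab2 -ab1; ring.
apply: (product_degree_operator (g := fun m => g (rho + m)%N) (beta := 2)
  (gamma := 2 * u)
  (rhoc := v ^+ 2 - u ^+ 2 - 4 * u * kappa)
  (u1 := u1) (u2 := u2) (u0 := - u1 * w 1 - u2 * w 0)
  (n1 := b) (n2 := a) (n0 := c)) => //.
- by move=> i; rewrite /w -!natr1; ring.
- by move=> i; rewrite /w /aw_form -!natr1; ring.
- move=> i j i_n j_n; rewrite !wE; try lia.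
  by move/xinj => /(_ _ _)/addnI; apply; lia.
- by move=> m mn; apply: gn0; lia.
- by ring.
- by rewrite /w /u1 /u2 -!natr1; ring.
- move=> m mn; rewrite !wE; try lia.
  by have := tw (rho + m)%N; rewrite addnS; apply; lia.
- by rewrite /lam; ring.
- have -> : u2 * a * 2 + u1 * a + u2 * b = n%:R * y - (a + a).
    by rewrite /u1 /u2 bE; ring.
  by rewrite a2E /lam dE; ring.
- move=> k; rewrite /lam /u1 /u2 -[k.+2%:R]natr1 -[k.+1%:R]natr1.
  have -> : forall N : F, - (N + 2) * b + - (N + 2) * a + N * b + N * a -
    N * a * (2 - 2) = - 2 * y by move=> N; rewrite bE; ring.
  by ring.
Qed.

(** The sequence [(-1)^k (z k + y + (d - n) z / 2)] up to an additive
    constant, written without dividing by 2. *)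
Definition alternating_eigenvalue (y z : F) (k : nat) : F :=
  if odd k then - (z * k%:R + 2 * y + (d - n)%:R * z) else z * k%:R.

(** For indices [k < l] of the same parity the difference is [th k - th l];
    for different parities it is [th k - th (l + (d - n))]. *)
Lemma alternating_eigenvalue_inj (th : nat -> F) (kap y z : F) :
  odd d = odd n ->
  (forall i, (i <= d)%N -> th i = kap + (-1) ^+ i * (y + z * i%:R)) ->
  inj_upto d th -> inj_upto n (alternating_eigenvalue y z).
Proof.
move=> par thE thinj; apply: inj_upto_lt => k l kl ln.
(* The shift [d - n] is even, so [j] has the parity of [l]. *)
pose j := if odd k == odd l then l else (l + (d - n))%N.
have kj : (k < j)%N by rewrite /j; case: ifP; lia.
have jd : (j <= d)%N by rewrite /j; case: ifP; lia.
have thkj : th k - th j != 0.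
  by rewrite subr_eq0; apply/eqP => /thinj; lia.
rewrite -subr_eq0; suff -> : alternating_eigenvalue y z k -
  alternating_eigenvalue y z l = th k - th j by [].
have pdn : odd (d - n) = false by rewrite oddB // par addbb.
have oj : odd j = odd l by rewrite /j; case: ifP => // _; rewrite oddD pdn addbF.
rewrite !thE /alternating_eigenvalue; try lia.
rewrite -(signr_odd _ k) -(signr_odd _ j) oj /j.
by case: (odd k) (odd l) => -[] /=; rewrite ?natrD; ring.
Qed.

(** The case [beta = -2] with [n] even, so that both ends of the window have
    the same sign and [u1 : u2 = n + 2 : n]. *)
Lemma alternating_window_operator (x th g : nat -> F)
    (kappa u v kap y z a b c : F) :
  ~~ odd d -> ~~ odd n ->
  (forall i, (i <= d)%N -> x i = kappa + (-1) ^+ i * (u + v * i%:R)) ->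
  (forall i, (i <= d)%N -> th i = kap + (-1) ^+ i * (y + z * i%:R)) ->
  inj_upto d x -> inj_upto d th ->
  (forall i, (i <= d)%N -> g i != 0) ->
  twist_relation x g a b c ->
  a - b = - z -> a + b = - 2 * y - d%:R * z ->
  window_operator x g.
Proof.
move=> d_even n_even xE thE xinj thinj gn0 tw ab1 ab2.
pose w i := kappa - (-1) ^+ (rho + i)%N * (u + v * (rho%:R + i%:R - 1)).
have wE i : (rho + i <= d)%N -> w i.+1 = x (rho + i)%N.
  move=> id; rewrite xE // /w addnS exprS natrD -[i.+1%:R]natr1; ring.
have dE : d%:R = n%:R + (d - n)%:R :> F by rewrite -natrD subnKC.
exists (alternating_eigenvalue y z).
  apply: alternating_eigenvalue_inj thE thinj.
  by rewrite (negPf d_even) (negPf n_even).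
apply: (@eq_degree_operator (fun m : 'I_n.+1 => w m.+1)).
  by move=> m; rewrite wE //; have := ltn_ord m; lia.
pose u2 : F := n%:R; pose u1 : F := n%:R + 2.
have bE : b = a + z by rewrite -[z]opprK -ab1; ring.
have a2E : a + a = - 2 * y - d%:R * z - z.
  by rewrite -ab2 bE; ring.
apply: (product_degree_operator (g := fun m => g (rho + m)%N) (beta := -2)
  (gamma := 4 * kappa)
  (rhoc := v ^+ 2 - 4 * kappa ^+ 2)
  (u1 := u1) (u2 := u2) (u0 := - u1 * w 1 - u2 * w 0)
  (n1 := b) (n2 := a) (n0 := c)) => //.
- move=> i; rewrite /w !addnS !exprS -[i.+2%:R]natr1 -[i.+1%:R]natr1; ring.
- move=> i; rewrite /w /aw_form !addnS (exprS (-1) (rho + i)) -[i.+1%:R]natr1.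
  by rewrite -(signr_odd _ (rho + i)); case: (odd _) => /=;
     rewrite ?expr1 ?expr0; ring.
- move=> i j i_n j_n; rewrite !wE; try lia.
  by move/xinj => /(_ _ _)/addnI; apply; lia.
- by move=> m mn; apply: gn0; lia.
- by ring.
- have sn : (-1) ^+ n = 1 :> F by rewrite -signr_odd (negPf n_even).
  rewrite /w /u1 /u2 !addnS addn0 !exprS exprD sn.
  by rewrite -[n.+2%:R]natr1 -[n.+1%:R]natr1; ring.
- move=> m mn; rewrite !wE; try lia.
  by have := tw (rho + m)%N; rewrite addnS; apply; lia.
- by rewrite /alternating_eigenvalue /= mulr0.
- have -> : u2 * a * -2 + u1 * a + u2 * b = n%:R * z + (a + a).
    by rewrite /u1 /u2 bE; ring.
  by rewrite a2E /alternating_eigenvalue /= dE; ring.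
- move=> k; have -> : u1 * b + u1 * a + u2 * b + u2 * a - u2 * a * (2 - -2) =
      n%:R * z + n%:R * z + 2 * z + (a + a) + (a + a).
    by rewrite /u1 /u2 bE; ring.
  rewrite a2E /alternating_eigenvalue /= negbK dE.
  by rewrite -[k.+2%:R]natr1 -[k.+1%:R]natr1; case: (odd k) => /=; ring.
Qed.

(** An even [rho] preserves the parity of the rows, and shifting the index by
    [rho] replaces [r] by [2 rho + r] and [p] by [rho^2 + r rho + p]. *)
Lemma parity_window_operator (x th g : nat -> F)
    (kappa u v kap y z r p : F) :
  let s := 1 - 2 * (u / v) in
  odd d -> odd n -> ~~ odd rho ->
  (forall i, (i <= d)%N -> x i = kappa + (-1) ^+ i * (u + v * i%:R)) ->
  (forall i, (i <= d)%N -> th i = kap + (-1) ^+ i * (y + z * i%:R)) ->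
  inj_upto d x -> inj_upto d th ->
  (forall i, (i <= d)%N -> g i != 0) ->
  (forall i, (i < d)%N -> odd i -> g i = g i.+1) ->
  (forall i, (i < d)%N -> ~~ odd i ->
     ((i.+1%:R - s) ^+ 2 - r * (i.+1%:R - s) + p) * g i =
     (i.+1%:R ^+ 2 + r * i.+1%:R + p) * g i.+1) ->
  r = 2 * (y / z) + 2 * (u / v) + d%:R - 1 ->
  window_operator x g.
Proof.
move=> s d_odd n_odd rho_even xE thE xinj thinj gn0 g_odd g_even rE.
have z0 : z != 0.
  apply/eqP => z0; suff : 0%N = 2%N by [].
  by apply: thinj; rewrite ?thE //; try lia; rewrite z0 sqrrN expr1n !mul0r.
have v0 : v != 0.
  apply/eqP => v0; suff : 0%N = 2%N by [].
  by apply: xinj; rewrite ?xE //; try lia; rewrite v0 sqrrN expr1n !mul0r.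
pose w i := kappa - (-1) ^+ i * (u + v * rho%:R + v * (i%:R - 1)).
have srho : (-1) ^+ rho = 1 :> F by rewrite -signr_odd (negPf rho_even).
have wE i : (rho + i <= d)%N -> w i.+1 = x (rho + i)%N.
  by move=> id; rewrite xE // /w exprD srho exprS natrD -[i.+1%:R]natr1; ring.
exists (fun k => alternating_eigenvalue y z k / (v * z)).
  move=> i j i_n j_n /(mulIf _) E.
  apply: (alternating_eigenvalue_inj _ thE thinj) => //.
    by rewrite d_odd n_odd.
  by apply: E; rewrite invr_eq0 mulf_neq0.
apply: (@eq_degree_operator (fun m : 'I_n.+1 => w m.+1)).
  by move=> m; rewrite wE //; have := ltn_ord m; lia.
apply: (parity_degree_operator (g := fun m => g (rho + m)%N)
  (r := 2 * rho%:R + r) (p := rho%:R ^+ 2 + r * rho%:R + p)) => //.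
- move=> i j i_n j_n; rewrite -![_ - _]/(w _.+1) !wE; try lia.
  by move/xinj => /(_ _ _)/addnI; apply; lia.
- by move=> m mn; apply: gn0; lia.
- move=> m mn m_odd; rewrite addnS; apply: g_odd; first by lia.
  by rewrite oddD (negPf rho_even).
- move=> m mn m_even; have := g_even (rho + m)%N.
  rewrite addnS oddD (negPf rho_even) m_even -addnS => /(_ _ isT) E.
  have := E; rewrite natrD /s => {}E.
  have -> : (m.+1%:R - 1 + 2 * ((u + v * rho%:R) / v)) ^+ 2 -
    (2 * rho%:R + r) * (m.+1%:R - 1 + 2 * ((u + v * rho%:R) / v)) +
    (rho%:R ^+ 2 + r * rho%:R + p) =
    (rho%:R + m.+1%:R - (1 - 2 * (u / v))) ^+ 2 -
       r * (rho%:R + m.+1%:R - (1 - 2 * (u / v))) + p by field.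
  have -> : m.+1%:R ^+ 2 + (2 * rho%:R + r) * m.+1%:R +
    (rho%:R ^+ 2 + r * rho%:R + p) =
    (rho%:R + m.+1%:R) ^+ 2 + r * (rho%:R + m.+1%:R) + p by ring.
  by apply: E; lia.
- move=> k; rewrite /alternating_eigenvalue rE.
  have -> : d%:R = n%:R + (d - n)%:R :> F by rewrite -natrD subnKC.
  by case: (odd k); field; rewrite v0 z0.
Qed.

End Families.

(** * The listed parameter arrays *)

Section Cases.
Variables (F : fieldType) (d : nat).

Lemma twist_of_factors (x g vphi phi : nat -> F) (a b c : F) :
  (forall i, (i < d)%N -> phi i.+1 * g i = vphi i.+1 * g i.+1) ->
  (forall i, (i < d)%N -> vphi i.+1 != 0) ->
  (forall i, (i < d)%N -> exists f,
     vphi i.+1 = f * (b * x i + a * x i.+1 + c) /\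
     phi i.+1 = f * (b * x i.+1 + a * x i + c)) ->
  twist_relation d x g a b c.
Proof.
move=> gE v0 H i id; have [f [vE pE]] := H i id.
have f0 : f != 0.
  by apply: contra_neq (v0 i id) => f0; rewrite vE f0 mul0r.
by apply: (mulfI f0); rewrite !mulrA -vE -pE gE.
Qed.

Lemma exprz_1B2 (q : F) (i : nat) : q != 0 ->
  q ^ (1 - 2 * i.+1%:Z) = (q ^+ i * q ^+ i * q)^-1.
Proof.
move=> q0; rewrite (_ : 1 - _ = - (i + i).+1%:Z); last by lia.
by rewrite -exprnN exprSr exprD.
Qed.

Lemma exprz_Bd1 (q : F) (i : nat) : q != 0 ->
  q ^ (i.+1%:Z - d%:Z - 1) = q ^+ i / q ^+ d.
Proof.
move=> q0; rewrite (_ : _ - _ - 1 = i%:Z + - d%:Z); last by lia.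
by rewrite expfzDr // -exprnN.
Qed.

Lemma exprz_dB2 (q : F) (i : nat) : q != 0 ->
  q ^ (d%:Z + 2 - 2 * i.+1%:Z) = q ^+ d / (q ^+ i * q ^+ i).
Proof.
move=> q0; rewrite (_ : _ + 2 - _ = d%:Z + - (i + i)%:Z); last by lia.
by rewrite expfzDr // -exprnN exprD.
Qed.

Lemma exprz_1B (q : F) (i : nat) : q != 0 ->
  q ^ (1 - i.+1%:Z) = (q ^+ i)^-1.
Proof.
by move=> q0; rewrite (_ : 1 - _ = - i%:Z) -?exprnN //; lia.
Qed.

End Cases.

Section FromCases.
Variables (K : fieldType) (L : closedFieldType) (iota : {rmorphism K -> L}).
Variables (d : nat) (p : param_array K d) (g : nat -> K).
Hypothesis th_inj : injective (pa_th p).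
Hypothesis ths_inj : injective (pa_ths p).
Hypothesis vphi_neq0 : forall i, (i < d)%N -> pa_vphi p i.+1 != 0.
Hypothesis g_neq0 : forall i, (i <= d)%N -> g i != 0.
Hypothesis gE : forall i, (i < d)%N ->
  pa_phi p i.+1 * g i = pa_vphi p i.+1 * g i.+1.
Variables (n rho : nat).
Hypotheses (n_gt1 : (1 < n)%N) (n_lt : (n < d)%N) (le_rho : (rho <= d - n)%N).

Let x (i : nat) := iota (pa_ths p (inord i)).
Let th (i : nat) := iota (pa_th p (inord i)).
Let gL (i : nat) := iota (g i).

Let x_inj : inj_upto d x.
Proof.
move=> i j i_d j_d /fmorph_inj/ths_inj/(congr1 val).
by rewrite /= !inordK.
Qed.

Let th_injL : inj_upto d th.
Proof.
move=> i j i_d j_d /fmorph_inj/th_inj/(congr1 val).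
by rewrite /= !inordK.
Qed.

Let gL_neq0 i : (i <= d)%N -> gL i != 0.
Proof. by move=> id; rewrite fmorph_eq0 g_neq0. Qed.

Let givenP th' ths vphi phi : pa_given_by iota p th' ths vphi phi ->
  [/\ forall i, (i <= d)%N -> th i = th' i,
      forall i, (i <= d)%N -> x i = ths i,
      forall i, (i < d)%N -> phi i.+1 * gL i = vphi i.+1 * gL i.+1 &
      forall i, (i < d)%N -> vphi i.+1 != 0].
Proof.
case=> H1 H2 H3 H4; split=> i id.
- by rewrite /th H1 inordK.
- by rewrite /x H2 inordK.
- by rewrite -H3 // -H4 // -!rmorphM gE.
- by rewrite -H3 // fmorph_eq0 vphi_neq0.
Qed.

Let window_operator_q th' ths vphi phi
    (q kappa X Y kap y z a b c sc : L) :
  pa_given_by iota p th' ths vphi phi ->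
  q != 0 -> sc != 0 ->
  (forall i, ths i = kappa + X / q ^+ i + Y * q ^+ i) ->
  (forall i, th' i = kap + y / q ^+ i + z * q ^+ i) ->
  (1 - q ^+ 2 != 0 -> forall i, (i < d)%N -> exists f,
     vphi i.+1 = f * (b * ths i + a * ths i.+1 + c) /\
     phi i.+1 = f * (b * ths i.+1 + a * ths i + c)) ->
  (1 - q ^+ 2 != 0 -> a + b * q = sc * y /\ q * a + b = sc * z * q ^+ d) ->
  window_operator n rho x gL.
Proof.
move=> /givenP [thE xE geq v0] q0 sc0 thsE th'E H ab.
have q2 : 1 - q ^+ 2 != 0.
  apply/eqP => /subr0_eq q2; suff : 0%N = 2%N by [].
  by apply: x_inj; rewrite ?xE ?thsE -?q2 ?expr0 //; lia.
apply: (q_window_operator n_gt1 le_rho (ltnW n_lt) (th := th)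
  (kappa := kappa) (X := X) (Y := Y) (kap := kap)
  (y := y) (z := z) (a := a) (b := b) (c := c) (sc := sc) (q := q)) => //.
- by move=> i id; rewrite xE.
- by move=> i id; rewrite thE.
- apply: twist_of_factors geq v0 _ => i id.
  by rewrite !xE //; [apply: H | apply: ltnW].
- by case: (ab q2).
- by case: (ab q2).
Qed.

Lemma window_operator_I : pa_I iota p -> window_operator n rho x gL.
Proof.
case=> q [h [hs [r1 [r2 [s [ss [q0 r12 given]]]]]]].
have qi0 i : q ^+ i != 0 by rewrite expf_neq0.
set t0 := iota (pa_ths p ord0) in given.
set t1 := iota (pa_th p ord0) in given.
(* [a] and [b] solve [a + b q = q h] and [q a + b = q (h s q) q^d]. *)
pose a := h * (q - s * q ^+ d * q ^+ 3) / (1 - q ^+ 2).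
pose b := h * (s * q ^+ d * q ^+ 2 - q ^+ 2) / (1 - q ^+ 2).
pose kappa := t0 - hs - hs * ss * q.
pose c := - h * hs * q * (r1 + r2) - kappa * (a + b).
apply: (window_operator_q (sc := q) (a := a) (b := b) (c := c) given q0
  (kappa := kappa) (X := hs) (Y := hs * ss * q)
  (kap := t1 - h - h * s * q) (y := h) (z := h * s * q)) => //.
- by move=> i; rewrite /kappa exprS; field; rewrite qi0.
- by move=> i; rewrite exprS; field; rewrite qi0.
- (* The factor shared by [vphi_(i+1)] and [phi_(i+1)]. *)
  move=> q21 i id; exists ((1 - q ^+ i.+1) * (1 - q ^+ i / q ^+ d) / q ^+ i.+1).
  rewrite exprz_1B2 // exprz_Bd1 // exprz_dB2 // /c /a /b /kappa !exprS.
  move: r12; rewrite exprS => r12.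
  split.
    rewrite -[_ * (1 - r1 * _) * _]mulrA.
    have -> : (1 - r1 * (q * q ^+ i)) * (1 - r2 * (q * q ^+ i)) =
        1 - (r1 + r2) * (q * q ^+ i) + s * ss * (q * q ^+ d) * (q * q ^+ i) ^+ 2.
      by rewrite -r12; ring.
    by field; rewrite q0 q21 !qi0.
  case: eqP => /= [ss0|/eqP ss0].
    by rewrite ss0; field; rewrite q0 q21 !qi0.
  rewrite -[_ * (r1 - _) * _]mulrA.
  have -> : (r1 - ss * (q * q ^+ i)) * (r2 - ss * (q * q ^+ i)) =
      ss * (s * (q * q ^+ d) - (r1 + r2) * (q * q ^+ i) + ss * (q * q ^+ i) ^+ 2).
    transitivity (r1 * r2 - ss * (r1 + r2) * (q * q ^+ i)
        + ss ^+ 2 * (q * q ^+ i) ^+ 2); first by ring.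
    by rewrite r12; ring.
  by field; rewrite q0 q21 !qi0 ss0.
- by move=> q21; split; rewrite /a /b; field.
Qed.
Lemma window_operator_IA : pa_IA iota p -> window_operator n rho x gL.
Proof.
case=> q [hs [r [s [q0 given]]]].
have qi0 i : q ^+ i != 0 by rewrite expf_neq0.
set t0 := iota (pa_ths p ord0) in given.
set t1 := iota (pa_th p ord0) in given.
pose a := - s * q ^+ d * q ^+ 3 / (1 - q ^+ 2).
pose b := s * q ^+ d * q ^+ 2 / (1 - q ^+ 2).
pose kappa := t0 - hs.
pose c := - r * hs * q - kappa * (a + b).
apply: (window_operator_q (sc := q) (a := a) (b := b) (c := c) given q0
  (kappa := kappa) (X := hs) (Y := 0)
  (kap := t1 - s * q) (y := 0) (z := s * q)) => //.
- by move=> i; rewrite /kappa; field; rewrite qi0.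
- by move=> i; ring.
- move=> q21 i id; exists ((1 - q ^+ i.+1) * (1 - q ^+ i / q ^+ d) / q ^+ i.+1).
  rewrite exprz_1B // exprz_Bd1 // exprz_dB2 // /c /a /b /kappa !exprS.
  by split; field; rewrite q0 q21 !qi0.
- by move=> q21; split; rewrite /a /b; field.
Qed.

Let window_operator_quadratic th' ths vphi phi
    (kappa u v kap y z a b c : L) :
  pa_given_by iota p th' ths vphi phi ->
  (forall i, ths i = kappa + u * i%:R ^+ 2 + v * i%:R) ->
  (forall i, th' i = kap + y * i%:R ^+ 2 + z * i%:R) ->
  (2 != 0 :> L -> forall i, (i < d)%N -> exists f,
     vphi i.+1 = f * (b * ths i + a * ths i.+1 + c) /\
     phi i.+1 = f * (b * ths i.+1 + a * ths i + c)) ->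
  (2 != 0 :> L -> a + b = y /\ a - b = z + d%:R * y) ->
  window_operator n rho x gL.
Proof.
move=> /givenP [thE xE geq v0] thsE th'E H ab.
have two : 2 != 0 :> L.
  apply/eqP => two; suff : 0%N = 2%N by [].
  by apply: x_inj; rewrite ?xE ?thsE ?two //; lia.
apply: (quadratic_window_operator n_gt1 le_rho (ltnW n_lt) (th := th)
  (kappa := kappa) (u := u) (v := v) (kap := kap)
  (y := y) (z := z) (a := a) (b := b) (c := c)) => //.
- by move=> i id; rewrite xE.
- by move=> i id; rewrite thE.
- apply: twist_of_factors geq v0 _ => i id.
  by rewrite !xE //; [apply: H | apply: ltnW].
- by case: (ab two).
- by case: (ab two).
Qed.

Lemma window_operator_II : pa_II iota p -> window_operator n rho x gL.
Proof.
case=> h [hs [r1 [r2 [s [ss [r12 given]]]]]].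
set t0 := iota (pa_ths p ord0) in given.
set t1 := iota (pa_th p ord0) in given.
pose a := h * (s + d%:R + 2) / 2.
pose b := h * (- s - d%:R) / 2.
pose c := h * hs * r1 * r2 + h * hs * ss * (- s - d%:R) / 2 - t0 * h.
apply: (window_operator_quadratic (a := a) (b := b) (c := c) given
  (kappa := t0) (u := hs) (v := hs * (1 + ss))
  (kap := t1) (y := h) (z := h * (1 + s))) => //.
- by move=> i; ring.
- by move=> i; ring.
- move=> two i id; exists (i.+1%:R * (i.+1%:R - d%:R - 1)).
  have r2E : r2 = s + ss + d%:R + 1 - r1 by rewrite -r12; ring.
  by rewrite /c /a /b r2E -[i.+1%:R]natr1; split; field.
- by move=> two; split; rewrite /a /b; field.
Qed.

Lemma window_operator_IIA : pa_IIA iota p -> window_operator n rho x gL.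
Proof.
case=> h [r [s [ss given]]].
set t0 := iota (pa_ths p ord0) in given.
set t1 := iota (pa_th p ord0) in given.
pose a := h * (s + d%:R + 2) / 2.
pose b := h * (- s - d%:R) / 2.
pose c := h * ss * r + b * ss - t0 * h.
apply: (window_operator_quadratic (a := a) (b := b) (c := c) given
  (kappa := t0) (u := 0) (v := ss)
  (kap := t1) (y := h) (z := h * (1 + s))) => //.
- by move=> i; ring.
- by move=> i; ring.
- move=> two i id; exists (i.+1%:R * (i.+1%:R - d%:R - 1)).
  by rewrite /c /a /b -[i.+1%:R]natr1; split; field.
- by move=> two; split; rewrite /a /b; field.
Qed.

Lemma window_operator_IIB : pa_IIB iota p -> window_operator n rho x gL.
Proof.
case=> hs [r [s [ss given]]].
set t0 := iota (pa_ths p ord0) in given.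
set t1 := iota (pa_th p ord0) in given.
apply: (window_operator_quadratic (a := s / 2) (b := - s / 2)
  (c := hs * s * (r - ss / 2)) given
  (kappa := t0) (u := hs) (v := hs * (1 + ss))
  (kap := t1) (y := 0) (z := s)) => //.
- by move=> i; ring.
- by move=> i; ring.
- move=> two i id; exists (i.+1%:R * (i.+1%:R - d%:R - 1)).
  by rewrite -[i.+1%:R]natr1; split; field.
- by move=> two; split; field.
Qed.

Lemma window_operator_IIC : pa_IIC iota p -> window_operator n rho x gL.
Proof.
case=> r [s [ss given]].
set t0 := iota (pa_ths p ord0) in given.
set t1 := iota (pa_th p ord0) in given.
apply: (window_operator_quadratic (a := s / 2) (b := - s / 2)
  (c := r - s * ss / 2) given
  (kappa := t0) (u := 0) (v := ss)
  (kap := t1) (y := 0) (z := s)) => //.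
- by move=> i; ring.
- by move=> i; ring.
- move=> two i id; exists (i.+1%:R * (i.+1%:R - d%:R - 1)).
  by rewrite -[i.+1%:R]natr1; split; field.
- by move=> two; split; field.
Qed.

Let window_operator_alternating th' ths vphi phi
    (kappa u v kap y z a b c : L) :
  pa_given_by iota p th' ths vphi phi -> ~~ odd d -> ~~ odd n ->
  (forall i, ths i = kappa + (-1) ^+ i * (u + v * i%:R)) ->
  (forall i, th' i = kap + (-1) ^+ i * (y + z * i%:R)) ->
  (forall i, (i < d)%N -> exists f,
     vphi i.+1 = f * (b * ths i + a * ths i.+1 + c) /\
     phi i.+1 = f * (b * ths i.+1 + a * ths i + c)) ->
  a - b = - z -> a + b = - 2 * y - d%:R * z ->
  window_operator n rho x gL.
Proof.
move=> /givenP [thE xE geq v0] d_even n_even thsE th'E H ab1 ab2.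
apply: (alternating_window_operator n_gt1 le_rho (ltnW n_lt) (th := th)
  (kappa := kappa) (u := u) (v := v) (kap := kap)
  (y := y) (z := z) (a := a) (b := b) (c := c)) => //.
- by move=> i id; rewrite xE.
- by move=> i id; rewrite thE.
- apply: twist_of_factors geq v0 _ => i id.
  by rewrite !xE //; [apply: H | apply: ltnW].
Qed.

Let window_operator_parity th' ths vphi phi
    (kappa u v kap y z r p0 : L) :
  let s := 1 - 2 * (u / v) in
  pa_given_by iota p th' ths vphi phi -> odd d -> odd n -> ~~ odd rho ->
  (forall i, ths i = kappa + (-1) ^+ i * (u + v * i%:R)) ->
  (forall i, th' i = kap + (-1) ^+ i * (y + z * i%:R)) ->
  (forall i, odd i -> phi i.+1 = vphi i.+1) ->
  (z != 0 -> v != 0 -> forall i, ~~ odd i -> exists f,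
     vphi i.+1 = f * (i.+1%:R ^+ 2 + r * i.+1%:R + p0) /\
     phi i.+1 = f * ((i.+1%:R - s) ^+ 2 - r * (i.+1%:R - s) + p0)) ->
  (z != 0 -> v != 0 -> r = 2 * (y / z) + 2 * (u / v) + d%:R - 1) ->
  window_operator n rho x gL.
Proof.
move=> s /givenP [thE xE geq vn0] d_odd n_odd rho_even thsE th'E H_odd H_even rE.
have z0 : z != 0.
  apply/eqP => z0; suff : 0%N = 2%N by [].
  by apply: th_injL; rewrite ?thE ?th'E //; try lia;
     rewrite z0 sqrrN expr1n !mul0r.
have v0 : v != 0.
  apply/eqP => v0; suff : 0%N = 2%N by [].
  by apply: x_inj; rewrite ?xE ?thsE //; try lia;
     rewrite v0 sqrrN expr1n !mul0r.
apply: (parity_window_operator n_gt1 le_rho (ltnW n_lt) (th := th)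
  (kappa := kappa) (u := u) (v := v) (kap := kap)
  (y := y) (z := z) (r := r) (p := p0)) => //.
- by move=> i id; rewrite xE.
- by move=> i id; rewrite thE.
- by move=> i id i_odd; apply: (mulfI (vn0 i id)); rewrite -geq // H_odd.
- move=> i id i_even; have [f [vE pE]] := H_even z0 v0 i i_even.
  have f0 : f != 0.
    by apply: contra_neq (vn0 i id) => f0; rewrite vE f0 mul0r.
  by apply: (mulfI f0); rewrite [LHS]mulrA [RHS]mulrA -vE -pE geq.
- exact: rE.
Qed.

Lemma window_operator_III : pa_III iota p ->
  (~~ odd d -> ~~ odd n) -> (odd d -> odd n /\ ~~ odd rho) ->
  window_operator n rho x gL.
Proof.
case=> h [hs [r1 [r2 [s [ss [r12 given]]]]]] d_even d_odd.
set t0 := iota (pa_ths p ord0) in given.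
set t1 := iota (pa_th p ord0) in given.
pose u := hs * (1 - ss); pose v := 2 * hs.
pose y := h * (1 - s); pose z := 2 * h.
have r2E : r2 = - s - ss + d%:R + 1 - r1 by rewrite -r12; ring.
case: (boolP (odd d)) => [dO|dE].
  have [nO rE] := d_odd dO.
  apply: (window_operator_parity (kappa := t0 + hs * (ss - 1)) (u := u) (v := v)
    (kap := t1 + h * (s - 1)) (y := y) (z := z) (r := r1 + r2)
    (p0 := r1 * r2) given dO nO rE).
  - by move=> i; rewrite /u /v; ring.
  - by move=> i; rewrite /y /z; ring.
  - by move=> i i_odd; rewrite dO /= negbK i_odd.
  - move=> z0; rewrite /v mulf_eq0 negb_or => /andP [two hs0] i i_even.
    exists (- 4 * h * hs); rewrite dO /= i_even r2E /u.
    by split; field; rewrite ?two ?hs0.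
  - rewrite /z /v !mulf_eq0 !negb_or => /andP [two h0] /andP [_ hs0].
    by rewrite r2E /u /y; field; rewrite two h0 hs0.
apply: (window_operator_alternating
  (a := h * (s - d%:R - 2)) (b := h * (s - d%:R))
  (c := - 2 * h * hs * (r1 - r2)
        - (t0 + hs * (ss - 1)) * (2 * h * (s - d%:R - 1)))
  (kappa := t0 + hs * (ss - 1)) (u := u) (v := v)
  (kap := t1 + h * (s - 1)) (y := y) (z := z) given dE (d_even dE)).
- by move=> i; rewrite /u /v; ring.
- by move=> i; rewrite /y /z; ring.
- move=> i id.
  (* The sign [(-1)^(i+1)] is moved from the affine factor into this one. *)
  exists (if odd i then i%:R + 1 else - (i%:R - d%:R)).
  rewrite dE /= negbK r2E exprS -signr_odd -[i.+1%:R]natr1.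
  by case: (odd i) => /=; rewrite ?expr1 ?expr0; split; ring.
- by rewrite /z; ring.
- by rewrite /y /z; ring.
Qed.

End FromCases.

(** * Bases and matrices of endomorphisms *)

Section Bases.
Variables (K : fieldType) (V : vectType K) (n : nat).
Implicit Types (u : 'I_n.+1 -> V) (T : 'End(V)).

Definition basis_family u := basis_of fullv (mktuple u).

Definition component u (i : 'I_n.+1) : V -> K := coord (mktuple u) i.

Lemma component_scalar u i : scalar (component u i).
Proof. by move=> a v v'; rewrite /component linearP. Qed.
HB.instance Definition _ u i :=
  GRing.isLinear.Build K V K *%R (component u i) (component_scalar u i).

Lemma nth_mktuple_ord u (i : 'I_n.+1) : (mktuple u)`_i = u i.
Proof. by rewrite -tnth_nth tnth_mktuple. Qed.

Lemma component_expand u v : basis_family u -> v = \sum_i component u i v *: u i.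
Proof.
move=> bu; rewrite [LHS](coord_basis bu (memvf v)).
by apply: eq_bigr => i _; rewrite nth_mktuple_ord.
Qed.

Lemma component_lincomb u (c : 'I_n.+1 -> K) i :
  basis_family u -> component u i (\sum_j c j *: u j) = c i.
Proof.
move=> bu; rewrite /component -[RHS](coord_sum_free c i (basis_free bu)).
by congr (coord _ i _); apply: eq_bigr => j _; rewrite nth_mktuple_ord.
Qed.

Lemma component_basis u i j : basis_family u -> component u i (u j) = (i == j)%:R.
Proof.
move=> bu; rewrite -[X in component u i X](_ : \sum_k (k == j)%:R *: u k = _).
  by rewrite component_lincomb.
rewrite (bigD1 j) //= eqxx scale1r big1 ?addr0 // => k /negPf ->.
by rewrite scale0r.
Qed.

Lemma basis_neq0 u i : basis_family u -> u i != 0.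
Proof.
move=> bu; apply/eqP => u0; have := component_basis i i bu.
by rewrite u0 linear0 eqxx => /esym/eqP; rewrite oner_eq0.
Qed.

Lemma basis_family_dim u : basis_family u -> \dim (fullv : {vspace V}) = n.+1.
Proof. exact: size_basis. Qed.

Lemma basis_family_free u : \dim (fullv : {vspace V}) = n.+1 ->
  (forall c : 'I_n.+1 -> K, \sum_i c i *: u i = 0 -> forall i, c i = 0) ->
  basis_family u.
Proof.
move=> dimV H; rewrite /basis_family basisEfree subvf size_tuple dimV leqnn.
rewrite !andbT; apply/freeP => c cE; apply: H; rewrite -[RHS]cE.
by apply: eq_bigr => i _; rewrite nth_mktuple_ord.
Qed.

Lemma eq_on_basis (W : vectType K) u (T1 T2 : 'Hom(V, W)) : basis_family u ->
  (forall i, T1 (u i) = T2 (u i)) -> T1 = T2.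
Proof.
move=> bu H; apply/lfunP => v; rewrite (component_expand v bu) !linear_sum.
by apply: eq_bigr => i _; rewrite !linearZ /= H.
Qed.

Definition extend (W : vectType K) u (h : 'I_n.+1 -> W) (v : V) : W :=
  \sum_i component u i v *: h i.

Lemma extend_linear (W : vectType K) u (h : 'I_n.+1 -> W) : linear (extend u h).
Proof.
move=> a v v'; rewrite /extend scaler_sumr -big_split /=.
by apply: eq_bigr => i _; rewrite /component linearP scalerDl scalerA.
Qed.
HB.instance Definition _ (W : vectType K) u (h : 'I_n.+1 -> W) :=
  GRing.isLinear.Build K V W _ (extend u h) (extend_linear u h).

Lemma extend_basis (W : vectType K) u (h : 'I_n.+1 -> W) i :
  basis_family u -> linfun (extend u h) (u i) = h i.
Proof.
move=> bu; rewrite lfunE /= /extend (bigD1 i) //= component_basis // eqxx scale1r.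
by rewrite big1 ?addr0 // => j /negPf ji; rewrite component_basis // ji scale0r.
Qed.

(** Applying polynomials in [T] to a linear relation multiplies its
    coefficients by the values at the eigenvalues; interpolation isolates each
    of them. *)
Lemma eigenvectors_free u (t : 'I_n.+1 -> K) T :
  injective t -> (forall i, u i != 0) -> (forall i, T (u i) = t i *: u i) ->
  forall c : 'I_n.+1 -> K, \sum_i c i *: u i = 0 -> forall i, c i = 0.
Proof.
move=> tinj un0 uE c c0 k.
have poly0 (p : {poly K}) : \sum_i (p.[t i] * c i) *: u i = 0.
  elim/poly_ind: p => [|p a IH].
    by rewrite big1 // => i _; rewrite horner0 mul0r scale0r.
  transitivity (T (\sum_i (p.[t i] * c i) *: u i) + a *: \sum_i c i *: u i).
    rewrite linear_sum scaler_sumr -big_split /=.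
    apply: eq_bigr => i _; rewrite linearZ /= uE !scalerA -scalerDl.
    by congr (_ *: _); rewrite hornerMXaddC; ring.
  by rewrite IH c0 linear0 scaler0 addr0.
pose p := \prod_(l | l != k) ('X - (t l)%:P).
have pk : p.[t k] != 0.
  rewrite horner_prod; apply/prodf_neq0 => l lk.
  by rewrite !hornerE subr_eq0 (inj_eq tinj) eq_sym.
have := poly0 p; rewrite (bigD1 k) //= big1 ?addr0 => [/eqP|i ik].
  by rewrite scaler_eq0 (negPf (un0 k)) orbF mulf_eq0 (negPf pk) => /eqP.
suff -> : p.[t i] = 0 by rewrite mul0r scale0r.
by rewrite horner_prod (bigD1 i) //= !hornerE subrr mul0r.
Qed.

Lemma leigenspaceP T mu v :
  reflect (T v = mu *: v) (v \in passmx.leigenspace T mu).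
Proof.
rewrite memv_ker !lfun_simp subr_eq0; exact: eqP.
Qed.

Lemma leigenvalueP T mu :
  passmx.leigenvalue T mu <-> exists2 v, v != 0 & T v = mu *: v.
Proof.
split=> [H|[v v0 /leigenspaceP vE]].
  exists (vpick (passmx.leigenspace T mu)); first by rewrite vpick0.
  exact/leigenspaceP/memv_pick.
by apply: contraNneq v0 => E; move: vE; rewrite E memv0.
Qed.

(** Row convention: row [i] contains the coordinates of [T (u i)]. *)
Definition mat u T : 'M[K]_n.+1 := \matrix_(i, j) component u j (T (u i)).

Lemma matE u T i : basis_family u -> T (u i) = \sum_j mat u T i j *: u j.
Proof.
by move=> bu; rewrite {1}(component_expand (T (u i)) bu); apply: eq_bigr => j _; rewrite mxE.
Qed.

Lemma decomposition_basis (U : 'I_n.+1 -> {vspace V}) : decomposition U ->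
  exists2 u, basis_family u & forall i, U i = <[u i]>%VS.
Proof.
case=> dimU sumU dirU.
have UE i : U i = <[vpick (U i)]>%VS.
  apply/esym/eqP; rewrite eqEdim -memvE memv_pick dimU dim_vline.
  by rewrite vpick0 -dimv_eq0 dimU.
exists (fun i => vpick (U i)) => //.
have dimV : \dim (fullv : {vspace V}) = n.+1.
  rewrite -sumU; move/directvP: dirU => /= ->.
  by under eq_bigr => i _ do rewrite dimU; rewrite sum1_card card_ord.
apply: basis_family_free => // c c0 i.
have /directv_sum_independent := dirU.
move=> /(_ (fun i => c i *: vpick (U i))) H.
have /eqP := H (fun i _ => memvZ _ (memv_pick _)) c0 i isT.
by rewrite scaler_eq0 vpick0 -dimv_eq0 dimU orbF => /eqP.
Qed.

End Bases.

(** * Modules over a matrix algebra *)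

Section MatrixModule.
Variables (K : fieldType) (calA : algType K) (V : vectType K).
Variables (act : {linear calA -> 'End(V)}) (n : nat).
Variables (f : {lrmorphism calA -> 'M[K]_n.+1}).
Hypotheses (f_bij : bijective f) (irrV : irreducible_module act).

(** The images of one vector under the matrix units of the first column; the
    vector is chosen outside the kernel of the first diagonal unit, which is
    not all of [V] because the units generate [1]. *)
Lemma matrix_module_basis :
  exists2 w : 'I_n.+1 -> V, basis_family w &
    forall a j, act a (w j) = \sum_i f a i j *: w i.
Proof.
case: irrV => -[act1 actM] V0 irr; case: f_bij => g gK fK.
pose e i j := g (delta_mx i j : 'M[K]_n.+1).
have fe i j : f (e i j) = delta_mx i j by rewrite /e fK.
have fM a b : f (a * b) = f a *m f b by exact: rmorphM.
have fMn a k : f (a *+ k) = f a *+ k by exact: rmorphMn.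
have f1 : f 1 = 1%:M by exact: rmorph1.
have fZ k a : f (k *: a) = k *: f a by exact: linearZ.
have fsum (h : 'I_n.+1 -> calA) : f (\sum_i h i) = \sum_i f (h i).
  exact: raddf_sum.
have f_inj : injective f by exact: can_inj gK.
have eM i j k l : e i j * e k l = e i l *+ (j == k).
  by apply: f_inj; rewrite fM fMn !fe mul_delta_mx_cond.
have [v v0] : exists v, act (e ord0 ord0) v != 0.
  have [v v_neq0] : exists v : V, v != 0.
    exists (vpick (fullv : {vspace V})); rewrite vpick0; exact/eqP.
  have [i ei] : exists i, act (e i i) v != 0.
    apply/existsP; apply: contraR v_neq0; rewrite negb_exists => /forallP H.
    have -> : v = act (\sum_i e i i) v.
      have -> : \sum_i e i i = 1.
        apply: f_inj; rewrite fsum f1.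
        under eq_bigr => i _ do rewrite fe.
        apply/matrixP => k l; rewrite summxE !mxE (bigD1 k) //= !mxE eqxx.
        rewrite big1 ?addr0 => [|m mk]; last first.
          by rewrite mxE eq_sym (negPf mk).
        by rewrite /= eq_sym.
      by rewrite act1 id_lfunE.
    rewrite linear_sum sum_lfunE big1 // => i _.
    by have := H i; rewrite negbK => /eqP.
  exists (act (e ord0 i) v); apply: contraNneq ei => E.
  have -> : e i i = e i ord0 * (e ord0 ord0 * e ord0 i).
    by rewrite !(eM, eqxx, mulr1n).
  by rewrite !actM !comp_lfunE E linear0.
pose w i := act (e i ord0) v.
have actw a j : act a (w j) = \sum_i f a i j *: w i.
  have -> : act a (w j) = act (a * e j ord0) v by rewrite actM comp_lfunE.
  have -> : a * e j ord0 = \sum_i f a i j *: e i ord0.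
    apply: f_inj; rewrite fM fe fsum.
    apply/matrixP => k l; rewrite mxE summxE (bigD1 j) //= [X in _ + X]big1.
      rewrite addr0 [RHS](bigD1 k) //= [X in _ = _ + X]big1.
        by rewrite addr0 fZ fe !mxE !eqxx.
      by move=> i ik; rewrite fZ fe !mxE eq_sym (negPf ik) mulr0.
    by move=> i ij; rewrite mxE (negPf ij) mulr0.
  rewrite linear_sum sum_lfunE; apply: eq_bigr => i _.
  by rewrite linearZ /= scale_lfunE.
exists w => //.
have wfree (c : 'I_n.+1 -> K) : \sum_i c i *: w i = 0 -> forall i, c i = 0.
  move=> c0 i; have /(congr1 (act (e ord0 i))) := c0.
  rewrite linear0 linear_sum /= (bigD1 i) //= big1 ?addr0 => [|j ji].
    rewrite linearZ /= actw (bigD1 ord0) //= big1 ?addr0 => [|k k0].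
      rewrite fe mxE !eqxx scale1r => /eqP; rewrite scaler_eq0 => /orP [/eqP //|].
      by rewrite (negPf v0).
    by rewrite fe mxE (negPf k0) scale0r.
  rewrite linearZ /= actw big1 ?scaler0 // => k _.
  by rewrite fe mxE (negPf ji) andbF scale0r.
rewrite /basis_family /basis_of.
have -> /= : free (mktuple w).
  apply/freeP => c c0; apply: wfree; rewrite -[RHS]c0.
  by apply: eq_bigr => i _; rewrite nth_mktuple_ord.
rewrite andbT; case: (irr <<mktuple w>>%VS) => [a|/eqP|->] //.
  apply/subvP => _ /memv_imgP [x xw ->].
  rewrite (coord_span xw) linear_sum memv_suml // => i _.
  rewrite linearZ memvZ //= nth_mktuple_ord actw memv_suml // => k _.
  by rewrite memvZ // memv_span // -[w k](tnth_mktuple w) mem_tnth.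
rewrite -subv0 => /subvP/(_ (w ord0)).
rewrite memv_span => [/(_ isT)|]; last by rewrite -[w _](tnth_mktuple w) mem_tnth.
by rewrite memv0 (negPf v0).
Qed.

Lemma act_injective a : act a = 0 -> a = 0.
Proof.
have [w bw actw] := matrix_module_basis => a0.
apply: (bij_inj f_bij); rewrite rmorph0; apply/matrixP => i j.
by rewrite -(component_lincomb (fun i => f a i j) i bw) -actw a0 lfunE linear0 mxE.
Qed.

Lemma act_surjective (T : 'End(V)) : exists a, act a = T.
Proof.
have [w bw actw] := matrix_module_basis; case: (f_bij) => g gK fK.
exists (g (mat w T)^T); apply: (eq_on_basis bw) => i.
by rewrite actw fK (matE _ _ bw); apply: eq_bigr => j _; rewrite !mxE.
Qed.

End MatrixModule.

(** * Primitive idempotents and tridiagonal relations *)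

Section Idempotents.
Variables (K : fieldType) (calA : algType K) (V : vectType K).
Variables (act : {linear calA -> 'End(V)}) (n : nat).
Hypothesis act_inj : forall a, act a = 0 -> a = 0.
Hypothesis act1 : act 1 = \1%VF.
Hypothesis actM : forall a b, act (a * b) = (act a \o act b)%VF.
Implicit Types (u : 'I_n.+1 -> V) (E : 'I_n.+1 -> calA) (t : 'I_n.+1 -> K).

Definition diagonalizes (a : calA) E u t :=
  [/\ basis_family u, injective t,
      forall i, act a (u i) = t i *: u i &
      forall k i, act (E k) (u i) = (k == i)%:R *: u i].

Lemma act_eq a b : act a = act b -> a = b.
Proof.
by move=> ab; apply/subr0_eq/act_inj; rewrite linearB /= ab subrr.
Qed.

Lemma eigenvector_component u t (a : calA) mu v : basis_family u ->
  (forall i, act a (u i) = t i *: u i) -> act a v = mu *: v ->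
  forall i, component u i v != 0 -> mu = t i.
Proof.
move=> bu uE vE i; apply: contraNeq => mu_t.
have : component u i (act a v) = component u i (mu *: v) by rewrite vE.
rewrite {1}(component_expand v bu) linear_sum.
have -> : \sum_j act a (component u j v *: u j) =
    \sum_j (component u j v * t j) *: u j.
  by apply: eq_bigr => j _; rewrite linearZ /= uE scalerA.
rewrite component_lincomb // linearZ /= => /eqP.
rewrite -subr_eq0 [_ * t i]mulrC -mulrBl mulf_eq0 subr_eq0 eq_sym.
by rewrite (negPf mu_t).
Qed.

Lemma eigenvalue_of_diagonal u t (a : calA) mu : basis_family u ->
  (forall i, act a (u i) = t i *: u i) ->
  passmx.leigenvalue (act a) mu -> exists i, mu = t i.
Proof.
move=> bu uE /leigenvalueP [v v0 vE].
have [i ci] : exists i, component u i v != 0.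
  apply/existsP; apply: contraR v0; rewrite negb_exists => /forallP H.
  rewrite (component_expand v bu) big1 // => i _.
  by have := H i; rewrite negbK => /eqP ->; rewrite scale0r.
by exists i; apply: eigenvector_component ci.
Qed.

Lemma diagonalizes_idempotent a E u t k : diagonalizes a E u t ->
  primitive_idempotent act a (t k) (E k).
Proof.
case=> bu tinj uE EE; split.
- by apply/leigenvalueP; exists (u k); rewrite ?basis_neq0.
- move=> v /leigenspaceP vE.
  rewrite {1}(component_expand v bu) [RHS](component_expand v bu) linear_sum.
  apply: eq_bigr => i _ /=; rewrite linearZ /= EE.
  case: (eqVneq (component u i v) 0) => [->|ci]; first by rewrite !scale0r.
  by rewrite (tinj _ _ (eigenvector_component bu uE vE ci)) eqxx scale1r.
- move=> mu v mu_t /leigenspaceP vE.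
  rewrite (component_expand v bu) linear_sum big1 // => i _ /=.
  rewrite linearZ /= EE.
  case: (eqVneq (component u i v) 0) => [->|ci]; first by rewrite !scale0r.
  case: eqP => [ki|_]; last by rewrite scale0r scaler0.
  by rewrite ki -(eigenvector_component bu uE vE ci) eqxx in mu_t.
Qed.

Lemma diagonalizes_ordering a E u t : diagonalizes a E u t ->
  multiplicity_free act n a /\ primitive_idempotent_ordering act a E.
Proof.
move=> dE; have [bu tinj uE EE] := dE; split.
  by exists t; split=> // i; case: (diagonalizes_idempotent i dE).
split=> [k l kl|e].
  have := EE k k; rewrite eqxx scale1r {1}kl EE.
  case: eqP => [->//|_]; rewrite scale0r => /esym/eqP.
  by rewrite (negPf (basis_neq0 k bu)).
split=> [[i <-]|[th [th_eig th1 th0]]].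
  by exists (t i); apply: diagonalizes_idempotent dE.
have [i thE] := eigenvalue_of_diagonal bu uE th_eig; exists i; apply: act_eq.
apply: (eq_on_basis bu) => j; rewrite EE; case: eqP => [<-|ij].
  by rewrite scale1r th1 // thE; apply/leigenspaceP.
rewrite scale0r (th0 (t j)) //; last by apply/leigenspaceP.
by rewrite thE (inj_eq tinj) eq_sym; apply/eqP.
Qed.

(** The scalars attached to the [E k] are distinct: two idempotents with the
    same scalar would act alike on a basis of eigenvectors. *)
Lemma ordering_diagonalizes a E : \dim (fullv : {vspace V}) = n.+1 ->
  multiplicity_free act n a -> primitive_idempotent_ordering act a E ->
  exists u t, diagonalizes a E u t.
Proof.
move=> dimV [th [th_inj th_eig]] [E_inj EP].
have /fin_all_exists [x xP] : forall i : 'I_n.+1, exists v : V,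
    v != 0 /\ act a v = th i *: v.
  by move=> i; have /leigenvalueP [v v0 vE] := th_eig i; exists v.
have bx : basis_family x.
  apply: basis_family_free => //; apply: (eigenvectors_free (T := act a) th_inj) => i.
    by case: (xP i).
  by case: (xP i).
have xE i : act a (x i) = th i *: x i by case: (xP i).
have /fin_all_exists [t tP] : forall i : 'I_n.+1, exists mu : K,
    primitive_idempotent act a mu (E i).
  by move=> i; apply/EP; exists i.
have tinj : injective t.
  move=> k l kl; apply/E_inj/act_eq/(eq_on_basis bx) => i.
  have [_ k1 k0] := tP k; have [_ l1 l0] := tP l.
  have xi : x i \in passmx.leigenspace (act a) (th i) by apply/leigenspaceP.
  case: (eqVneq (th i) (t k)) => ik.
    by rewrite k1 -?ik // l1 // -kl -ik.
  by rewrite (k0 (th i)) // (l0 (th i)) // -kl.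
have /fin_all_exists [u uP] : forall i : 'I_n.+1, exists v : V,
    v != 0 /\ act a v = t i *: v.
  by move=> i; have [/leigenvalueP [v v0 vE] _ _] := tP i; exists v.
exists u, t; split=> //.
- apply: basis_family_free => //; apply: (eigenvectors_free (T := act a) tinj) => i.
    by case: (uP i).
  by case: (uP i).
- by move=> i; case: (uP i).
- move=> k i; have [_ k1 k0] := tP k; have [_ uE] := uP i.
  have ui : u i \in passmx.leigenspace (act a) (t i) by apply/leigenspaceP.
  case: (eqVneq k i) => [->|ki]; first by have [_ -> //] := tP i; rewrite scale1r.
  by rewrite scale0r (k0 (t i)) // (inj_eq tinj) eq_sym.
Qed.

Lemma diagonalizes_eigenvalue a E u t k mu : diagonalizes a E u t ->
  primitive_idempotent act a mu (E k) -> mu = t k.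
Proof.
move=> [bu tinj uE EE] [_ mu1 mu0]; apply/eqP; apply: contraT => mut.
have := mu0 (t k) (u k); rewrite eq_sym => /(_ mut).
rewrite EE eqxx scale1r => H; have /eqP := H (introT (leigenspaceP _ _ _) (uE k)).
by rewrite (negPf (basis_neq0 k bu)).
Qed.

Lemma limg_idempotent a E u t k : diagonalizes a E u t ->
  limg (act (E k)) = <[u k]>%VS.
Proof.
case=> bu _ _ EE; apply/vspaceP => v; apply/memv_imgP/vlineP.
  case=> x _ ->; exists (component u k x).
  rewrite {1}(component_expand x bu) linear_sum (bigD1 k) //= big1 ?addr0.
    by rewrite linearZ /= EE eqxx scale1r.
  by move=> i ik; rewrite linearZ /= EE eq_sym (negPf ik) scale0r scaler0.
case=> c ->; exists (c *: u k); first exact: memvf.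
by rewrite linearZ /= EE eqxx scale1r.
Qed.

(** [E_i a E_j] is the elementary map from the line [j] to the line [i] whose
    scalar is the matrix entry of [a]. *)
Lemma sandwich_basis b E u t a i j k : diagonalizes b E u t ->
  act (E i * a * E j) (u k) =
  (mat u (act a) j i *+ (j == k)) *: u i.
Proof.
move=> [bu _ _ EE]; rewrite !actM !comp_lfunE EE linearZ /=.
case: eqP => [<-|_]; last by rewrite scale0r linear0 scale0r.
rewrite scale1r (matE _ j bu) linear_sum (bigD1 i) //= big1 ?addr0 => [|l li].
  by rewrite linearZ /= EE eqxx scale1r.
by rewrite linearZ /= EE eq_sym (negPf li) scale0r scaler0.
Qed.

Lemma sandwich_eq0 b E u t a i j : diagonalizes b E u t ->
  E i * a * E j = 0 <-> mat u (act a) j i = 0.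
Proof.
move=> dE; have [bu _ _ _] := dE; split=> [e0|m0].
  have := sandwich_basis a i j j dE.
  rewrite e0 linear0 lfunE /= eqxx => /esym/eqP.
  by rewrite scaler_eq0 (negPf (basis_neq0 i bu)) orbF => /eqP.
apply/act_inj/(eq_on_basis bu) => k.
by rewrite (sandwich_basis _ _ _ _ dE) m0 mul0rn scale0r lfunE.
Qed.

Lemma tridiagonal_relationsP b E u t a : diagonalizes b E u t ->
  tridiagonal_relations E a <-> irreducible_tridiagonal (mat u (act a)).
Proof.
move=> dE; split=> [H|[tri irr] i j].
  split=> i j ij; have [H1 H2] := H j i.
    by apply/(sandwich_eq0 _ _ _ dE)/H1; move: ij; rewrite /far; lia.
  apply/eqP => /(sandwich_eq0 _ _ _ dE); apply: H2.
  by move: ij; rewrite /adjacent; lia.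
split=> ij.
  by apply/(sandwich_eq0 _ _ _ dE)/tri; rewrite /far; lia.
move/(sandwich_eq0 _ _ _ dE)/eqP; apply/negP/irr.
by rewrite /adjacent; lia.
Qed.

End Idempotents.

(** * Split sequences *)

Section SplitRatio.
Variables (K : fieldType) (n : nat) (x : nat -> K).
Hypothesis x_inj : forall i j, (i <= n)%N -> (j <= n)%N -> x i = x j -> i = j.

(** [a i k] stands for the coefficient on the [i]-th eigenvector of [A*] of
    the [k]-th vector of a split sequence. *)
Definition split_array (vphi : nat -> K) (a : nat -> nat -> K) :=
  (forall i k, (i <= n)%N -> (k < n)%N ->
     (x i - x k.+1) * a i k.+1 = vphi k.+1 * a i k) /\
  (forall i, (i <= n)%N -> (x i - x 0) * a i 0 = 0).

Definition diagonal_growth (m : nat -> K) (a : nat -> nat -> K) :=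
  forall i, (i < n)%N -> a i.+1 i.+1 = m i * a i i.

(** The split relations express [a i n] through [a i i], and the latter
    through [a 0 0]. *)
Lemma split_array_last vphi m a : split_array vphi a -> diagonal_growth m a ->
  forall i, (i <= n)%N -> a i n =
    (\prod_(i <= k < n) vphi k.+1) / (\prod_(i <= k < n) (x i - x k.+1)) *
    ((\prod_(k < i) m k) * a 0 0).
Proof.
case=> step first diag.
have diagE i : (i <= n)%N -> a i i = (\prod_(k < i) m k) * a 0 0.
  elim: i => [|i IH] i_n; first by rewrite big_ord0 mul1r.
  by rewrite diag // IH ?(ltnW i_n) // big_ord_recr /=; ring.
move=> i i_n; rewrite -diagE //.
suff H N : (i + N <= n)%N -> a i (i + N)%N =
    (\prod_(i <= k < i + N) vphi k.+1)
    / (\prod_(i <= k < i + N) (x i - x k.+1)) * a i i.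
  by have := H (n - i)%N; rewrite subnKC //; apply.
elim: N => [|N IH] iN.
  by rewrite addn0 !big_geq // divr1 mul1r.
have xx : x i - x (i + N).+1 != 0.
  apply/eqP => /subr0_eq/x_inj; lia.
have pp : \prod_(i <= k < i + N) (x i - x k.+1) != 0.
  rewrite prodf_seq_neq0; apply/allP => k; rewrite mem_index_iota => ik /=.
  by apply/eqP => /subr0_eq/x_inj; lia.
rewrite addnS; apply: (mulfI xx); rewrite step //; try lia.
rewrite IH; last by lia.
by rewrite !big_nat_recr ?leq_addr //=; field; rewrite pp xx.
Qed.

Lemma split_array_lower vphi a : split_array vphi a ->
  forall i k, (i <= n)%N -> (k < i)%N -> a i k = 0.
Proof.
case=> step first i k i_n; elim: k => [|k IH] ki.
  have /eqP := first i i_n; rewrite mulf_eq0 => /orP [/eqP/subr0_eq/x_inj|/eqP //].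
  by lia.
have kn : (k < n)%N by lia.
have /eqP := step i k i_n kn; rewrite IH ?mulr0; last by lia.
by rewrite mulf_eq0 => /orP [/eqP/subr0_eq/x_inj|/eqP //]; lia.
Qed.

Lemma split_array_neq0 vphi a : split_array vphi a -> a 0 n != 0 ->
  forall k, (k < n)%N -> vphi k.+1 != 0.
Proof.
case=> step _ a0n.
have H N : (N < n)%N -> vphi (n - N)%N != 0 /\ a 0 (n - N.+1)%N != 0.
  elim: N => [|N IH] Nn.
    have E : (x 0 - x n) * a 0 n = vphi n * a 0 n.-1.
      by have := step 0%N n.-1; rewrite prednK //; apply.
    have : vphi n * a 0 n.-1 != 0.
      by rewrite -E mulf_neq0 //; apply/eqP => /subr0_eq/x_inj; lia.
    by rewrite subn0 subn1 mulf_eq0 negb_or => /andP.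
  have [_ aN] := IH (ltnW Nn).
  have E : (x 0 - x (n - N.+1)%N) * a 0 (n - N.+1)%N =
      vphi (n - N.+1)%N * a 0 (n - N.+2)%N.
    have := step 0%N (n - N.+2)%N isT.
    by rewrite (_ : (n - N.+2).+1 = n - N.+1)%N; [apply; lia | lia].
  have : vphi (n - N.+1)%N * a 0 (n - N.+2)%N != 0.
    by rewrite -E mulf_neq0 //; apply/eqP => /subr0_eq/x_inj; lia.
  by rewrite mulf_eq0 negb_or => /andP.
move=> k kn; have [] := H (n - k.+1)%N; first by lia.
by rewrite (_ : n - (n - k.+1) = k.+1)%N //; lia.
Qed.

(** In the closed forms of [a i n] and [a' i n] the factors built from [x] and
    [m] are the same for the two arrays, and only the products of the [vphi]
    and [phi] remain. *)
Lemma split_ratio vphi phi m a a' :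
  split_array vphi a -> diagonal_growth m a ->
  split_array phi a' -> diagonal_growth m a' ->
  forall i, (i < n)%N ->
    phi i.+1 * (a i n * a' i.+1 n) = vphi i.+1 * (a i.+1 n * a' i n).
Proof.
move=> sa ga sa' ga' i i_n.
rewrite !(split_array_last sa ga) ?(ltnW i_n) //.
rewrite !(split_array_last sa' ga') ?(ltnW i_n) //.
rewrite [\prod_(i <= k < n) vphi _]big_ltn // [\prod_(i <= k < n) phi _]big_ltn //.
by ring.
Qed.

End SplitRatio.

Section TridiagonalAction.
Variables (K : fieldType) (V : vectType K) (n : nat).
Implicit Types (u us : 'I_n.+1 -> V) (S T : 'End(V)).

Lemma component_app u S i v : basis_family u ->
  component u i (S v) = \sum_l component u l v * mat u S l i.
Proof.
move=> bu; rewrite {1}(component_expand v bu) !linear_sum.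
by apply: eq_bigr => l _; rewrite !linearZ /= mxE.
Qed.

(** Each application of [S] moves a basis line by at most one step. *)
Lemma component_iter u S (i j : 'I_n.+1) k : basis_family u -> tridiagonal (mat u S) ->
  (j + k < i)%N || (i + k < j)%N -> component u i (iter k S (u j)) = 0.
Proof.
move=> bu tri; elim: k i => [|k IH] i ij /=.
  rewrite component_basis //; case: eqP => // E; move: ij; rewrite E; lia.
rewrite component_app // big1 // => l _.
case: (boolP ((j + k < l) || (l + k < j))%N) => jl; first by rewrite IH ?mul0r.
by rewrite tri ?mulr0 // /far; lia.
Qed.

Lemma component_eigen us (ths : 'I_n.+1 -> K) S i v : basis_family us ->
  (forall i, S (us i) = ths i *: us i) ->
  component us i (S v) = ths i * component us i v.
Proof.
move=> bus usE; rewrite component_app // (bigD1 i) //= big1 ?addr0 => [|l li].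
  by rewrite mxE usE linearZ /= component_basis // eqxx mulr1 mulrC.
by rewrite mxE usE linearZ /= component_basis // eq_sym (negPf li) !mulr0.
Qed.

(** The vectors without component along [us i] form a subspace stable under
    [S]; if it contained an extreme [u j], irreducibility would let it grow to
    the whole space. *)
Lemma extreme_component_neq0 us u (ths : 'I_n.+1 -> K) S i :
  basis_family us -> basis_family u ->
  (forall i, S (us i) = ths i *: us i) -> irreducible_tridiagonal (mat u S) ->
  component us i (u ord0) != 0 /\ component us i (u ord_max) != 0.
Proof.
move=> bus bu usE [tri irr].
have absurd : ~ (forall k, component us i (u k) = 0).
  move=> H; have := component_basis i i bus.
  rewrite (component_expand (us i) bu) linear_sum big1 => [|k _].
    by rewrite eqxx => /esym/eqP; rewrite oner_eq0.
  by rewrite linearZ /= H mulr0.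
have grow (k l : 'I_n.+1) : adjacent k l -> component us i (u k) = 0 ->
    (forall j : 'I_n.+1, j != l -> adjacent k j -> component us i (u j) = 0) ->
    component us i (u l) = 0.
  move=> kl uk H; have := component_eigen i (u k) bus usE.
  rewrite uk mulr0 (matE _ k bu) linear_sum (bigD1 l) //= big1.
    by rewrite addr0 linearZ => /eqP; rewrite mulf_eq0 (negPf (irr _ _ kl)) => /eqP.
  move=> j jl; rewrite linearZ /=.
  have /or3P [/eqP/val_inj E|kj|kj] := trichotomy k j.
  - by rewrite -E uk mulr0.
  - by rewrite (H j jl kj) mulr0.
  - by rewrite tri // mul0r.
split; apply/eqP => u0; apply: absurd => k.
- suff H N (l : 'I_n.+1) : (l <= N)%N -> component us i (u l) = 0 by apply: (H k).
  elim: N l => [|N IH] l lN.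
    by rewrite (_ : l = ord0) //; apply/val_inj => /=; lia.
  case: (posnP l) => [l0|l0]; first by apply: IH; lia.
  have l1 : (l.-1 < n.+1)%N by have := ltn_ord l; lia.
  apply: (grow (Ordinal l1)); first by rewrite /adjacent /=; lia.
    by apply: IH => /=; lia.
  move=> j; rewrite -val_eqE /adjacent /= => jl jl1; apply: IH; lia.
- suff H N (l : 'I_n.+1) : (n <= l + N)%N -> component us i (u l) = 0.
    by apply: (H n); rewrite leq_addl.
  elim: N l => [|N IH] l lN.
    rewrite (_ : l = ord_max) //; apply/val_inj => /=.
    by have := ltn_ord l; lia.
  case: (ltnP l n) => [l0|l0]; last by apply: IH; lia.
  apply: (grow (Ordinal (l0 : (l.+1 < n.+1)%N))).
  - by rewrite /adjacent /= eqxx orbT.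
  - by apply: IH => /=; lia.
  - move=> j; rewrite -val_eqE /adjacent /= => jl jl1; apply: IH; lia.
Qed.

End TridiagonalAction.

Section SplitSequence.
Variables (K : fieldType) (calA : algType K) (V : vectType K).
Variables (act : {linear calA -> 'End(V)}) (n : nat).
Hypothesis irrV : irreducible_module act.

Lemma split_sequence (A As : calA) (th ths : 'I_n.+1 -> K) (vphi : nat -> K)
    (f : {lrmorphism calA -> 'M[K]_n.+1}) :
  bijective f -> f A = lower_bidiag th -> f As = upper_bidiag ths vphi ->
  exists w : nat -> V, [/\ w 0%N != 0 /\ w n != 0,
    forall k, (k < n)%N -> act A (w k) = th (inord k) *: w k + w k.+1,
    act A (w n) = th ord_max *: w n,
    forall k, (k < n)%N ->
      act As (w k.+1) = ths (inord k.+1) *: w k.+1 + vphi k.+1 *: w k &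
    act As (w 0%N) = ths ord0 *: w 0%N].
Proof.
move=> fbij fA fAs; have [w bw actw] := matrix_module_basis fbij irrV.
exists (fun k => w (inord k)).
have io0 : inord 0 = ord0 :> 'I_n.+1 by apply/val_inj; rewrite /= inordK.
have ion : inord n = ord_max :> 'I_n.+1 by apply/val_inj; rewrite /= inordK.
split; first by split; apply: basis_neq0.
- move=> k kn; have kn' : (k < n.+1)%N by lia.
  have kS : inord k.+1 != inord k :> 'I_n.+1.
    by rewrite -val_eqE /= !inordK //; lia.
  rewrite actw fA (bigD1 (inord k)) //= (bigD1 (inord k.+1)) //= big1 ?addr0.
    by rewrite !mxE eqxx (negPf kS) !inordK // eqxx scale1r.
  move=> i /andP [ik ik1]; rewrite mxE (negPf ik).
  move: ik1; rewrite -val_eqE /= !inordK // => /negPf ->.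
  by rewrite scale0r.
- rewrite actw fA ion (bigD1 ord_max) //= big1 ?addr0 => [|i ik].
    by rewrite mxE eqxx.
  rewrite mxE (negPf ik) ltn_eqF ?scale0r //.
- move=> k kn; have kn' : (k < n.+1)%N by lia.
  have kS : inord k != inord k.+1 :> 'I_n.+1.
    by rewrite -val_eqE /= !inordK //; lia.
  rewrite actw fAs (bigD1 (inord k.+1)) //= (bigD1 (inord k)) //= big1 ?addr0.
    by rewrite !mxE eqxx (negPf kS) !inordK // eqxx.
  move=> i /andP [ik ik1]; rewrite mxE (negPf ik) inordK //.
  move: ik1; rewrite -val_eqE /= inordK // => ik1.
  by rewrite eqSS eq_sym (negPf ik1) scale0r.
- rewrite actw fAs io0 (bigD1 ord0) //= big1 ?addr0 => [|i ik].
    by rewrite mxE eqxx.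
  by rewrite mxE (negPf ik) /= scale0r.
Qed.

(** Taking coefficients along [us i] in the action of [As] gives the split
    relations; the growth of the diagonal comes from [A], whose matrix in the
    basis [us] does not depend on the split sequence. *)
Lemma split_array_of_sequence (A As : calA) (us : 'I_n.+1 -> V)
    (th ths : 'I_n.+1 -> K) (vphi : nat -> K) (w : nat -> V) :
  basis_family us -> injective ths ->
  (forall i, act As (us i) = ths i *: us i) -> tridiagonal (mat us (act A)) ->
  (forall k, (k < n)%N -> act A (w k) = th (inord k) *: w k + w k.+1) ->
  (forall k, (k < n)%N ->
      act As (w k.+1) = ths (inord k.+1) *: w k.+1 + vphi k.+1 *: w k) ->
  act As (w 0%N) = ths ord0 *: w 0%N ->
  let a i k := component us (inord i) (w k) in
  split_array n (fun i => ths (inord i)) vphi a /\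
  diagonal_growth n (fun i => mat us (act A) (inord i) (inord i.+1)) a.
Proof.
move=> bus ths_inj usE tri wA wAs w0 a.
have io0 : inord 0 = ord0 :> 'I_n.+1 by apply/val_inj; rewrite /= inordK.
have sa : split_array n (fun i => ths (inord i)) vphi a.
  split=> [i k i_n k_n|i i_n].
    have := component_eigen (inord i) (w k.+1) bus usE.
    rewrite wAs // linearD !linearZ /= => E.
    by rewrite /a mulrBl -E; ring.
  have := component_eigen (inord i) (w 0%N) bus usE.
  by rewrite w0 linearZ /= io0 => E; rewrite /a mulrBl -E subrr.
split=> // i i_n.
have ths_inj' j k : (j <= n)%N -> (k <= n)%N ->
    ths (inord j) = ths (inord k) -> j = k.
  by move=> jn kn /ths_inj/(congr1 val); rewrite /= !inordK.
have low := split_array_lower ths_inj' sa.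
have -> : a i.+1 i.+1 = component us (inord i.+1) (act A (w i)).
  rewrite wA // linearD linearZ /=.
  by rewrite -/(a i.+1 i) (low i.+1 i) // mulr0 add0r.
rewrite component_app // (bigD1 (inord i)) //= big1 ?addr0; first by rewrite mulrC.
move=> l; rewrite -val_eqE /= inordK; last by lia.
move=> li; case: (ltnP l i) => l_i.
  by rewrite tri ?mulr0 // /far inordK //; lia.
have -> : component us l (w i) = a l i by rewrite /a inord_val.
by rewrite low ?mul0r // -1?ltnS //; lia.
Qed.

End SplitSequence.

(** The ratio of the components of [E_d V] and [E_0 V] along [E*_i V], for
    chosen spanning vectors. *)
Definition end_ratio (K : fieldType) (V : vectType K) n (us u : 'I_n.+1 -> V)
    (i : nat) : K :=
  component us (inord i) (u ord_max) / component us (inord i) (u ord0).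

(** The last vectors of the split sequences of [Phi] and of [down Phi] span
    [E_d V] and [E_0 V], so that [split_ratio] gives the relation satisfied by
    the end ratios. The [vphi i] do not vanish because the last vector of the
    sequence has a component along [E*_0 V]. *)
Lemma leonard_eigenbases (K : fieldType) (calA : algType K) (V : vectType K)
    (act : {linear calA -> 'End(V)}) (d : nat)
    (Phi : leonard_seq calA d) (p : param_array K d) :
  matrix_algebra calA d -> irreducible_module act -> leonard_system act Phi ->
  parameter_array_of act Phi p ->
  exists u us : 'I_d.+1 -> V,
  [/\ diagonalizes act (ls_A Phi) (ls_E Phi) u (pa_th p),
    diagonalizes act (ls_As Phi) (ls_Es Phi) us (pa_ths p),
    irreducible_tridiagonal (mat us (act (ls_A Phi))),
    irreducible_tridiagonal (mat u (act (ls_As Phi))) &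
    (forall i, (i < d)%N -> pa_vphi p i.+1 != 0) /\
    (forall i, (i < d)%N ->
       pa_phi p i.+1 * end_ratio us u i = pa_vphi p i.+1 * end_ratio us u i.+1)].
Proof.
move=> [f0 f0bij] irr [[mfA mfAs] oE oEs triEs triE].
move=> [[thP thsP [f [fbij fA fAs]]] [_ _ [f' [fbij' fA' fAs']]]].
have [[act1 actM] _ _] := irr.
have act_inj := act_injective f0bij irr.
have dimV : \dim (fullv : {vspace V}) = d.+1.
  by have [w bw _] := matrix_module_basis f0bij irr; apply: basis_family_dim bw.
have [u [t dE]] := ordering_diagonalizes act_inj dimV mfA oE.
have [us [ts dEs]] := ordering_diagonalizes act_inj dimV mfAs oEs.
have {}dE : diagonalizes act (ls_A Phi) (ls_E Phi) u (pa_th p).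
  have tE i : pa_th p i = t i := diagonalizes_eigenvalue dE (thP i).
  case: dE => bu tinj uE EE; split=> // [i j|i]; rewrite !tE //.
  exact: tinj.
have {}dEs : diagonalizes act (ls_As Phi) (ls_Es Phi) us (pa_ths p).
  have tE i : pa_ths p i = ts i := diagonalizes_eigenvalue dEs (thsP i).
  case: dEs => bu tinj uE EE; split=> // [i j|i]; rewrite !tE //.
  exact: tinj.
have [bu thinj uE EE] := dE; have [bus thsinj usE EsE] := dEs.
have irrA := (tridiagonal_relationsP act_inj actM (ls_A Phi) dEs).1 triEs.
have irrAs := (tridiagonal_relationsP act_inj actM (ls_As Phi) dE).1 triE.
have [w [[w0n wnn] wA wAn wAs wAs0]] := split_sequence irr fbij fA fAs.
have [w' [[w0n' wnn'] wA' wAn' wAs' wAs0']] := split_sequence irr fbij' fA' fAs'.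
have [sa ga] := split_array_of_sequence bus thsinj usE irrA.1 wA wAs wAs0.
have [sa' ga'] := split_array_of_sequence (th := fun i => pa_th p (rev_ord i))
  bus thsinj usE irrA.1 wA' wAs' wAs0'.
have ths_inj' i j : (i <= d)%N -> (j <= d)%N ->
    pa_ths p (inord i) = pa_ths p (inord j) -> i = j.
  by move=> id jd /thsinj/(congr1 val); rewrite /= !inordK.
have line v k : v != 0 -> act (ls_A Phi) v = pa_th p k *: v ->
    exists2 c, c != 0 & v = c *: u k.
  move=> v0 vE; have vEq : v = component u k v *: u k.
    rewrite {1}(component_expand v bu) (bigD1 k) //= big1 ?addr0 // => i ik.
    case: (eqVneq (component u i v) 0) => [->|ci]; first by rewrite scale0r.
    by rewrite (thinj _ _ (eigenvector_component bu uE vE ci)) eqxx in ik.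
  exists (component u k v) => //.
  by apply: contraNneq v0 => c0; rewrite vEq c0 scale0r.
have [c c0 wdE] := line _ _ wnn wAn.
have {}wAn' : act (ls_A Phi) (w' d) = pa_th p ord0 *: w' d.
  by rewrite wAn'; congr (pa_th p _ *: _); apply/val_inj => /=; rewrite subnn.
have [c' c0' wdE'] := line _ _ wnn' wAn'.
have ends i := extreme_component_neq0 i bus bu usE irrAs.
exists u, us; split=> //; split.
  apply: (split_array_neq0 ths_inj' sa).
  rewrite wdE linearZ /= mulf_neq0 //; first by case: (ends (inord 0)).
move=> i id; have := split_ratio ths_inj' sa ga sa' ga' id.
rewrite wdE wdE' !linearZ /= /end_ratio => E.
have [e1 _] := ends (inord i); have [e2 _] := ends (inord i.+1).
have {}E : pa_phi p i.+1 * (component us (inord i) (u ord_max) *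
      component us (inord i.+1) (u ord0)) =
    pa_vphi p i.+1 * (component us (inord i.+1) (u ord_max) *
      component us (inord i) (u ord0)).
  by apply: (mulfI (mulf_neq0 c0 c0')); apply: (etrans _ (etrans E _)); ring.
apply: (mulIf (mulf_neq0 e1 e2)).
transitivity (pa_phi p i.+1 * (component us (inord i) (u ord_max) *
      component us (inord i.+1) (u ord0))); first by field.
by rewrite E; field.
Qed.

(** * Uniqueness up to affine transformation *)

Section BaseChange.
Variables (K : fieldType) (V : vectType K) (n : nat).
Implicit Types (u e : 'I_n.+1 -> V) (T : 'End(V)).

(** Row convention: row [i] contains the coordinates of [u i] in [e]. *)
Definition base_change u e : 'M[K]_n.+1 := \matrix_(i, j) component e j (u i).

Lemma base_change_mul u e : basis_family u -> basis_family e ->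
  base_change u e *m base_change e u = 1%:M.
Proof.
move=> bu be; apply/matrixP => i j; rewrite !mxE eq_sym.
rewrite -(component_basis j i bu) (component_expand (u i) be) linear_sum.
by apply: eq_bigr => k _; rewrite linearZ /= !mxE.
Qed.

Lemma base_change_unit u e : basis_family u -> basis_family e ->
  base_change u e \in unitmx.
Proof. by move=> bu be; case: (mulmx1_unit (base_change_mul bu be)). Qed.

Lemma base_change_diag u e T (t : 'I_n.+1 -> K) : basis_family u ->
  basis_family e -> (forall i, T (u i) = t i *: u i) ->
  base_change u e *m mat e T = diag_mx (\row_i t i) *m base_change u e.
Proof.
move=> bu be uE; apply/matrixP => i j; rewrite mul_diag_mx !mxE.
rewrite -linearZ /= -uE (component_expand (u i) be) !linear_sum.
by apply: eq_bigr => k _; rewrite !linearZ /= !mxE.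
Qed.

Lemma base_change_mat u e T : basis_family u -> basis_family e ->
  base_change u e *m mat e T = mat u T *m base_change u e.
Proof.
move=> bu be; apply/matrixP => i j; rewrite !mxE.
transitivity (component e j (T (u i))).
  rewrite (component_expand (u i) be) !linear_sum.
  by apply: eq_bigr => k _; rewrite !linearZ /= !mxE.
by rewrite (matE T i bu) linear_sum; apply: eq_bigr => k _; rewrite linearZ /= !mxE.
Qed.

Lemma mat_diag u T (t : 'I_n.+1 -> K) : basis_family u ->
  (forall i, T (u i) = t i *: u i) -> mat u T = diag_mx (\row_i t i).
Proof.
move=> bu uE; apply/matrixP => i j; rewrite !mxE uE linearZ /=.
by rewrite component_basis // eq_sym mulr_natr.
Qed.

End BaseChange.

Section Uniqueness.
Variables (K : fieldType) (calA : algType K) (V : vectType K).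
Variables (act : {linear calA -> 'End(V)}) (n : nat).
Hypothesis act_inj : forall a, act a = 0 -> a = 0.
Hypothesis act1 : act 1 = \1%VF.
Hypothesis actM : forall a b, act (a * b) = (act a \o act b)%VF.
Hypothesis dimV : \dim (fullv : {vspace V}) = n.+1.
Hypothesis n_gt0 : (0 < n)%N.

Lemma diagonalizes_same_image a E (u e : 'I_n.+1 -> V) t : diagonalizes act a E u t ->
  basis_family e -> (forall k, limg (act (E k)) = <[e k]>%VS) ->
  diagonalizes act a E e t.
Proof.
move=> dE be limE; have [bu tinj uE EE] := dE.
have eu k : exists c, e k = c *: u k.
  by apply/vlineP; rewrite -(limg_idempotent k dE) limE memv_line.
split=> // [i|k i]; have [c ->] := eu i.
  by rewrite linearZ /= uE !scalerA mulrC.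
by rewrite linearZ /= EE !scalerA mulrC.
Qed.

Lemma affine_of_diagonalizes a a' E E' b b' Es Es' (u us : 'I_n.+1 -> V)
    t t' ts ts' :
  diagonalizes act a E u t -> diagonalizes act a' E' u t' ->
  diagonalizes act b Es us ts -> diagonalizes act b' Es' us ts' ->
  irreducible_tridiagonal (mat us (act a)) ->
  irreducible_tridiagonal (mat us (act a')) ->
  (exists xi zeta, xi != 0 /\ a' = xi *: a + zeta%:A) /\
  (forall i, E' i = E i).
Proof.
move=> [bu tinj uE EE] [_ tinj' uE' EE'] [bus _ _ _] _ irr [tri' _].
have [xi [zeta tE]] := tridiagonal_unique (base_change_unit bu bus) irr tri'
  (base_change_diag bu bus uE) (base_change_diag bu bus uE').
split; last first.
  by move=> i; apply/(act_eq act_inj)/(eq_on_basis bu) => k; rewrite EE EE'.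
exists xi, zeta; split.
  apply/eqP => xi0; have : ord0 = ord_max :> 'I_n.+1.
    by apply: tinj'; rewrite !tE xi0 !mul0r.
  by move/(congr1 val) => /= n0; have := n_gt0; rewrite -n0.
apply/(act_eq act_inj)/(eq_on_basis bu) => k.
rewrite uE' tE linearD !linearZ /= act1 add_lfunE !scale_lfunE id_lfunE uE.
by rewrite scalerA -scalerDl.
Qed.

(** Each of [A], [A*] is diagonal in its own eigenbasis and irreducible
    tridiagonal in that of the other, and the two eigenbases are given by the
    images of the idempotents. *)
Lemma affine_of_same_images (Phi Psi : leonard_seq calA n) :
  leonard_system act Phi -> leonard_system act Psi ->
  (forall i, limg (act (ls_E Psi i)) = limg (act (ls_E Phi i))) ->
  (forall i, limg (act (ls_Es Psi i)) = limg (act (ls_Es Phi i))) ->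
  affine_transformation act Phi Psi.
Proof.
move=> [[mA mAs] oE oEs triEs triE] lPsi imE imEs; split=> //.
case: lPsi => -[mA' mAs'] oE' oEs' triEs' triE'.
have [u [t dE]] := ordering_diagonalizes act_inj dimV mA oE.
have [us [ts dEs]] := ordering_diagonalizes act_inj dimV mAs oEs.
have [u' [t' dE']] := ordering_diagonalizes act_inj dimV mA' oE'.
have [us' [ts' dEs']] := ordering_diagonalizes act_inj dimV mAs' oEs'.
have [bu _ _ _] := dE; have [bus _ _ _] := dEs.
have {}dE' : diagonalizes act (ls_A Psi) (ls_E Psi) u t'.
  apply: (diagonalizes_same_image dE') => // k.
  by rewrite imE (limg_idempotent k dE).
have {}dEs' : diagonalizes act (ls_As Psi) (ls_Es Psi) us ts'.
  apply: (diagonalizes_same_image dEs') => // k.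
  by rewrite imEs (limg_idempotent k dEs).
have tP a b E u0 t0 := @tridiagonal_relationsP _ _ _ act n act_inj actM b E u0 t0 a.
have [[xi [zeta [xi0 AE]]] EE] := affine_of_diagonalizes dE dE' dEs dEs'
  ((tP _ _ _ _ _ dEs).1 triEs) ((tP _ _ _ _ _ dEs').1 triEs').
have [[xis [zetas [xis0 AsE]]] EsE] := affine_of_diagonalizes dEs dEs' dE dE'
  ((tP _ _ _ _ _ dE).1 triE) ((tP _ _ _ _ _ dE').1 triE').
by exists xi, xis, zeta, zetas; split.
Qed.

End Uniqueness.

(** * The matrix of the form *)

Lemma window_bound n d rho m :
  (n <= d)%N -> (rho <= d - n)%N -> (m < n.+1)%N -> (rho + m < d.+1)%N.
Proof. lia. Qed.

Section Form.
Variables (K : fieldType) (V V' : vectType K) (d n rho : nat).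
Variable B : {bilinear V -> V' -> K | *%R & *%R}.
Variables (u us : 'I_d.+1 -> V) (y es' : 'I_n.+1 -> V').
Variables (As : 'End(V)) (ths : 'I_d.+1 -> K).
Hypotheses (le_nd : (n <= d)%N) (le_rho : (rho <= d - n)%N).
Hypotheses (bu : basis_family u) (bus : basis_family us).
Hypotheses (bby : basis_family y) (bes' : basis_family es').
Hypothesis usE : forall i, As (us i) = ths i *: us i.
Hypothesis ths_inj : injective ths.
Hypothesis irrAs : irreducible_tridiagonal (mat u As).
Hypothesis Bus : forall (i : 'I_d.+1) (j : 'I_n.+1),
  (i : nat) <> (j + rho)%N -> B (us i) (es' j) = 0.
Hypothesis Bu : forall (i : 'I_d.+1) (j : 'I_n.+1),
  (i < j)%N \/ (j + (d - n) < i)%N -> B (u i) (y j) = 0.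
Hypothesis Bfull : full_rank B.

Definition window_index (m : 'I_n.+1) : 'I_d.+1 := inord (rho + m).

Lemma window_index_val m : window_index m = (rho + m)%N :> nat.
Proof. by rewrite inordK // (window_bound le_nd le_rho). Qed.

Lemma window_index_inj : injective window_index.
Proof.
move=> i j /(congr1 val); rewrite /= !window_index_val => /addnI.
exact: val_inj.
Qed.

Lemma window_sum (h : 'I_d.+1 -> K) :
  (forall i, (forall m, i != window_index m) -> h i = 0) ->
  \sum_i h i = \sum_m h (window_index m).
Proof.
move=> h0; rewrite (bigID [pred i | i \in codom window_index]) /=.
rewrite [X in _ + X]big1 ?addr0 => [|i iw]; last first.
  by apply: h0 => m; apply: contraNneq iw => ->; exact: codom_f.
rewrite -big_uniq /=; last by rewrite map_inj_uniq ?enum_uniq //; exact: window_index_inj.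
by rewrite big_image.
Qed.

(** Outside the window [us i] is orthogonal to every [es' j], hence to all of
    [V']. *)
Lemma form_outside i v' : (forall m, i != window_index m) -> B (us i) v' = 0.
Proof.
move=> iw; rewrite (component_expand v' bes') linear_sumr big1 // => j _.
rewrite linearZr_LR Bus ?mulr0 // => ij; have := iw j.
by rewrite -val_eqE /= window_index_val ij addnC eqxx.
Qed.

(** For [u ord0] spanning [E_0 V], the vectors whose functionals give
    coordinates on [V']. *)
Definition end_part (k : 'I_d.+1) : V := component us k (u ord0) *: us k.

(** By [base_change_dual], row [j] of this matrix contains the coordinates of
    [y j] in the basis dual to the [end_part (window_index m)]. *)
Definition form_matrix : 'M[K]_n.+1 :=
  \matrix_(j, m) B (end_part (window_index m)) (y j).

Lemma end_component_neq0 k : component us k (u ord0) != 0.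
Proof. by have [] := extreme_component_neq0 k bus bu usE irrAs. Qed.

Lemma form_window_eq0 v' :
  (forall m, B (end_part (window_index m)) v' = 0) -> v' = 0.
Proof.
move=> H; apply: Bfull => v; rewrite (component_expand v bus) linear_sumlz.
rewrite big1 // => i _; rewrite linearZl_LR.
case: (boolP [exists m, i == window_index m]) => [/existsP [m /eqP ->]|].
  have /eqP := H m; rewrite linearZl_LR mulf_eq0 (negPf (end_component_neq0 _)).
  by move/eqP => ->; rewrite mulr0.
rewrite negb_exists => /forallP iw.
by rewrite form_outside ?mulr0.
Qed.

Lemma form_matrix_unit : form_matrix \in unitmx.
Proof.
rewrite -row_free_unit -kermx_eq0; apply/rowV0P => c /sub_kermxP cQ.
have v0 : \sum_j c 0 j *: y j = 0.
  apply: form_window_eq0 => m; rewrite linear_sumr.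
  have /matrixP/(_ 0 m) := cQ; rewrite !mxE => E; rewrite -[RHS]E.
  by apply: eq_bigr => j _; rewrite linearZr_LR mxE.
by apply/rowP => j; rewrite mxE -(component_lincomb (fun j => c 0 j) j bby) v0 linear0.
Qed.

Lemma iter_eigen k v i : component us i (iter k As v) =
  ths i ^+ k * component us i v.
Proof.
elim: k => [|k IH]; first by rewrite mul1r.
by rewrite /= (component_eigen _ _ bus usE) IH exprS mulrA.
Qed.

(** The sum over the window is the sum over all nodes, the other terms being
    zero, and the latter is the expansion of [As^k v] in the basis [us]. *)
Lemma form_matrix_power (j : 'I_n.+1) k v :
  \sum_m (component us (window_index m) v / component us (window_index m) (u ord0))
    * form_matrix j m * ths (window_index m) ^+ k = B (iter k As v) (y j).
Proof.
rewrite [in RHS](component_expand (iter k As v) bus) linear_sumlz window_sum.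
  apply: eq_bigr => m _; rewrite mxE !linearZl_LR iter_eigen.
  by field; exact: end_component_neq0.
by move=> i iw; rewrite linearZl_LR form_outside ?mulr0.
Qed.

Lemma form_iter_eq0 k (l : 'I_d.+1) (j : 'I_n.+1) :
  (forall i : 'I_d.+1, (i <= l + k)%N -> (l <= i + k)%N -> B (u i) (y j) = 0) ->
  B (iter k As (u l)) (y j) = 0.
Proof.
move=> H; rewrite (component_expand (iter k As (u l)) bu) linear_sumlz big1 //.
move=> i _; rewrite linearZl_LR.
case: (boolP ((l + k < i) || (i + k < l))%N) => il.
  by rewrite component_iter ?mul0r //; case: irrAs.
by rewrite H ?mulr0 //; move: il; lia.
Qed.

Let x m := ths (window_index m).

(** [As^k (u ord0)] lies in the span of the [u i] with [i <= k], to which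
    [y j] is orthogonal if [k < j]. *)
Lemma form_matrix_low : annihilates_low_degrees form_matrix x.
Proof.
move=> j k kj; rewrite -[RHS](_ : B (iter k As (u ord0)) (y j) = 0).
  rewrite -form_matrix_power; apply: eq_bigr => m _.
  by rewrite divff ?mul1r ?end_component_neq0.
by apply: form_iter_eq0 => i ik _; apply: Bu; left; move: ik; rewrite /=; lia.
Qed.

(** The same argument started from [u ord_max]. *)
Lemma form_matrix_high : annihilates_low_degrees
  (reversed form_matrix (fun m => end_ratio us u (rho + m))) x.
Proof.
move=> j k kj.
rewrite -[RHS](_ : B (iter k As (u ord_max)) (y (rev_ord j)) = 0).
  rewrite -form_matrix_power; apply: eq_bigr => m _.
  by rewrite [X in X * _]mxE mulrC [in RHS]mulrC [form_matrix _ _ * _]mulrC.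
apply: form_iter_eq0 => i _ ik; apply: Bu; right.
by move: ik; rewrite /=; have := ltn_ord j; lia.
Qed.

Lemma window_nodes_inj : injective x.
Proof. by move=> i j /ths_inj/window_index_inj. Qed.

Lemma form_dual_eq0 m m' : m != m' -> B (end_part (window_index m)) (es' m') = 0.
Proof.
move=> mm'; rewrite linearZl_LR Bus ?mulr0 // window_index_val addnC => /addIn.
by move/val_inj => e; rewrite e eqxx in mm'.
Qed.

Lemma form_dual_neq0 m : B (end_part (window_index m)) (es' m) != 0.
Proof.
apply: contraNneq (basis_neq0 m bes') => E; apply/eqP.
apply: form_window_eq0 => m'; case: (eqVneq m' m) => [->//|m'm].
exact: form_dual_eq0.
Qed.

Definition dual_vector m : V' :=
  (B (end_part (window_index m)) (es' m))^-1 *: es' m.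

Lemma dual_vector_form m m' :
  B (end_part (window_index m)) (dual_vector m') = (m == m')%:R.
Proof.
rewrite linearZr_LR; case: (eqVneq m m') => [->|mm'].
  by rewrite mulVf ?form_dual_neq0.
by rewrite (form_dual_eq0 mm') mulr0.
Qed.

Lemma dual_vector_basis : basis_family dual_vector.
Proof.
apply: basis_family_free (basis_family_dim bes') _ => c c0 i.
have : B (end_part (window_index i)) (\sum_j c j *: dual_vector j) = 0.
  by rewrite c0 linear0r.
rewrite linear_sumr (bigD1 i) //= big1 ?addr0 => [|j ji].
  by rewrite linearZr_LR dual_vector_form eqxx mulr1.
by rewrite linearZr_LR dual_vector_form eq_sym (negPf ji) mulr0.
Qed.

Lemma dual_vector_line m : <[dual_vector m]>%VS = <[es' m]>%VS.
Proof.
apply/eqP; rewrite eqEdim -memvE memvZ ?memv_line //= !dim_vline basis_neq0 //.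
by rewrite basis_neq0 //; exact: dual_vector_basis.
Qed.

Lemma base_change_dual : base_change y dual_vector = form_matrix.
Proof.
apply/matrixP => j m; rewrite !mxE.
rewrite [in RHS](component_expand (y j) dual_vector_basis) linear_sumr.
rewrite (bigD1 m) //= big1 ?addr0 => [|i im].
  by rewrite linearZr_LR dual_vector_form eqxx mulr1.
by rewrite linearZr_LR dual_vector_form eq_sym (negPf im) mulr0.
Qed.

End Form.

(** * Existence of the descendent *)

(** Case IV does not occur here, as it has [d = 3] and [n] equal to 1 or
    3. *)
Lemma proper_descendent_matrix (K : fieldType) (L : closedFieldType)
    (iota : {rmorphism K -> L}) (d : nat) (p : param_array K d) (c : pa_case)
    (g : nat -> K) (n rho : nat) (Q : 'M[K]_n.+1) :
  let x (m : 'I_n.+1) := pa_ths p (inord (rho + m)) in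
  pa_form iota p c -> injective (pa_th p) -> injective (pa_ths p) ->
  (forall i, (i < d)%N -> pa_vphi p i.+1 != 0) ->
  (forall i, (i <= d)%N -> g i != 0) ->
  (forall i, (i < d)%N -> pa_phi p i.+1 * g i = pa_vphi p i.+1 * g i.+1) ->
  (1 < n)%N -> (n < d)%N -> (rho <= d - n)%N ->
  (c = CaseIII -> (~~ odd d -> n = 1%N \/ ~~ odd n) /\
     (odd d -> odd n /\ ~~ odd rho)) ->
  (c = CaseIV -> [\/ n = 1%N /\ rho = 0%N, n = 1%N /\ rho = 2%N |
     n = 3%N /\ rho = 0%N]) ->
  Q \in unitmx -> annihilates_low_degrees Q x ->
  annihilates_low_degrees (reversed Q (fun m => g (rho + m)%N)) x ->
  exists (t : 'I_n.+1 -> K) (Y : 'M[K]_n.+1),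
    [/\ injective t, tridiagonal Y & Q *m Y = diag_mx (\row_k t k) *m Q].
Proof.
move=> x formp th_inj ths_inj vphi0 g0 gE n_gt1 n_lt le_rho cIII cIV Qu Q0 Qr0.
have small (m : 'I_n.+1) : (rho + m < d.+1)%N by have := ltn_ord m; lia.
have x_inj : injective x.
  move=> i j /ths_inj/(congr1 val); rewrite /= !inordK // => /addnI.
  exact: val_inj.
have gn0 (m : 'I_n.+1) : g (rho + m)%N != 0.
  by apply: g0; rewrite -ltnS.
pose xL (i : nat) := iota (pa_ths p (inord i)).
have [lam lam_inj [Y [lamt [Ytri Ydeg Ygdeg]]]] :
    window_operator n rho xL (fun i => iota (g i)).
  case: c cIII cIV formp => cIII cIV formp.
  - exact: (window_operator_I th_inj).
  - exact: (window_operator_IA th_inj).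
  - exact: (window_operator_II th_inj).
  - exact: (window_operator_IIA th_inj).
  - exact: (window_operator_IIB th_inj).
  - exact: (window_operator_IIC th_inj).
  - have [cE cO] := cIII erefl; apply: (window_operator_III th_inj) => //.
    by move=> dE; case: (cE dE) => // n1; rewrite n1 in n_gt1.
  - case: formp => _ d3 _; case: (cIV erefl) => -[]; lia.
have lamI : injective (fun k : 'I_n.+1 => lam k).
  by move=> i j /lam_inj H; apply/val_inj/H; rewrite -ltnS.
have low (R : 'M[K]_n.+1) : annihilates_low_degrees R x ->
    annihilates_low_degrees (map_mx iota R) (fun m => xL (rho + m)%N).
  move=> R0 j k kj; have /(congr1 iota) := R0 j k kj.
  rewrite rmorph0 rmorph_sum => E; rewrite -[RHS]E.
  by apply: eq_bigr => m _; rewrite mxE rmorphM rmorphXn.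
have QL : map_mx iota Q *m Y = diag_mx (\row_k lam k) *m map_mx iota Q.
  apply: (diagonal_of_two_filtrations (x := fun m : 'I_n.+1 => xL (rho + m)%N)
    (g := fun m : 'I_n.+1 => iota (g (rho + m)%N)) (lamt := lamt)) => //.
  - by rewrite map_unitmx.
  - by move=> i j /fmorph_inj/x_inj.
  - by move=> m; rewrite fmorph_eq0.
  - exact: low.
  - move=> j k kj; apply: etrans (low _ Qr0 j k kj); apply: eq_bigr => m _.
    by rewrite !mxE rmorphM.
pose M := Q *m diag_mx (\row_m x m) *m invmx Q.
have QX : Q *m diag_mx (\row_m x m) = M *m Q by rewrite /M mulmxKV.
have Mirr := nodes_irreducible_tridiagonal Qu x_inj gn0 Q0 Qr0 QX.
exact: (tridiagonal_descent (ltnW n_gt1) Qu QX Mirr lamI Ytri QL).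
Qed.

Section Existence.
Variables (K : fieldType) (L : closedFieldType) (iota : {rmorphism K -> L}).
Variables (V V' : vectType K) (d n rho : nat).
Variable B : {bilinear V -> V' -> K | *%R & *%R}.
Variables (u us : 'I_d.+1 -> V) (y es' : 'I_n.+1 -> V').
Variables (A As : 'End(V)) (p : param_array K d) (c : pa_case).
Hypotheses (n_gt0 : (0 < n)%N) (le_nd : (n <= d)%N) (le_rho : (rho <= d - n)%N).
Hypotheses (bu : basis_family u) (bus : basis_family us).
Hypotheses (bby : basis_family y) (bes' : basis_family es').
Hypothesis uE : forall i, A (u i) = pa_th p i *: u i.
Hypothesis usE : forall i, As (us i) = pa_ths p i *: us i.
Hypotheses (th_inj : injective (pa_th p)) (ths_inj : injective (pa_ths p)).
Hypothesis irrA : irreducible_tridiagonal (mat us A).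
Hypothesis irrAs : irreducible_tridiagonal (mat u As).
Hypothesis vphi_neq0 : forall i, (i < d)%N -> pa_vphi p i.+1 != 0.
Hypothesis ratioE : forall i, (i < d)%N ->
  pa_phi p i.+1 * end_ratio us u i = pa_vphi p i.+1 * end_ratio us u i.+1.
Hypothesis formp : pa_form iota p c.
Hypothesis condIII : c = CaseIII -> (~~ odd d -> n = 1%N \/ ~~ odd n) /\
     (odd d -> odd n /\ ~~ odd rho).
Hypothesis condIV : c = CaseIV ->
  [\/ n = 1%N /\ rho = 0%N, n = 1%N /\ rho = 2%N | n = 3%N /\ rho = 0%N].
Hypothesis Bus : forall (i : 'I_d.+1) (j : 'I_n.+1),
  (i : nat) <> (j + rho)%N -> B (us i) (es' j) = 0.
Hypothesis Bu : forall (i : 'I_d.+1) (j : 'I_n.+1),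
  (i < j)%N \/ (j + (d - n) < i)%N -> B (u i) (y j) = 0.
Hypothesis Bfull : full_rank B.

Let Q := form_matrix rho B u us y.

(** For equal diameters the form identifies [V'] with the dual of [V], and the
    matrix is that of the adjoint of [A] in the basis dual to the
    [end_part]s. *)
Lemma full_diameter_matrix : n = d ->
  exists Y : 'M[K]_n.+1, exists2 t : 'I_n.+1 -> K, injective t &
    tridiagonal Y /\ Q *m Y = diag_mx (\row_k t k) *m Q.
Proof.
move=> n_d.
have B0 (i : 'I_d.+1) (j : 'I_n.+1) : i != j :> nat -> B (u i) (y j) = 0.
  by move=> ij; apply: Bu; lia.
have rho0 : rho = 0%N by lia.
pose win := window_index d rho (n := n).
have winE m : win m = m :> nat by rewrite (window_index_val le_nd le_rho) rho0.
have win_inj : injective win by apply: (window_index_inj le_nd le_rho).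
pose cm (i : 'I_d.+1) := component us i (u ord0).
have cm0 i : cm i != 0 by apply: (end_component_neq0 bu bus usE irrAs).
exists (\matrix_(l, m) (cm (win m) * mat us A (win m) (win l) / cm (win l))).
exists (fun j => pa_th p (win j)); first by move=> i j /th_inj/win_inj.
split=> [l m lm|].
  rewrite mxE (irrA.1 _ _ _) ?mulr0 ?mul0r //.
  by move: lm; rewrite /far !winE; lia.
apply/matrixP => j m; rewrite mul_diag_mx !mxE.
have BA v : B (A v) (y j) = pa_th p (win j) * B v (y j).
  rewrite (component_expand v bu) linear_sum !linear_sumlz mulr_sumr.
  apply: eq_bigr => i _; rewrite linearZ /= uE scalerA !linearZl_LR.
  case: (eqVneq (i : nat) j) => [ij|ij]; last by rewrite B0 // !mulr0.
  have -> : win j = i by apply/val_inj; rewrite /= winE.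
  by rewrite mulrCA mulrA.
rewrite -BA [A _]linearZ /= (matE A (win m) bus) scaler_sumr linear_sumlz.
rewrite (window_sum le_nd le_rho) => [|i iw].
  apply: eq_bigr => l _; rewrite !mxE scalerA !linearZl_LR.
  by rewrite -!/(cm _); field; exact: cm0.
have := iw (inord i); rewrite -val_eqE /= (window_index_val le_nd le_rho) rho0 inordK ?eqxx //.
by have := ltn_ord i; lia.
Qed.

Lemma descendent_matrix :
  exists (t : 'I_n.+1 -> K) (Y : 'M[K]_n.+1),
    [/\ injective t, tridiagonal Y & Q *m Y = diag_mx (\row_k t k) *m Q].
Proof.
have Qu : Q \in unitmx by exact: (form_matrix_unit le_nd le_rho bu bus bby bes' usE irrAs Bus Bfull).
case: (eqVneq n 1%N) => [n1|n1].
  (* With two nodes every matrix is tridiagonal. *)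
  exists (fun k : 'I_n.+1 => (k : nat)%:R).
  exists (invmx Q *m diag_mx (\row_k (k : nat)%:R) *m Q); split.
  - move=> i j ij; have i2 : (i < 2)%N by have := ltn_ord i; lia.
    have j2 : (j < 2)%N by have := ltn_ord j; lia.
    apply/val_inj; move: ij i2 j2 => /=.
    case: (nat_of_ord i) (nat_of_ord j) => [|[|//]] [|[|//]] // /eqP.
      by rewrite eq_sym oner_eq0.
    by rewrite oner_eq0.
  - move=> i j; have := ltn_ord i; have := ltn_ord j; rewrite /far; lia.
  - by rewrite mulmxA mulmxA mulmxV // mul1mx.
case: (eqVneq n d) => [n_d|n_d].
  have [Y [t tinj [Ytri QY]]] := full_diameter_matrix n_d.
  by exists t, Y.
apply: (proper_descendent_matrix (g := end_ratio us u) (rho := rho) formp) => //.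
- move=> i id; have [e1 e2] := extreme_component_neq0 (inord i) bus bu usE irrAs.
  by rewrite mulf_neq0 ?invr_eq0.
- lia.
- lia.
- exact: (form_matrix_low le_nd le_rho bu bus bby bes' usE irrAs Bus Bu).
- exact: (form_matrix_high le_nd le_rho bu bus bby bes' usE irrAs Bus Bu).
Qed.

End Existence.

Theorem mainTheorem3
    (K : fieldType) (L : closedFieldType) (iota : {rmorphism K -> L})
    (closureL : algebraic_closure iota)
    (d : nat) (d_gt0 : (0 < d)%N)
    (calA : algType K) (V : vectType K) (act : {linear calA -> 'End(V)})
    (matA : matrix_algebra calA d) (irrV : irreducible_module act)
    (Phi : leonard_seq calA d) (leonardPhi : leonard_system act Phi)
    (p : param_array K d) (paPhi : parameter_array_of act Phi p)
    (c : pa_case) (formp : pa_form iota p c)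
    (d' : nat) (d'_gt0 : (0 < d')%N) (le_d'd : (d' <= d)%N)
    (calA' : algType K) (V' : vectType K) (act' : {linear calA' -> 'End(V')})
    (matA' : matrix_algebra calA' d') (irrV' : irreducible_module act')
    (rho : nat) (le_rho : (rho <= d - d')%N)
    (condIII : c = CaseIII ->
       (~~ odd d -> d' = 1%N \/ ~~ odd d') /\
       (odd d -> odd d' /\ ~~ odd rho))
    (condIV : c = CaseIV ->
       [\/ d' = 1%N /\ rho = 0%N, d' = 1%N /\ rho = 2%N |
           d' = 3%N /\ rho = 0%N])
    (U' Us' : 'I_d'.+1 -> {vspace V'})
    (decU' : decomposition U') (decUs' : decomposition Us')
    (B : {bilinear V -> V' -> K | *%R & *%R})
    (B_i : forall (i : 'I_d.+1) (j : 'I_d'.+1), (i : nat) <> (j + rho)%N ->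
       orthogonal_spaces B (limg (act (ls_Es Phi i))) (Us' j))
    (B_ii : forall (i : 'I_d.+1) (j : 'I_d'.+1),
       (i < j)%N \/ (j + (d - d') < i)%N ->
       orthogonal_spaces B (limg (act (ls_E Phi i))) (U' j))
    (B_iii : full_rank B) :
  let good (Phi' : leonard_seq calA' d') : Prop :=
    [/\ descendent act act' rho Phi Phi',
        forall i, limg (act' (ls_E Phi' i)) = U' i &
        forall i, limg (act' (ls_Es Phi' i)) = Us' i] in
  exists Phi' : leonard_seq calA' d',
    [/\ good Phi',
        balanced_form B act act' rho Phi Phi' &
        forall Phi'' : leonard_seq calA' d', good Phi'' ->
          affine_transformation act' Phi' Phi''].
Proof.
move=> good.
have [u [us [dE dEs irrA irrAs [vphi0 ratioE]]]] :=
  leonard_eigenbases matA irrV leonardPhi paPhi.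
have [bu th_inj uE EE] := dE; have [bus ths_inj usE EsE] := dEs.
have [y bby yU] := decomposition_basis decU'.
have [e' be' eUs] := decomposition_basis decUs'.
have [f' f'bij] := matA'; have [[act1' actM'] _ _] := irrV'.
have act_inj' := act_injective f'bij irrV'.
have lift := act_surjective f'bij irrV'.
have Bus (i : 'I_d.+1) (j : 'I_d'.+1) :
    (i : nat) <> (j + rho)%N -> B (us i) (e' j) = 0.
  move=> ij; apply: (B_i i j ij (us i) (e' j)); last by rewrite eUs memv_line.
  by rewrite (limg_idempotent i dEs) memv_line.
have Bu (i : 'I_d.+1) (j : 'I_d'.+1) :
    (i < j)%N \/ (j + (d - d') < i)%N -> B (u i) (y j) = 0.
  move=> ij; apply: (B_ii i j ij (u i) (y j)); last by rewrite yU memv_line.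
  by rewrite (limg_idempotent i dE) memv_line.
have [t [Y [t_inj Ytri QY]]] := descendent_matrix d'_gt0 le_d'd le_rho bu bus bby
  be' uE usE th_inj ths_inj irrA irrAs vphi0 ratioE formp condIII condIV Bus Bu B_iii.
set Q := form_matrix rho B u us y in QY.
have Qu : Q \in unitmx.
  exact: (form_matrix_unit le_d'd le_rho bu bus bby be' usE irrAs Bus B_iii).
have Q0 := form_matrix_low le_d'd le_rho bu bus bby be' usE irrAs Bus Bu.
have Qr0 := form_matrix_high le_d'd le_rho bu bus bby be' usE irrAs Bus Bu.
pose x (m : 'I_d'.+1) := pa_ths p (window_index d rho m).
have x_inj : injective x by exact: (window_nodes_inj le_d'd le_rho).
pose e := dual_vector rho B u us e'.
have be : basis_family e.
  exact: (dual_vector_basis le_d'd le_rho bu bus be' usE irrAs Bus B_iii).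
have QE : base_change y e = Q.
  exact: (base_change_dual _ le_d'd le_rho bu bus be' usE irrAs Bus B_iii).
have [a aE] := lift (linfun (extend y (fun i => t i *: y i))).
have [b bE] := lift (linfun (extend e (fun i => x i *: e i))).
have /fin_all_exists [E' E'E] : forall k : 'I_d'.+1, exists e0,
    act' e0 = linfun (extend y (fun i => (k == i)%:R *: y i)) by [].
have /fin_all_exists [Es' Es'E] : forall k : 'I_d'.+1, exists e0,
    act' e0 = linfun (extend e (fun i => (k == i)%:R *: e i)) by [].
have da : diagonalizes act' a E' y t.
  by split=> // [i|k i]; rewrite ?aE ?E'E extend_basis.
have db : diagonalizes act' b Es' e x.
  by split=> // [i|k i]; rewrite ?bE ?Es'E extend_basis.
have [_ _ ya _] := da; have [_ _ eb _] := db.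
have YE : mat e (act' a) = Y.
  have := base_change_diag bby be ya; rewrite QE -QY => H.
  by rewrite -[LHS](mulKmx Qu) H mulKmx.
have QX : Q *m diag_mx (\row_m x m) = mat y (act' b) *m Q.
  by rewrite -(mat_diag be eb) -QE; apply: base_change_mat.
have gn0 (m : 'I_d'.+1) : end_ratio us u (rho + m) != 0.
  have [e1 e2] := extreme_component_neq0 (inord (rho + m)) bus bu usE irrAs.
  by rewrite mulf_neq0 ?invr_eq0.
have irr_b := nodes_irreducible_tridiagonal Qu x_inj gn0 Q0 Qr0 QX.
have irr_a := irreducible_of_tridiagonal Qu t_inj Ytri QY QX irr_b.
pose Phi' := LeonardSeq a b E' Es'.
have leonardPhi' : leonard_system act' Phi'.
  have [mfa oa] := diagonalizes_ordering act_inj' da.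
  have [mfb ob] := diagonalizes_ordering act_inj' db.
  split=> //.
    by apply/(tridiagonal_relationsP act_inj' actM' a db); rewrite YE.
  exact/(tridiagonal_relationsP act_inj' actM' b da).
have imE k : limg (act' (ls_E Phi' k)) = U' k.
  by rewrite (limg_idempotent k da) yU.
have imEs k : limg (act' (ls_Es Phi' k)) = Us' k.
  rewrite (limg_idempotent k db) eUs.
  exact: (dual_vector_line le_d'd le_rho bu bus be' usE irrAs Bus B_iii).
have balanced : balanced_form B act act' rho Phi Phi'.
  split=> //.
  - exists (end_part u us (window_index d rho (ord0 : 'I_d'.+1))), (e' ord0).
    exact: (form_dual_neq0 le_d'd le_rho bu bus be' usE irrAs Bus B_iii).
  - by move=> i j ij; rewrite imEs; apply: B_i.
  - by move=> i j ij; rewrite imE; apply: B_ii.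
exists Phi'; split=> //; first by split=> //; split=> //; exists B.
move=> Psi [[_ leonardPsi _] imPsi imsPsi].
apply: (affine_of_same_images act_inj' act1' actM' (basis_family_dim bby) d'_gt0
  leonardPhi' leonardPsi) => i.
  by rewrite imPsi imE.
by rewrite imsPsi imEs.
Qed.
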